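(* Let $X$ be a connected, oriented surface, let $f\colon X\to X$ be an orientation-preserving homeomorphism, let $p\in X\setminus\partial X$ be a direct saddle fixed point of $f$, and let $V\subset X$ be a homoclinic cell at $p$. Let $r\in\mathbb{N}$ be such that every periodic orbit of $f$ contained in $V$ with minimum period $2^k$, $0\le k\le r$, is hyperbolic. Then either (a) $V$ contains an attracting or repelling periodic orbit of minimum period $2^k$ for some $k\in\{0,\dots,r\}$, or (b) $V$ contains a twisted saddle orbit of cardinality $2^k$ for every $k=0,\dots,r$.
   Context: A fixed point $q$ of a map $h$ is smooth if it lies in a coordinate chart in which $h$ is represented by a $C^1$ map; for smooth $q$, it is hyperbolic if no eigenvalue of $dh_q$ lies on the unit circle, a sink (attracting) if all eigenvalues lie inside the unit circle, a source (repelling) if all lie outside. A fixed point $q\notin\partial X$ of $h$ is a direct saddle (resp. twisted saddle) if there is a chart sending $q$ to $0\in\mathbb{R}^2$ in which $h$ is locally represented by $(x,y)\mapsto(\mu x,\lambda y)$ with $\mu>1>\lambda>0$ (resp. $\mu<-1<\lambda<0$); such a chart is diagonalizing. An $n$-periodic point of $f$ is a fixed point of $f^n$; it is hyperbolic, attracting, a twisted saddle, etc., if it has that property as a fixed point of $f^n$, and if $n$ is its minimum period its orbit is called an $n$-orbit. The stable curve $W_s(p)$ is the connected component containing $p$ of the set of $x\in X$ for which there is a sequence $(x_k)_{k\ge0}$ with $x_0=x$, $f(x_k)=x_{k+1}$, $x_k\to p$; $W_u(p)$ is the stable curve of $p$ for $f^{-1}$. A homoclinic point is $p'\in(W_s(p)\cap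 W_u(p))\setminus\{p\}$; it determines the loop $J_s\cup J_u$ with $J_s\subset W_s(p)$, $J_u\subset W_u(p)$ the arcs with endpoints $p,p'$, simple if $J_s\cap J_u=\{p,p'\}$. A homoclinic cell is $V=D\setminus\partial D$ where $D\subset X$ is a closed 2-cell whose boundary is a simple homoclinic loop at $p$. *)

(* Defs.v *)
From mathcomp Require Import all_boot all_order all_algebra.
From mathcomp Require Import all_classical all_reals all_analysis.
From mathcomp Require Import complex.
Import numFieldNormedType.Exports.
Import Order.TTheory GRing.Theory Num.Theory.

Set Implicit Arguments.
Unset Strict Implicit.
Unset Printing Implicit Defensive.

Local Open Scope classical_set_scope.
Local Open Scope ring_scope.

Section Surfaces.
Variable R : realType.

Definition halfplane : set (R * R) := [set z | 0 <= z.2].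

Record chart (T : topologicalType) := Chart {
  ch_dom : set T;
  ch_map : T -> R * R;
  ch_inv : R * R -> T;
  ch_img : set (R * R) }.

Variable T : topologicalType.

Definition is_chart (c : chart T) : Prop :=
  open (ch_dom c) /\
  (forall x, ch_dom c x -> (ch_img c (ch_map c x) /\ ch_inv c (ch_map c x) = x)) /\
  (forall z, ch_img c z -> (ch_dom c (ch_inv c z) /\ ch_map c (ch_inv c z) = z)) /\
  {within ch_dom c, continuous (ch_map c)} /\
  {within ch_img c, continuous (ch_inv c)} /\
  (open (ch_img c) \/ exists O : set (R * R), open O /\ ch_img c = O `&` halfplane).

Definition surface : Prop :=
  hausdorff_space T /\ forall x : T, exists c, is_chart c /\ ch_dom c x.

Definition boundary_pt (x : T) : Prop :=
  exists c, [/\ is_chart c, ch_dom c x,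
    (exists O : set (R * R), open O /\ ch_img c = O `&` halfplane) &
    (ch_map c x).2 = 0].

Definition interior_in (W : set (R * R)) (z : R * R) : Prop :=
  exists e : R, 0 < e /\ ball z e `<=` W.

Definition winds (gamma : R -> R * R) (c : R * R) (n : int) : Prop :=
  (forall t, 0 <= t <= 1 -> gamma t <> c) /\
  exists theta : R -> R,
    [/\ {within [set t | 0 <= t <= 1], continuous theta},
        (forall t, 0 <= t <= 1 ->
           let d1 := (gamma t).1 - c.1 in let d2 := (gamma t).2 - c.2 in
           (d1 = Num.sqrt (d1 ^+ 2 + d2 ^+ 2) * cos (theta t) /\
            d2 = Num.sqrt (d1 ^+ 2 + d2 ^+ 2) * sin (theta t))) &
        theta 1 - theta 0 = 2 * pi * n%:~R].

Definition circ (z : R * R) (r : R) (t : R) : R * R :=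
  (z.1 + r * cos (2 * pi * t), z.2 + r * sin (2 * pi * t)).

(** g (defined on D) is locally orientation preserving at z: local degree +1. *)
Definition loc_orient_pres (g : R * R -> R * R) (D : set (R * R)) (z : R * R) : Prop :=
  exists e : R, [/\ 0 < e, ball z e `<=` D &
    forall r : R, 0 < r < e -> winds (fun t => g (circ z r t)) (g z) 1].

Definition oriented_atlas (A : set (chart T)) : Prop :=
  [/\ (forall c, A c -> is_chart c),
      (forall x, exists c, A c /\ ch_dom c x) &
      (forall c c' x, A c -> A c' -> ch_dom c x -> ch_dom c' x ->
         let D := ch_map c @` (ch_dom c `&` ch_dom c') in
         interior_in D (ch_map c x) ->
         loc_orient_pres (fun z => ch_map c' (ch_inv c z)) D (ch_map c x))].

Definition orient_pres (A : set (chart T)) (f : T -> T) : Prop :=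
  forall c c' x, A c -> A c' -> ch_dom c x -> ch_dom c' (f x) ->
    let D := ch_map c @` (ch_dom c `&` f @^-1` ch_dom c') in
    interior_in D (ch_map c x) ->
    loc_orient_pres (fun z => ch_map c' (f (ch_inv c z))) D (ch_map c x).

Definition C1_on (g : R * R -> R * R) (O : set (R * R)) : Prop :=
  (forall z, O z -> differentiable g z) /\
  {within O, continuous (fun z => ('d g z (1, 0), 'd g z (0, 1)))}.

Definition jac (g : R * R -> R * R) (z : R * R) : 'M[R]_2 :=
  \matrix_(i < 2, j < 2)
    (let v := 'd g z (if j == ord0 then (1, 0) else (0, 1)) in
     if i == ord0 then v.1 else v.2).

Definition smooth_fixed_with (h : T -> T) (q : T) (P : R[i] -> Prop) : Prop :=
  h q = q /\
  exists (c : chart T) (O : set (R * R)),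
    is_chart c /\ ch_dom c q /\ open O /\ O (ch_map c q) /\ O `<=` ch_img c /\
        (forall z, O z -> ch_dom c (h (ch_inv c z))) /\
        C1_on (fun z => ch_map c (h (ch_inv c z))) O /\
        (forall l : R[i],
          eigenvalue (map_mx (fun a : R => (a%:C)%C) (jac (fun z => ch_map c (h (ch_inv c z))) (ch_map c q))) l ->
          P l).

Definition hyperbolic_fixed (h : T -> T) (q : T) : Prop :=
  smooth_fixed_with h q (fun l => `|l| != 1).
Definition sink_fixed (h : T -> T) (q : T) : Prop :=
  smooth_fixed_with h q (fun l => `|l| < 1).
Definition source_fixed (h : T -> T) (q : T) : Prop :=
  smooth_fixed_with h q (fun l => 1 < `|l|).

Definition diag_rep (h : T -> T) (q : T) (mu la : R) : Prop :=
  exists (c : chart T) (O : set (R * R)),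
    is_chart c /\ ch_dom c q /\ ch_map c q = (0, 0) /\ open O /\ O (0, 0) /\
        O `<=` ch_img c /\
        (forall z, O z -> (ch_dom c (h (ch_inv c z)) /\
                         ch_map c (h (ch_inv c z)) = (mu * z.1, la * z.2))).

Definition direct_saddle (h : T -> T) (q : T) : Prop :=
  h q = q /\ ~ boundary_pt q /\
  exists mu la : R, [/\ 1 < mu, 0 < la, la < 1 & diag_rep h q mu la].

Definition twisted_saddle (h : T -> T) (q : T) : Prop :=
  h q = q /\ ~ boundary_pt q /\
  exists mu la : R, [/\ mu < -1, -1 < la, la < 0 & diag_rep h q mu la].

Definition min_period (f : T -> T) (q : T) (n : nat) : Prop :=
  (0 < n)%N /\ iter n f q = q /\ forall m, (0 < m < n)%N -> iter m f q <> q.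

Definition orbit_of (f : T -> T) (q : T) : set T := range (fun i => iter i f q).

Definition stable_curve (f : T -> T) (p : T) : set T :=
  connected_component [set x | (fun k => iter k f x) @ \oo --> p] p.

Definition is_arc (J : set T) (a b : T) : Prop :=
  exists gamma : R -> T,
    [/\ {within [set t : R | 0 <= t <= 1], continuous gamma},
        (forall s t, 0 <= s <= 1 -> 0 <= t <= 1 -> gamma s = gamma t -> s = t),
        gamma 0 = a, gamma 1 = b &
        J = gamma @` [set t : R | 0 <= t <= 1]].

Definition closed_disk : set (R * R) := [set z | z.1 ^+ 2 + z.2 ^+ 2 <= 1].
Definition unit_circle : set (R * R) := [set z | z.1 ^+ 2 + z.2 ^+ 2 = 1].

(** V is a homoclinic cell at p for f (finv the inverse of f): V = D \ bD,
    D a closed 2-cell whose boundary bD is a simple homoclinic loop at p. *)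
Definition homoclinic_cell (f finv : T -> T) (p : T) (V : set T) : Prop :=
  exists (e : R * R -> T),
    [/\ {within closed_disk, continuous e},
        (forall u v, closed_disk u -> closed_disk v -> e u = e v -> u = v),
        V = (e @` closed_disk) `\` (e @` unit_circle) &
        exists (p' : T) (Js Ju : set T),
          p' <> p /\ stable_curve f p p' /\ stable_curve finv p p' /\
          Js `<=` stable_curve f p /\ Ju `<=` stable_curve finv p /\
          is_arc Js p p' /\ is_arc Ju p p' /\
          Js `&` Ju = [set p; p'] /\
          e @` unit_circle = Js `|` Ju].

End Surfaces.

(* Main.v *)
(** Suppose (a) fails and some [2^k] is not the period of a twisted saddle orbit in [V]. By
    hyperbolicity every periodic orbit of period [2^j], [j <= k], in [V] is a saddle, with
    real multipliers [|la| < 1 < |mu|], and it is linearizable. If [mu < 0], orientation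
    gives [la < 0], so for [j = k] the orbit would be twisted, and for [j < k] an even power
    makes [mu] positive. Hence all fixed points of [f^(2^k)] with orbit in [V] have index
    -1. The loop bounding [V] consists of an arc of the stable line of [p] and an arc of its
    unstable line; pushing back onto the stable arc the points that leave the closed cell
    turns [f^(2^k)] into a self-map of the closed disk, and a small translation near [p]
    makes the fixed point [p] on the boundary disappear or become an interior fixed point of
    index -1. A self-map [Phi] of the disk has total index 1, which is absurd. The index is
    handled through continuous arguments: [z - Phi z] times the product of the [z - z_i] over
    the fixed points [z_i] would have a continuous argument on the disk, whereas on the circle
    it has degree [1 + #{z_i} > 0]. *)
Require Import Defs.
From mathcomp Require Import all_boot all_order all_algebra.
From mathcomp Require Import all_classical all_reals all_analysis.
From mathcomp Require Import complex.
From mathcomp Require Import ring lra.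
Import numFieldNormedType.Exports.
Import Order.TTheory GRing.Theory Num.Theory.
Local Open Scope classical_set_scope.
Local Open Scope ring_scope.
Set Implicit Arguments.
Unset Strict Implicit.
Unset Printing Implicit Defensive.

(** Three difficulties shape the argument. The arcs [Js] and [Ju] are only known to lie in the
    stable sets of [p] for the topology of the surface, where the stable line may accumulate on [p];
    an arc could then reach [p] from the far end of the line, and this case must be analysed before
    the loop takes its expected form. Next, the self-map of the disk is continuous only because
    points leave the cell across the stable arc alone: [f] respects the side of the cell at [p],
    hence along the whole unstable arc. For this the unstable arc must lie in the linear chart, so
    the cell is replaced by its image under a power of [finv], which contains the same periodic
    orbits. Last, near [p] the cell fills one quadrant or the other three; the translation removes
    the fixed point in one case and moves it inside in the other. Degree theory is built on a single
    notion, a continuous argument; invariance of domain follows from it through odd maps of the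
    circle. Periodic points are linearized only topologically: the expanding multiplier is kept, the
    contracting one is replaced by another number of modulus between 0 and 1. *)

(** * Continuity relative to a subset *)

(** Convergence along [within A] states continuity of the restriction pointwise on the original
    type, so that composition and restriction need no change of topology; [continP] links it to the
    library notion. *)
Definition contin (X Y : topologicalType) (A : set X) (f : X -> Y) :=
  forall x, A x -> f @ within A (nbhs x) --> f x.

Section Contin.
Variables (X Y Z : topologicalType).
Implicit Types (A B : set X).

Lemma continP A (f : X -> Y) : {within A, continuous f} <-> contin A f.
Proof. exact: subspace_continuousP. Qed.

Lemma contin_cst A (y : Y) : contin A (fun=> y).
Proof. by move=> x Ax; apply: cvg_cst. Qed.

Lemma contin_continuous A (f : X -> Y) : continuous f -> contin A f.
Proof. by move=> cf x Ax; apply: cvg_trans (cf x); apply: cvg_app; exact: cvg_within. Qed.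

Lemma contin_id A : contin A id.
Proof. by move=> x Ax; apply: cvg_within. Qed.

Lemma contin_sub A B (f : X -> Y) : A `<=` B -> contin B f -> contin A f.
Proof.
move=> AB cf x Ax; apply: cvg_trans (cf x (AB _ Ax)).
by apply: cvg_app; apply: within_subset AB.
Qed.

Lemma contin_setT (f : X -> Y) : contin setT f -> continuous f.
Proof.
move=> cf x U fU; have := cf x I _ fU; rewrite !nbhs_simpl /within /=.
by apply: filterS => y; apply.
Qed.

Lemma contin_eq A (f g : X -> Y) : {in A, f =1 g} -> contin A f -> contin A g.
Proof.
move=> fg cf x Ax; rewrite -fg ?inE//; apply: cvg_trans (cf x Ax).
by apply: fmap_within_eq => y; rewrite inE => Ay; rewrite fg ?inE.
Qed.

Lemma contin_comp A (B : set Y) (f : X -> Y) (g : Y -> Z) :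
  contin A f -> contin B g -> (forall x, A x -> B (f x)) ->
  contin A (fun x => g (f x)).
Proof.
move=> cf cg fAB x Ax; apply: cvg_trans (cg _ (fAB _ Ax)).
move=> U /= gU; have := cf _ Ax _ gU; rewrite /= !nbhs_simpl /within /=.
by apply: filter_app; near=> y => + Ay => /(_ Ay); apply; apply: fAB.
Unshelve. all: by end_near. Qed.

Lemma contin_pair A (f : X -> Y) (g : X -> Z) :
  contin A f -> contin A g -> contin A (fun x => (f x, g x)).
Proof. by move=> cf cg x Ax; apply: cvg_pair; [exact: cf|exact: cg]. Qed.

Lemma contin_local A (f : X -> Y) :
  (forall x, A x -> exists2 U, nbhs x U & contin (A `&` U) f) -> contin A f.
Proof.
move=> H x Ax; have [U Ux cU] := H x Ax.
move=> W fW; have := cU x (conj Ax (nbhs_singleton Ux)) W fW.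
rewrite !nbhs_simpl /within /=; move: Ux; apply: filter_app2.
by near=> y => Uy WW Ay; exact: WW.
Unshelve. all: by end_near. Qed.

Lemma continU A B (f : X -> Y) : closed A -> closed B ->
  contin A f -> contin B f -> contin (A `|` B) f.
Proof. by move=> cA cB /continP fA /continP fB; apply/continP/withinU_continuous. Qed.

Lemma contin_image_compact A (f : X -> Y) : contin A f -> compact A -> compact (f @` A).
Proof. by move=> /continP; exact: continuous_compact. Qed.

Lemma contin_open A (f : X -> Y) x U : contin A f -> open A -> A x -> nbhs (f x) U ->
  nbhs x (f @^-1` U).
Proof.
move=> cf oA Ax fU; have := cf _ Ax _ fU; rewrite !nbhs_simpl /within /=.
have := open_nbhs_nbhs (conj oA Ax); apply: filter_app2.
by near=> y => Ay; apply.
Unshelve. all: by end_near. Qed.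

Lemma contin_preimage_closed A (f : X -> Y) (C : set Y) : contin A f -> closed A ->
  closed C -> closed (A `&` f @^-1` C).
Proof.
move=> /continP cf cA cC.
have /continuous_closedP/(_ _ cC)/closed_subspaceP[V cV VE] := cf.
by rewrite setIC -VE; apply: closedI.
Qed.

(** The trace of [S] on [A] is open, through the interior of [A t -> S t], and closed, through that
    of [A t -> ~ S t]. The continuation arguments below, in a homotopy parameter or along an arc,
    use this form. *)
Lemma locally_constant_connected A (S : X -> Prop) x y : connected A ->
  (forall z, A z -> \forall t \near z, A t -> (S t <-> S z)) ->
  A x -> A y -> S x -> S y.
Proof.
move=> cA loc Ax Ay Sx.
suff : A `&` S = A by move=> E; move: Ay; rewrite -{1}E => -[].
apply: cA; first by exists x.
- exists (interior [set t | A t -> S t]); first exact: open_interior.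
  apply/seteqP; split => z [Az].
    move=> Sz; split=> //; rewrite /interior /=; have := loc _ Az.
    by apply: filter_app; near=> t => + At => /(_ At) [_]; apply.
  by move=> /interior_subset/(_ Az).
- exists (~` interior [set t | A t -> ~ S t]); first by apply/open_closedC/open_interior.
  apply/seteqP; split => z [Az].
    by move=> Sz; split=> // /interior_subset/(_ Az).
  move=> nS; split => //; apply: contrapT => nSz; apply: nS.
  rewrite /interior /=; have := loc _ Az.
  by apply: filter_app; near=> t => + At => /(_ At) [St _] /St.
Unshelve. all: by end_near. Qed.

End Contin.

Section Real.
Variable R : realType.
Variable X : topologicalType.
Implicit Types (A : set X) (f g : X -> R).

Lemma continD A f g : contin A f -> contin A g -> contin A (fun x => f x + g x).
Proof. by move=> cf cg x Ax; apply: (@cvgD R R^o); [exact: cf|exact: cg]. Qed.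
Lemma continM A f g : contin A f -> contin A g -> contin A (fun x => f x * g x).
Proof. by move=> cf cg x Ax; apply: cvgM; [exact: cf|exact: cg]. Qed.
Lemma continN A f : contin A f -> contin A (fun x => - f x).
Proof.
move=> cf; apply: (contin_eq (f := fun x => -1 * f x)); first by move=> x _; rewrite mulN1r.
by apply: continM => //; exact: contin_cst.
Qed.
Lemma continB A f g : contin A f -> contin A g -> contin A (fun x => f x - g x).
Proof. by move=> cf cg; apply: continD => //; exact: continN. Qed.
Lemma contin_at (Y : topologicalType) A f (g : R -> Y) : contin A f ->
  (forall x, A x -> {for f x, continuous g}) -> contin A (fun x => g (f x)).
Proof. by move=> cf cg x Ax; apply: (cvg_comp _ _ (cf x Ax)); exact: cg. Qed.
Lemma continV A f : contin A f -> (forall x, A x -> f x != 0) -> contin A (fun x => (f x)^-1).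
Proof. by move=> cf f0; apply: contin_at => // x Ax; apply: inv_continuous; exact: f0. Qed.
Lemma continc A f (g : R -> R) : contin A f -> continuous g -> contin A (fun x => g (f x)).
Proof. by move=> cf cg; apply: (@contin_comp _ _ _ _ setT) => //; exact: contin_continuous. Qed.
Lemma continX A f n : contin A f -> contin A (fun x => f x ^+ n).
Proof.
move=> cf; elim: n => [|n IH]; first exact: contin_cst.
apply: (contin_eq (f := fun x => f x * f x ^+ n)) => [x _|]; first by rewrite exprS.
exact: continM.
Qed.
Lemma contin_norm A f : contin A f -> contin A (fun x => `|f x|).
Proof. by move=> cf; apply: continc => //; exact: norm_continuous. Qed.
Lemma contin_max A f g : contin A f -> contin A g -> contin A (fun x => Num.max (f x) (g x)).
Proof.
move=> cf cg.
apply: (contin_eq (f := fun x => (f x + g x + `|f x - g x|) / 2)).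
  by move=> x _; case: (lerP (f x) (g x)) => h; lra.
apply: continM; last exact: contin_cst.
by apply: continD; [exact: continD|apply: contin_norm; exact: continB].
Qed.
Lemma contin_min A f g : contin A f -> contin A g -> contin A (fun x => Num.min (f x) (g x)).
Proof.
move=> cf cg.
apply: (contin_eq (f := fun x => (f x + g x - `|f x - g x|) / 2)).
  by move=> x _; case: (lerP (f x) (g x)) => h; lra.
apply: continM; last exact: contin_cst.
by apply: continB; [exact: continD|apply: contin_norm; exact: continB].
Qed.

Lemma contin_fst (Y Z : topologicalType) A (f : X -> Y * Z) :
  contin A f -> contin A (fun x => (f x).1).
Proof. by move=> cf x Ax; apply: cvg_comp (cf x Ax) _; exact: cvg_fst. Qed.
Lemma contin_snd (Y Z : topologicalType) A (f : X -> Y * Z) :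
  contin A f -> contin A (fun x => (f x).2).
Proof. by move=> cf x Ax; apply: cvg_comp (cf x Ax) _; exact: cvg_snd. Qed.

Lemma contin_gt A f x c : contin A f -> A x -> c < f x ->
  \forall t \near x, A t -> c < f t.
Proof.
move=> cf Ax fc; have /cf : A x by [].
move=> /(_ [set z | c < z]); rewrite !nbhs_simpl /within /=; apply.
exact: lt_nbhsr.
Qed.

End Real.

(** * Maps to the punctured plane with a continuous argument *)

Section Winding.
Variable R : realType.

(** Complex arithmetic on pairs, where the charts take their values: product, conjugate, squared
    modulus, exp(it) and real scaling. *)
Definition cm (u v : R * R) : R * R := (u.1 * v.1 - u.2 * v.2, u.1 * v.2 + u.2 * v.1).
Definition cj (u : R * R) : R * R := (u.1, - u.2).
Definition sq (u : R * R) : R := u.1 ^+ 2 + u.2 ^+ 2.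
Definition cis (t : R) : R * R := (cos t, sin t).
Definition sc (a : R) (u : R * R) : R * R := (a * u.1, a * u.2).

Lemma pairE (u v : R * R) : u.1 = v.1 -> u.2 = v.2 -> u = v.
Proof. by case: u v => a b [c d] /= -> ->. Qed.

Lemma sq_ge0 u : 0 <= sq u. Proof. by rewrite addr_ge0 ?sqr_ge0. Qed.

Lemma sq_eq0 u : sq u = 0 -> u = 0.
Proof.
move=> /eqP; rewrite paddr_eq0 ?sqr_ge0// !sqrf_eq0 => /andP[/eqP a /eqP b].
exact: pairE.
Qed.

Lemma sq_gt0 u : u <> 0 -> 0 < sq u.
Proof. by move=> u0; rewrite lt_neqAle sq_ge0 andbT eq_sym; apply/eqP => /sq_eq0. Qed.

Lemma sq_gt0_neq u : 0 < sq u -> u <> 0.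
Proof. by move=> + u0; rewrite u0 /sq /= expr0n /= addr0 ltxx. Qed.

Lemma sq_cm u v : sq (cm u v) = sq u * sq v.
Proof. by rewrite /sq /cm /=; ring. Qed.

Lemma cm_neq0 u v : u <> 0 -> v <> 0 -> cm u v <> 0.
Proof. by move=> /sq_gt0 u0 /sq_gt0 v0; apply: sq_gt0_neq; rewrite sq_cm mulr_gt0. Qed.

Lemma cj_neq0 u : u <> 0 -> cj u <> 0.
Proof. by move=> /sq_gt0 u0; apply: sq_gt0_neq; rewrite /sq /cj /= sqrrN. Qed.

Lemma sq_sc a u : sq (sc a u) = a ^+ 2 * sq u.
Proof. by rewrite /sq /sc /=; ring. Qed.

Lemma sc_neq0 a u : a != 0 -> u <> 0 -> sc a u <> 0.
Proof.
move=> a0 /sq_gt0 u0; apply: sq_gt0_neq.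
by rewrite sq_sc mulr_gt0// lt_neqAle sqr_ge0 eq_sym sqrf_eq0 a0.
Qed.

Lemma polar u : u <> 0 -> exists t, exists2 r, 0 < r & u = sc r (cis t).
Proof.
move=> u0; have s0 := sq_gt0 u0; set r := Num.sqrt (sq u).
have r0 : 0 < r by rewrite sqrtr_gt0.
have r2 : r ^+ 2 = sq u by rewrite sqr_sqrtr// ltW.
have c1 : (u.1 / r) ^+ 2 <= 1.
  by rewrite expr_div_n r2 ler_pdivrMr// mul1r /sq lerDl sqr_ge0.
have cb : -1 <= u.1 / r <= 1 by move: c1; set c := _ / _ => c1; apply/andP; split; nra.
have ca : cos (acos (u.1 / r)) = u.1 / r by rewrite acosK.
have sa : (sin (acos (u.1 / r))) ^+ 2 = (u.2 / r) ^+ 2.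
  by rewrite sin2cos2 ca !expr_div_n r2 /sq; field; apply/eqP; rewrite -/(sq u); lra.
move/eqP: sa; rewrite eqf_sqr => /orP[] /eqP sa.
  exists (acos (u.1 / r)), r => //; apply: pairE => /=; rewrite ?ca ?sa; field; rewrite gt_eqF//.
exists (- acos (u.1 / r)), r => //; apply: pairE => /=; rewrite ?cosN ?sinN ?ca ?sa; field; rewrite gt_eqF//.
Qed.

Section ContinPlane.
Variable X : topologicalType.
Implicit Types (P Q : set X) (u v w : X -> R * R).

Lemma contin_cm P u v : contin P u -> contin P v -> contin P (fun x => cm (u x) (v x)).
Proof.
move=> cu cv; have [? ?] := (contin_fst cu, contin_snd cu).
have [? ?] := (contin_fst cv, contin_snd cv).
by apply: contin_pair; [apply: continB|apply: continD]; apply: continM.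
Qed.

Lemma contin_cj P u : contin P u -> contin P (fun x => cj (u x)).
Proof.
by move=> cu; apply: contin_pair; [exact: contin_fst|apply: continN; exact: contin_snd].
Qed.

Lemma contin_sc P (a : X -> R) u : contin P a -> contin P u -> contin P (fun x => sc (a x) (u x)).
Proof.
move=> ca cu; have [? ?] := (contin_fst cu, contin_snd cu).
by apply: contin_pair; apply: continM.
Qed.

Lemma contin_sqn P u : contin P u -> contin P (fun x => sq (u x)).
Proof. by move=> cu; apply: continD; apply: continX; [exact: contin_fst|exact: contin_snd]. Qed.

Lemma contin_addp P u v : contin P u -> contin P v -> contin P (fun x => u x + v x).
Proof.
move=> cu cv; have [? ?] := (contin_fst cu, contin_snd cu).
have [? ?] := (contin_fst cv, contin_snd cv).
by apply: (contin_eq (f := fun x => ((u x).1 + (v x).1, (u x).2 + (v x).2))) => //;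
  apply: contin_pair; apply: continD.
Qed.

Lemma contin_subp P u v : contin P u -> contin P v -> contin P (fun x => u x - v x).
Proof.
move=> cu cv; have [? ?] := (contin_fst cu, contin_snd cu).
have [? ?] := (contin_fst cv, contin_snd cv).
by apply: (contin_eq (f := fun x => ((u x).1 - (v x).1, (u x).2 - (v x).2))) => //;
  apply: contin_pair; apply: continB.
Qed.

End ContinPlane.

Section Nul.
Variable X : topologicalType.
Implicit Types (P Q : set X) (u v w : X -> R * R).

(** [u] has a continuous argument on [P]: it is null-homotopic as a map to the punctured plane. *)
Definition nul P u := exists2 th : X -> R, contin P th &
  forall x, P x -> exists2 r, 0 < r & u x = sc r (cis (th x)).

(** Homotopy in the punctured plane: the difference of the arguments of [u] and [v] lifts to a
    continuous real function, although neither argument need do so. *)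
Definition sim P u v := nul P (fun x => cm (u x) (cj (v x))).

Lemma cis_neq0 t : cis t <> 0.
Proof. by apply: sq_gt0_neq; rewrite /sq /= cos2Dsin2. Qed.

Lemma nul_neq0 P u x : nul P u -> P x -> u x <> 0.
Proof.
move=> [th _ H] /H[r r0 ->]; apply: sc_neq0; last exact: cis_neq0.
by rewrite gt_eqF.
Qed.

Lemma nul_scale P u v : nul P v ->
  (forall x, P x -> exists2 r, 0 < r & u x = sc r (v x)) -> nul P u.
Proof.
move=> [th cth H] E; exists th => // x Px.
have [r r0 ->] := E x Px; have [s s0 ->] := H x Px.
by exists (r * s); [rewrite mulr_gt0|rewrite /sc /= !mulrA].
Qed.

Lemma nul_ext P u v : nul P v -> (forall x, P x -> u x = v x) -> nul P u.
Proof.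
move=> nv E; apply: (nul_scale nv) => x Px; exists 1 => //.
by rewrite E// /sc !mul1r -surjective_pairing.
Qed.

Lemma nul_sub P Q u : P `<=` Q -> nul Q u -> nul P u.
Proof. by move=> PQ [th cth H]; exists th; [exact: contin_sub cth|move=> x /PQ /H]. Qed.

Lemma nul_cm P u v : nul P u -> nul P v -> nul P (fun x => cm (u x) (v x)).
Proof.
move=> [th cth H] [th' cth' H']; exists (fun x => th x + th' x); first exact: continD.
move=> x Px; have [r r0 ->] := H x Px; have [s s0 ->] := H' x Px.
exists (r * s); first by rewrite mulr_gt0.
by apply: pairE; rewrite /cm /sc /cis /= ?cosD ?sinD; ring.
Qed.

Lemma nul_cj P u : nul P u -> nul P (fun x => cj (u x)).
Proof.
move=> [th cth H]; exists (fun x => - th x); first exact: continN.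
move=> x Px; have [r r0 ->] := H x Px; exists r => //.
by apply: pairE; rewrite /cj /sc /cis /= ?cosN ?sinN; ring.
Qed.

Lemma nul_cst P c : c <> 0 -> nul P (fun=> c).
Proof.
move=> /polar[t [r r0 E]]; exists (fun=> t); first exact: contin_cst.
by move=> x _; exists r.
Qed.

(** In the right half plane [atan (y / x)] is a continuous argument. *)
Lemma nul_pos P u : contin P u -> (forall x, P x -> 0 < (u x).1) -> nul P u.
Proof.
move=> cu u0; exists (fun x => atan ((u x).2 / (u x).1)).
  apply: continc; last exact: continuous_atan.
  apply: continM; first exact: contin_snd.
  by apply: continV => [|x /u0 ?]; [exact: contin_fst|rewrite gt_eqF].
move=> x /u0 ux; set t := atan _.
have ct : 0 < cos t by apply: cos_gt0_pihalf; rewrite atan_gtNpi2 atan_ltpi2.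
exists ((u x).1 / cos t); first by rewrite divr_gt0.
have : tan t = (u x).2 / (u x).1 by rewrite atanK.
rewrite /tan => E; apply: pairE => /=; first by rewrite mulfVK// gt_eqF.
have -> : sin t = (u x).2 / (u x).1 * cos t by rewrite -E mulfVK// gt_eqF.
by field; rewrite !gt_eqF.
Qed.

Lemma sim_refl P u : (forall x, P x -> u x <> 0) -> sim P u u.
Proof.
move=> u0; exists (fun=> 0); first exact: contin_cst.
move=> x /u0 /sq_gt0 ux; exists (sq (u x)) => //.
by apply: pairE; rewrite /cm /sc /cis /= ?cos0 ?sin0 /sq; ring.
Qed.

Lemma sim_sym P u v : sim P u v -> sim P v u.
Proof.
move=> /nul_cj H; apply: (nul_ext H) => x _.
by apply: pairE; rewrite /cm /cj /=; ring.
Qed.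

Lemma sim_neq0 P u v x : sim P u v -> P x -> u x <> 0 /\ v x <> 0.
Proof.
move=> s Px; have /sq_gt0 := nul_neq0 s Px; rewrite sq_cm => H.
split=> E; move: H; rewrite E /sq /cj /= ?oppr0 expr0n /= addr0 ?mulr0 ?mul0r ltxx//.
Qed.

(** The product of [u cj(v)] and [v cj(w)] is [u cj(w)] up to the positive factor [sq v]. *)
Lemma sim_trans P v u w : sim P u v -> sim P v w -> sim P u w.
Proof.
move=> s1 s2; have H := nul_cm s1 s2; apply: (nul_scale H) => x Px.
have [_ /sq_gt0 v0] := sim_neq0 s1 Px.
exists (sq (v x))^-1; first by rewrite invr_gt0.
apply: pairE; rewrite /cm /cj /sc /=; move: v0; rewrite /sq => v0; field; apply/eqP; lra.
Qed.

Lemma sim_nul P u v : sim P u v -> nul P v -> nul P u.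
Proof.
move=> s1 s2; have H := nul_cm s1 s2; apply: (nul_scale H) => x Px.
have [_ /sq_gt0 v0] := sim_neq0 s1 Px.
exists (sq (v x))^-1; first by rewrite invr_gt0.
apply: pairE; rewrite /cm /cj /sc /=; move: v0; rewrite /sq => v0; field; apply/eqP; lra.
Qed.

Lemma sim_cm P u v u' v' : sim P u v -> sim P u' v' ->
  sim P (fun x => cm (u x) (u' x)) (fun x => cm (v x) (v' x)).
Proof.
move=> s1 s2; apply: (nul_ext (nul_cm s1 s2)) => x _.
by apply: pairE; rewrite /cm /cj /=; ring.
Qed.

Definition cyl P : set (X * R) := [set q | P q.1 /\ 0 <= q.2 <= 1].

(** Being [sim] to the initial map is locally constant in the time: since [P] is compact, for [t]
    close to [s] the product of [H (x, s)] and the conjugate of [H (x, t)] has positive real part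
    for all [x] at once, and [nul_pos] applies. *)
Lemma homotopy_sim P (H : X * R -> R * R) : compact P -> contin (cyl P) H ->
  (forall q, cyl P q -> H q <> 0) -> sim P (fun x => H (x, 0)) (fun x => H (x, 1)).
Proof.
move=> cP cH H0.
pose I01 : set R := `[0, 1]%classic.
have I01E s : I01 s = (0 <= s <= 1) :> Prop by rewrite /I01 /= in_itv.
have cS s : I01 s -> contin P (fun x => H (x, s)).
  move=> Is; apply: (contin_comp _ cH) => [|x Px]; last by split=> //=; rewrite -I01E.
  by apply: contin_pair; [exact: contin_id|exact: contin_cst].
apply: (@locally_constant_connected _ I01 (fun s => sim P (fun x => H (x, 0)) (fun x => H (x, s))) 0).
- exact: segment_connected.
- move=> s Is.
  have : \forall t \near within I01 (nbhs s), P `<=` [set x | 0 < (cm (H (x, s)) (cj (H (x, t)))).1].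
    have /compact_near_coveringP/near_covering_withinP cov := cP.
    apply: cov => x Px.
    pose K (q : X * R) := cm (H (q.1, s)) (cj (H q)).
    have cK : contin (cyl P) K.
      apply: contin_cm; last exact: contin_cj.
      apply: (contin_comp _ cH) => [|q [Pq _]]; last by split=> //=; rewrite -I01E.
      by apply: contin_pair; [apply: contin_fst; exact: contin_id|exact: contin_cst].
    have cx : cyl P (x, s) by split=> //=; rewrite -I01E.
    have K0 : 0 < (K (x, s)).1.
      have := sq_gt0 (H0 _ cx); rewrite /K /cm /cj /sq /=; lra.
    have := contin_gt (contin_fst cK) cx K0.
    move=> [[U V] /= [Ux Vs] UV]; exists (U, V `&` I01) => /=.
      by split=> //; apply: filterS Vs => z Vz Iz; split.
    move=> [y t] /= [Uy [Vt It]] Py; have /= := UV (y, t) (conj Uy Vt).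
    by apply; split=> //=; rewrite -I01E.
  rewrite near_withinE => HH; apply: filterS HH => t /[swap] It /(_ It) Ht.
  have hs : sim P (fun x => H (x, s)) (fun x => H (x, t)).
    apply: nul_pos => [|x Px]; last exact: Ht.
    by apply: contin_cm; [exact: cS|apply: contin_cj; exact: cS].
  by split => h; [apply: sim_trans h (sim_sym hs)|apply: sim_trans h hs].
- by rewrite I01E lexx ler01.
- by rewrite I01E ler01 lexx.
- by apply: sim_refl => x Px; apply: H0; split=> //=; rewrite lexx ler01.
Qed.

End Nul.
End Winding.

(** * Circles, disks and the degree of loops *)

Section Plane.
Variable R : realType.
Notation plane := (R * R)%type.
Implicit Types (u v : R * R) (r t : R).

Definition circle r : set plane := [set v | sq v = r ^+ 2].
Definition disk r : set plane := [set v | sq v <= r ^+ 2].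
Definition odisk r : set plane := [set v | sq v < r ^+ 2].

Lemma continuous_sq : continuous (@sq R).
Proof. by apply: contin_setT; apply: contin_sqn; exact: contin_id. Qed.

Lemma closed_disk_set r : closed (disk r).
Proof.
have -> : disk r = @sq R @^-1` [set x | x <= r ^+ 2] by [].
by move/continuous_closedP: continuous_sq; apply; exact: closed_le.
Qed.

Lemma closed_circle r : closed (circle r).
Proof.
have -> : circle r = @sq R @^-1` [set x | x = r ^+ 2] by [].
by move/continuous_closedP: continuous_sq; apply; exact: closed_eq.
Qed.

Lemma open_odisk r : open (odisk r).
Proof.
have -> : odisk r = @sq R @^-1` [set x | x < r ^+ 2] by [].
by move/continuousP: continuous_sq; apply; exact: open_lt.
Qed.

Lemma abs_le_sq v r : 0 <= r -> sq v <= r ^+ 2 -> `|v.1| <= r /\ `|v.2| <= r.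
Proof.
rewrite /sq => r0 h; have h1 := sqr_ge0 v.1; have h2 := sqr_ge0 v.2.
by split; rewrite -(@ler_pXn2r _ 2)// ?nnegrE// real_normK ?num_real//; lra.
Qed.

Lemma compact_box r : compact (`[- r, r]%classic `*` `[- r, r]%classic : set plane).
Proof. by apply: compact_setX; exact: segment_compact. Qed.

Lemma compact_disk r : 0 <= r -> compact (disk r).
Proof.
move=> r0; apply: (subclosed_compact (@closed_disk_set r) (@compact_box r)).
by move=> v /(abs_le_sq r0)[h1 h2]; split; rewrite /= in_itv /= -ler_norml.
Qed.

Lemma circle_disk r : circle r `<=` disk r.
Proof. by move=> v; rewrite /circle /disk /= => ->. Qed.

Lemma compact_circle r : 0 <= r -> compact (circle r).
Proof.
move=> r0; apply: (subclosed_compact (@closed_circle r) (compact_disk r0)).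
exact: circle_disk.
Qed.

Lemma nul_comp (X Y : topologicalType) (P : set X) (Q : set Y) (g : Y -> X) (u : X -> plane) :
  contin Q g -> (forall y, Q y -> P (g y)) -> nul P u -> nul Q (fun y => u (g y)).
Proof.
move=> cg gQP [th cth H]; exists (fun y => th (g y)); first exact: contin_comp cg cth gQP.
by move=> y /gQP /H.
Qed.

(** Composing [u] with the contraction [k] is a homotopy from a constant to [u]. *)
Lemma nul_contractible (X : topologicalType) (P : set X) (k : X * R -> X) x0 (u : X -> plane) :
  compact P -> contin (cyl P) k -> (forall q, cyl P q -> P (k q)) ->
  (forall x, P x -> k (x, 1) = x) -> (forall x, P x -> k (x, 0) = x0) ->
  contin P u -> (forall x, P x -> u x <> 0) -> nul P u.
Proof.
move=> cP ck kP k1 k0 cu u0.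
have [[x Px]|] := pselect (P !=set0); last first.
  move=> /set0P/negP/negPn/eqP ->; exists (fun=> 0) => //; exact: contin_cst.
have Px0 : P x0 by rewrite -(k0 x Px); apply: kP; split=> //=; rewrite lexx ler01.
have S := homotopy_sim cP (contin_comp ck cu kP) (fun q h => u0 _ (kP q h)).
apply: (sim_nul (v := fun=> u x0)); last exact/nul_cst/u0.
apply: nul_ext (sim_sym S) _ => y Py; by rewrite k1// k0.
Qed.

Lemma contin_idfst (X : topologicalType) (P : set X) : contin (@cyl R X P) fst.
Proof. by apply: contin_fst; exact: contin_id. Qed.

Lemma contin_idsnd (X : topologicalType) (P : set X) : contin (@cyl R X P) snd.
Proof. by apply: contin_snd; exact: contin_id. Qed.

Lemma contin_cyl (X Y : topologicalType) (P : set X) (u : X -> Y) : contin P u ->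
  contin (@cyl R X P) (fun q => u q.1).
Proof. by move=> cu; apply: (contin_comp (@contin_idfst _ _) cu) => q []. Qed.

Lemma nul_disk r (u : plane -> plane) : 0 <= r -> contin (disk r) u -> (forall v, disk r v -> u v <> 0) ->
  nul (disk r) u.
Proof.
move=> r0; apply: (@nul_contractible _ _ (fun q => sc q.2 q.1) 0).
- exact: compact_disk.
- by apply: contin_sc; [exact: contin_idsnd|exact: contin_idfst].
- move=> [v t] [/= dv /andP[t0 t1]]; rewrite /disk /= sq_sc.
  apply: le_trans dv; rewrite ler_piMl ?sq_ge0// expr_le1//.
- by move=> v _; rewrite /sc /= !mul1r -surjective_pairing.
- by move=> v _; rewrite /sc /= !mul0r.
Qed.

Definition crc r t : plane := (r * cos (2 * pi * t), r * sin (2 * pi * t)).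

Lemma crc_circle r t : circle r (crc r t).
Proof.
by rewrite /circle /crc /sq /= !exprMn -mulrDr cos2Dsin2 mulr1.
Qed.

Lemma contin_crc r A : contin A (crc r).
Proof.
have H : contin A (fun t : R => 2 * pi * t).
  by apply: continM; [exact: contin_cst|exact: contin_id].
apply: contin_pair; apply: continM; try exact: contin_cst.
  by apply: continc H _; exact: continuous_cos.
by apply: continc H _; exact: continuous_sin.
Qed.

Lemma crc_surj r v : 0 < r -> circle r v -> exists2 t, 0 <= t <= 1 & crc r t = v.
Proof.
move=> r0 cv.
have c1 : (v.1 / r) ^+ 2 + (v.2 / r) ^+ 2 = 1.
  by move: cv; rewrite /circle /sq /= => cv; rewrite !expr_div_n -mulrDl cv divff// expf_neq0// gt_eqF.
have cb : -1 <= v.1 / r <= 1 by move: c1; set c := _ / _; set d := _ / _ => c1; apply/andP; split; nra.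
have ca : cos (acos (v.1 / r)) = v.1 / r by rewrite acosK.
have sa : (sin (acos (v.1 / r))) ^+ 2 = (v.2 / r) ^+ 2.
  by rewrite sin2cos2 ca; lra.
have p0 := pi_gt0 R; have a0 := acos_ge0 cb; have a1 := acos_lepi cb.
have p2 : pi *+ 2 = 2 * pi :> R by rewrite mulr_natl.
move/eqP: sa; rewrite eqf_sqr => /orP[] /eqP sa.
  exists (acos (v.1 / r) / (2 * pi)).
    have pp : 0 < 2 * pi :> R by rewrite mulr_gt0.
    by rewrite divr_ge0//= ?(ltW pp)// ler_pdivrMr//; lra.
  have e : 2 * pi * (acos (v.1 / r) / (2 * pi)) = acos (v.1 / r).
    by rewrite mulrC mulfVK// gt_eqF// mulr_gt0.
  by rewrite /crc e ca sa; apply: pairE => /=; field; rewrite gt_eqF.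
exists (1 - acos (v.1 / r) / (2 * pi)).
  have pp : 0 < 2 * pi :> R by rewrite mulr_gt0.
  rewrite subr_ge0 lerBlDr lerDl ler_pdivrMr// divr_ge0//= ?(ltW pp)// andbT; lra.
have e : 2 * pi * (1 - acos (v.1 / r) / (2 * pi)) = - acos (v.1 / r) + pi *+ 2.
  have pp : 0 < 2 * pi :> R by rewrite mulr_gt0.
  by rewrite p2 mulrBr mulr1 [X in _ - X]mulrC mulfVK ?gt_eqF// addrC.
by rewrite /crc e cosD2pi sinD2pi cosN sinN ca sa; apply: pairE => /=; field; rewrite gt_eqF.
Qed.

Lemma connected_circle r : 0 < r -> connected (circle r).
Proof.
move=> r0; have -> : circle r = crc r @` `[0, 1]%classic.
  apply/seteqP; split => v.
    by move=> /(crc_surj r0)[t t01 <-]; exists t => //=; rewrite in_itv.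
  by move=> [t _ <-]; exact: crc_circle.
apply: connected_continuous_connected; first exact: segment_connected.
by apply/continP; exact: contin_crc.
Qed.

Lemma sign_const (X : topologicalType) (P : set X) (d : X -> R) (x y : X) : connected P ->
  contin P d -> (forall z : X, P z -> d z != 0) -> P x -> P y -> 0 < d x -> 0 < d y.
Proof.
move=> cP cd d0; apply: (@locally_constant_connected _ P (fun z => 0 < d z)) => // z Pz.
case: (ltgtP (d z) 0) (d0 z Pz) => // dz _.
  have := contin_gt (continN cd) Pz (c := 0); rewrite oppr_gt0 => /(_ dz).
  by apply: filterS => t H /H; rewrite oppr_gt0 => dt; split=> //; move/(lt_trans dt); rewrite ltxx.
by have := contin_gt cd Pz dz; apply: filterS => t H /H dt; split.
Qed.

Lemma cis_add_pi t : cis (t + pi) = sc (-1) (cis t) :> plane.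
Proof. by rewrite /cis cosDpi sinDpi /sc /= !mulN1r. Qed.

(** Borsuk's argument: if [th] is an argument of the odd map [u], then [d v = th (-v) - th v] is
    odd, and its cosine is negative because [u (-v)] is opposite to [u v]. So [d] never vanishes,
    yet an odd function on the connected circle must change sign. *)
Lemma odd_not_nul r (u : plane -> plane) : 0 < r -> (forall v, circle r v -> u (sc (-1) v) = sc (-1) (u v)) ->
  ~ nul (circle r) u.
Proof.
move=> r0 ou [th cth H].
have oc v : circle r v -> circle r (sc (-1) v) by rewrite /circle /= sq_sc sqrrN expr1n mul1r.
have cN : contin (circle r) (sc (-1)) by apply: contin_sc; [exact: contin_cst|exact: contin_id].
pose d v := th (sc (-1) v) - th v.
have cd : contin (circle r) d by apply: continB => //; exact: (contin_comp cN cth oc).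
have dN v : circle r v -> cos (d v) < 0.
  move=> cv; have [a a0 ea] := H _ (oc _ cv); have [b b0 eb] := H _ cv.
  have e := ou v cv; rewrite ea eb /sc /cis /= in e.
  case: e => e1 e2; have c1 := cos2Dsin2 (th v); have c2 := cos2Dsin2 (th (sc (-1) v)).
  rewrite /d cosB.
  have : a * (cos (th (sc (-1) v)) * cos (th v) + sin (th (sc (-1) v)) * sin (th v)) = - b.
    rewrite mulrDr !mulrA e1 e2.
    transitivity (- b * (cos (th v) ^+ 2 + sin (th v) ^+ 2)); first by ring.
    by rewrite c1 mulr1.
  move=> e; have : a * (cos (th (sc (-1) v)) * cos (th v) + sin (th (sc (-1) v)) * sin (th v)) < 0 by rewrite e; lra.
  by rewrite pmulr_rlt0.
have d0 v : circle r v -> d v != 0.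
  by move=> /dN h; apply/eqP => E; move: h; rewrite E cos0; lra.
have dodd v : d (sc (-1) v) = - d v.
  by rewrite /d /sc /= !mulN1r !opprK -surjective_pairing opprB.
have c0 : circle r (crc r 0) by exact: crc_circle.
have cc := connected_circle r0.
have [h|h] := ltrP 0 (d (crc r 0)).
  have := sign_const cc cd d0 c0 (oc _ c0) h; rewrite dodd oppr_gt0 => /(lt_trans h).
  by rewrite ltxx.
have h' : 0 < d (sc (-1) (crc r 0)) by rewrite dodd oppr_gt0 lt_neqAle h d0.
by have := sign_const cc cd d0 (oc _ c0) c0 h'; rewrite ltNge h.
Qed.

(** Invariance under the reflection makes [u] factor through the second coordinate, hence through a
    segment, which is contractible. *)
Lemma nul_fold r (u : plane -> plane) : 0 < r -> contin (circle r) u -> (forall v, circle r v -> u v <> 0) ->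
  (forall v, circle r v -> u (- v.1, v.2) = u v) -> nul (circle r) u.
Proof.
move=> r0 cu u0 fu.
pose I : set R := `[- r, r]%classic.
have IE y : I y = (- r <= y <= r) :> Prop by rewrite /I /= in_itv.
pose g y : plane := (Num.sqrt (r ^+ 2 - y ^+ 2), y).
have cg : contin I g.
  apply: contin_pair; last exact: contin_id.
  apply: continc; last exact: sqrt_continuous.
  by apply: continB; [exact: contin_cst|apply: continX; exact: contin_id].
have gC y : I y -> circle r (g y).
  rewrite IE => /andP[h1 h2]; rewrite /circle /sq /= sqr_sqrtr; first by ring.
  nra.
have cug := contin_comp cg cu gC.
have n : nul I (fun y => u (g y)).
  apply: (@nul_contractible _ I (fun q => q.2 * q.1) 0) => //.
  - exact: segment_compact.
  - by apply: continM; [exact: contin_idsnd|exact: contin_idfst].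
  - move=> [y t]; rewrite /cyl /= IE => -[/andP[h1 h2] /andP[t0 t1]].
    by rewrite IE; apply/andP; split; nra.
  - by move=> x _; rewrite mul1r.
  - by move=> x _; rewrite mul0r.
  - by move=> y /gC /u0.
have := nul_comp (g := snd) (P := I) (Q := circle r) (contin_snd (@contin_id _ _)) _ n.
have sI v : circle r v -> I v.2.
  by move=> /circle_disk/(abs_le_sq (ltW r0))[_]; rewrite IE -ler_norml.
move=> /(_ sI) h; apply: (nul_ext h) => v cv /=.
have e : r ^+ 2 - v.2 ^+ 2 = v.1 ^+ 2 by move: cv; rewrite /circle /sq /= => <-; ring.
rewrite /g e sqrtr_sqr; have [v0|v0] := lerP 0 v.1.
  by rewrite ger0_norm// -surjective_pairing.
by rewrite ltr0_norm// fu.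
Qed.

(** Half of an argument of [u^2] is an argument of [u] up to sign: [u] is [a x] times [cis (th / 2)]
    with [a] continuous and nowhere zero. On a connected set the sign of [a] is constant, and [pi]
    is added if it is negative. *)
Lemma nul_sqrt (X : topologicalType) (P : set X) (u : X -> plane) : connected P -> contin P u ->
  nul P (fun x => cm (u x) (u x)) -> nul P u.
Proof.
move=> cP cu [th cth H].
have ct : contin P (fun x => th x / 2) by apply: continM => //; exact: contin_cst.
have cc : contin P (fun x => cos (th x / 2)) by apply: continc ct _; exact: continuous_cos.
have cs : contin P (fun x => sin (th x / 2)) by apply: continc ct _; exact: continuous_sin.
pose a x := (u x).1 * cos (th x / 2) + (u x).2 * sin (th x / 2).
have ca : contin P a.
  by apply: continD; apply: continM => //; [exact: contin_fst|exact: contin_snd].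
have key x : P x -> a x != 0 /\ u x = sc (a x) (cis (th x / 2)).
  move=> Px; have [r r0] := H x Px; rewrite /cm /sc /cis /=.
  have e : th x = th x / 2 + th x / 2 by field.
  rewrite [in cos _]e [in sin _]e cosD sinD /a.
  have := cos2Dsin2 (th x / 2).
  set c := cos _; set s := sin _; set x1 := (u x).1; set x2 := (u x).2 => cs1 [e1 e2].
  set b := x2 * c - x1 * s.
  have ab : (x1 * c + x2 * s) ^+ 2 - b ^+ 2 = r.
    have -> : (x1 * c + x2 * s) ^+ 2 - b ^+ 2 =
      (x1 * x1 - x2 * x2) * (c * c - s * s) + (x1 * x2 + x2 * x1) * (s * c + c * s) by rewrite /b; ring.
    rewrite e1 e2.
    have -> : r * (c * c - s * s) * (c * c - s * s) + r * (s * c + c * s) * (s * c + c * s) =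
      r * (c ^+ 2 + s ^+ 2) ^+ 2 by ring.
    by rewrite cs1 expr1n mulr1.
  have ab0 : (x1 * c + x2 * s) * b = 0.
    have : 2 * ((x1 * c + x2 * s) * b) =
      (x1 * x2 + x2 * x1) * (c * c - s * s) - (x1 * x1 - x2 * x2) * (s * c + c * s) by rewrite /b; ring.
    rewrite e1 e2 => E; have : 2 * ((x1 * c + x2 * s) * b) = 0 by rewrite E; ring.
    by move=> /eqP; rewrite mulf_eq0 pnatr_eq0 /= => /eqP.
  have a0 : x1 * c + x2 * s != 0.
    by apply/eqP => E; move: ab; rewrite E expr0n /= sub0r => E2; have := sqr_ge0 b; lra.
  split=> //; have b0 : b = 0 by move/eqP: ab0; rewrite mulf_eq0 (negPf a0) /= => /eqP.
  apply: pairE => /=.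
    have -> : (x1 * c + x2 * s) * c = x1 * (c ^+ 2 + s ^+ 2) + b * s by rewrite /b; ring.
    by rewrite cs1 b0 mul0r addr0 mulr1.
  have -> : (x1 * c + x2 * s) * s = x2 * (c ^+ 2 + s ^+ 2) - b * c by rewrite /b; ring.
  by rewrite cs1 b0 mul0r subr0 mulr1.
have [[x0 [Px0 a0]]|nex] := pselect (exists x, P x /\ 0 < a x).
  exists (fun x => th x / 2) => // x Px; have [_ e] := key x Px; exists (a x) => //.
  by apply: (sign_const cP ca _ Px0 Px a0) => z /key[].
exists (fun x => th x / 2 + pi); first by apply: continD => //; exact: contin_cst.
move=> x Px; have [ax e] := key x Px; exists (- a x).
  rewrite oppr_gt0 lt_neqAle ax leNgt /=; apply/negP => a0; apply: nex.
  by exists x.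
by rewrite cis_add_pi {1}e /sc /=; apply: pairE => /=; ring.
Qed.

Definition cpow n (z : plane) : plane := iter n (cm z) (1, 0).

Lemma cpow_crc n t : cpow n (crc 1 t) = cis (2 * pi * (n%:R * t)) :> plane.
Proof.
elim: n => [|n IH]; first by rewrite mul0r mulr0 /cis cos0 sin0.
rewrite /cpow iterS -/(cpow n _) IH /cm /cis /crc /= !mul1r.
have -> : 2 * pi * (n.+1%:R * t) = 2 * pi * t + 2 * pi * (n%:R * t) by rewrite -natr1; ring.
by rewrite cosD sinD; apply: pairE => /=; ring.
Qed.

(** Along the circle the difference [d] between a supposed argument and [2 pi n t] has cosine 1
    everywhere. It drops by [2 pi n] in one turn, so it also takes the value [d 1 + pi], where the
    cosine is -1. *)
Lemma cpow_not_nul n : (0 < n)%N -> ~ nul (circle 1) (cpow n).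
Proof.
move=> n0 [th cth H].
pose d t := th (crc 1 t) - 2 * pi * (n%:R * t).
have cI : contin (`[0, 1]%classic : set R) d.
  apply: continB; first by apply: (contin_comp (@contin_crc 1 _) cth) => x _; exact: crc_circle.
  by apply: continM; [exact: contin_cst|apply: continM; [exact: contin_cst|exact: contin_id]].
have c1 t : cos (d t) = 1.
  have [r r0] := H _ (crc_circle 1 t); rewrite cpow_crc => e.
  have r1 : r = 1.
    have : sq (cis (2 * pi * (n%:R * t))) = 1 by rewrite /sq /= cos2Dsin2.
    by rewrite e sq_sc /sq /= cos2Dsin2 mulr1 => /eqP; rewrite sqrf_eq1 => /orP[] /eqP // ; lra.
  move: e; rewrite r1 /sc !mul1r /cis /= => -[e1 e2].
  by rewrite /d cosB e1 e2 -!expr2 cos2Dsin2.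
have e01 : crc 1 1 = crc 1 0 :> plane.
  rewrite /crc !mulr1 mulr0 (_ : 2 * pi = 0 + pi *+ 2); last by rewrite add0r mulr_natl.
  by rewrite cosD2pi sinD2pi.
have d01 : d 0 - d 1 = 2 * pi * n%:R by rewrite /d e01; ring.
have p0 := pi_gt0 R.
have n1 : 1 <= n%:R :> R by rewrite ler1n.
have [t _ et] : exists2 t, t \in `[0, 1] & d t = d 1 + pi.
  apply: IVT => //; first exact/continP.
  by rewrite ge_min le_max; apply/andP; split; apply/orP; [right|left]; nra.
by have := c1 t; rewrite et cosDpi c1; lra.
Qed.

End Plane.

(** * Invariance of domain *)

Section InvDomain.
Variable R : realType.
Notation plane := (R * R)%type.
Implicit Types (u v : plane) (r : R).

Lemma nbhs_diskP (x : plane) (U : set plane) :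
  nbhs x U <-> exists2 r, 0 < r & forall v, disk r v -> U (x + v).
Proof.
split.
  move=> /nbhs_ballP[e /= e0 eU]; exists (e / 2); first by rewrite divr_gt0.
  move=> v /(abs_le_sq (ltW (divr_gt0 e0 (ltr0Sn R 1)))) [h1 h2].
  apply: eU; split; rewrite /ball /= opprD addNKr normrN.
    by apply: le_lt_trans h1 _; lra.
  by apply: le_lt_trans h2 _; lra.
move=> [r r0 rU]; apply/nbhs_ballP; exists (r / 2) => /=; first by rewrite divr_gt0.
move=> y [/= h1 h2]; rewrite (_ : y = x + (y - x)); last by rewrite addrC subrK.
apply: rU; rewrite /disk /sq /=.
move: h1 h2; rewrite /ball /= !ltr_norml => /andP[a1 a2] /andP[b1 b2]; nra.
Qed.

Lemma nbhs_sq (x : plane) e : 0 < e -> nbhs x [set y | sq (y - x) < e].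
Proof.
move=> e0; apply/nbhs_diskP; exists (Num.sqrt (e / 2)); first by rewrite sqrtr_gt0 divr_gt0.
move=> v; rewrite /disk /= sqr_sqrtr; last by rewrite divr_ge0// ltW.
by rewrite addrAC subrr add0r => h; apply: le_lt_trans h _; lra.
Qed.

Lemma sc_id v : sc 1 v = v. Proof. by rewrite /sc !mul1r -surjective_pairing. Qed.

Lemma disk_sc r a v : -1 <= a <= 1 -> disk r v -> disk r (sc a v).
Proof.
move=> /andP[a0 a1] dv; rewrite /disk /= sq_sc; apply: le_trans dv.
by rewrite ler_piMl ?sq_ge0//; nra.
Qed.

(** Halving [v] while letting the base point run from 0 to [- v / 2] deforms [phi v - phi 0] into
    the odd map [phi (v / 2) - phi (- v / 2)]; injectivity keeps the difference away from 0 all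
    along. *)
Lemma injective_not_nul r (phi : plane -> plane) : 0 < r -> contin (disk r) phi ->
  {in disk r &, injective phi} -> ~ nul (circle r) (fun v => phi v - phi 0).
Proof.
move=> r0 cphi iphi.
have inj u v : disk r u -> disk r v -> phi u = phi v -> u = v.
  by move=> du dv e; apply: iphi; rewrite ?inE.
pose H (q : plane * R) := phi (sc (1 - q.2 / 2) q.1) - phi (sc (- (q.2 / 2)) q.1).
have dH (q : plane * R) : cyl (circle r) q ->
   disk r (sc (1 - q.2 / 2) q.1) /\ disk r (sc (- (q.2 / 2)) q.1).
  move=> [/circle_disk dq /andP[h0 h1]].
  by split; apply: disk_sc => //; apply/andP; split; lra.
have c2 : contin (cyl (circle r)) (fun q : plane * R => q.2 / 2).
  by apply: continM; [exact: contin_idsnd|exact: contin_cst].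
have cH : contin (cyl (circle r)) H.
  apply: contin_subp.
    apply: (contin_comp _ cphi) => [|q /dH[]//].
    by apply: contin_sc; [apply: continB => //; exact: contin_cst|exact: contin_idfst].
  apply: (contin_comp _ cphi) => [|q /dH[]//].
  by apply: contin_sc; [exact: continN|exact: contin_idfst].
have H0 q : cyl (circle r) q -> H q <> 0.
  move=> cq /eqP; rewrite subr_eq0 => /eqP e; have [d1 d2] := dH q cq.
  have := inj _ _ d1 d2 e => -[e1 e2].
  have q0 : q.1 = 0 by apply: pairE => /=; lra.
  by case: cq; rewrite /circle /= q0 /sq /= expr0n /= addr0 => h _; nra.
have S := homotopy_sim (compact_circle (ltW r0)) cH H0.
move=> n; apply: (@odd_not_nul _ r (fun v => H (v, 1)) r0); last first.
  apply: (sim_nul (sim_sym S)); apply: (nul_ext n) => v _.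
  rewrite /H /= mul0r subr0 sc_id oppr0; congr (_ - phi _).
  by rewrite /sc !mul0r.
move=> v cv; rewrite /H /=.
have -> : sc (1 - 1 / 2) (sc (-1) v) = sc (- (1 / 2)) v by apply: pairE => /=; lra.
have -> : sc (- (1 / 2)) (sc (-1) v) = sc (1 - 1 / 2) v by apply: pairE => /=; lra.
by apply: pairE => /=; rewrite mulN1r opprB.
Qed.

(** Let [y] be closer to [phi 0] than the image of the circle. If [phi] missed [y], then [phi - y]
    would have an argument on the disk; on the circle a straight homotopy joins it to [phi - phi 0],
    which has none. *)
Lemma invariance_of_domain0 r (phi : plane -> plane) : 0 < r -> contin (disk r) phi ->
  {in disk r &, injective phi} -> nbhs (phi 0) (phi @` disk r).
Proof.
move=> r0 cphi iphi.
have nn := injective_not_nul r0 cphi iphi.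
have cC : contin (circle r) (fun v => phi v - phi 0).
  by apply: contin_subp; [apply: contin_sub cphi; exact: circle_disk|exact: contin_cst].
have C0 : circle r (crc r 0) by exact: crc_circle.
have [c cin cmin] : exists2 c, c \in circle r & forall t, t \in circle r ->
   sq (phi c - phi 0) <= sq (phi t - phi 0).
  apply: (@compact_EVT_min _ _ (fun v => sq (phi v - phi 0))).
  - by exists (crc r 0).
  - exact: compact_circle (ltW r0).
  - by apply/continP; exact: contin_sqn.
rewrite inE in cin.
have d0 : disk r 0 by rewrite /disk /sq /= expr0n /= addr0 sqr_ge0.
have m0 : 0 < sq (phi c - phi 0).
  apply: sq_gt0 => /eqP; rewrite subr_eq0 => /eqP e.
  have c0 : c = 0 by apply: iphi => //; rewrite ?inE//; exact: circle_disk.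
  by move: cin; rewrite /circle c0 /sq /= expr0n /= addr0 => h; nra.
apply: filterS (nbhs_sq _ m0) => y /= hy; apply: contrapT => ny.
apply: nn.
have n1 : nul (circle r) (fun v => phi v - y).
  apply: nul_sub (@circle_disk _ r) _; apply: nul_disk; first exact: ltW.
    by apply: contin_subp => //; exact: contin_cst.
  by move=> v dv /eqP; rewrite subr_eq0 => /eqP e; apply: ny; exists v.
apply: sim_nul n1.
pose H (q : plane * R) := (phi q.1 - phi 0) - sc q.2 (y - phi 0).
have := @homotopy_sim _ _ (circle r) H (compact_circle (ltW r0)).
have -> : (fun x => H (x, 0)) = (fun v => phi v - phi 0).
  by apply/funext => v; rewrite /H /sc /= !mul0r subr0.
have -> : (fun x => H (x, 1)) = (fun v => phi v - y).
  by apply/funext => v; rewrite /H sc_id opprB addrA subrK.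
apply.
  apply: contin_subp; first exact: (contin_cyl cC).
  by apply: contin_sc; [exact: contin_idsnd|exact: contin_cst].
move=> [v s] [/= cv /andP[s0 s1]] /eqP; rewrite subr_eq0 => /eqP /= e.
have := cmin v; rewrite inE => /(_ cv); rewrite e sq_sc.
by apply/negP; rewrite -ltNge; apply: le_lt_trans hy; rewrite ler_piMl ?sq_ge0// expr_le1.
Qed.

Lemma invariance_of_domain (U : set plane) (phi : plane -> plane) x : nbhs x U ->
  contin U phi -> {in U &, injective phi} -> nbhs (phi x) (phi @` U).
Proof.
move=> /nbhs_diskP[r r0 rU] cphi iphi.
have := @invariance_of_domain0 r (fun v => phi (x + v)) r0.
rewrite addr0 => H; have : nbhs (phi x) ((fun v => phi (x + v)) @` disk r).
  apply: H.
    apply: (contin_comp _ cphi) => [|v /rU//].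
    by apply: contin_addp; [exact: contin_cst|exact: contin_id].
  move=> u v; rewrite !inE => du dv /iphi; rewrite !inE => /(_ (rU _ du) (rU _ dv)).
  exact: addrI.
by apply: filterS => _ [v dv <-]; exists (x + v) => //; exact: rU.
Qed.

End InvDomain.

(** * Fixed points of index -1 in the disk *)

Section Inverse.
Variables (X Y : topologicalType).

(** The inverse is a total function with an arbitrary value in [X] off the image; it is continuous
    since [phi] maps closed subsets of the compact [K] to closed sets. *)
Lemma contin_inverse (K : set X) (phi : X -> Y) : hausdorff_space Y -> compact K ->
  contin K phi -> {in K &, injective phi} -> K !=set0 ->
  exists psi : Y -> X, [/\ contin (phi @` K) psi, (forall x, K x -> psi (phi x) = x) &
    forall y, (phi @` K) y -> K (psi y) /\ phi (psi y) = y].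
Proof.
move=> hY cK cphi iphi [x0 _].
pose psi y := xget x0 [set x | K x /\ phi x = y].
have psiK y : (phi @` K) y -> K (psi y) /\ phi (psi y) = y.
  by move=> [x Kx <-]; rewrite /psi; case: xgetP => [z _ []//|/(_ x)]; case.
have phiK x : K x -> psi (phi x) = x.
  move=> Kx; have [h1 h2] := psiK _ (imageP phi Kx).
  by apply: iphi => //; exact/mem_set.
exists psi; split=> //; apply/continP/continuous_closedP => C cC.
apply/closed_subspaceP; exists (phi @` (K `&` C)).
  apply: compact_closed => //; apply: contin_image_compact.
    by apply: contin_sub cphi => x [].
  exact: compact_closedI.
apply/seteqP; split => y [].
  by move=> [x [Kx Cx] <-] h; split=> //; rewrite /from_subspace /preimage /mkset phiK.
by move=> Cy yK; have [h1 h2] := psiK y yK; split=> //; exists (psi y).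
Qed.

End Inverse.

(** The near-covering form of compactness, applied to the filter of sequences generated by
    inclusion, produces one sequence that contains every point of [K]. *)
Lemma compact_discrete_seq (X : topologicalType) (K : set X) : compact K ->
  (forall x, K x -> \forall t \near x, K t -> t = x) ->
  exists s : seq X, forall x, K x -> x \in s.
Proof.
move=> /compact_near_coveringP/near_covering_withinP cov H.
pose G : set_system (seq X) := filter_from setT (fun s : seq X => [set s' : seq X | {subset s <= s'}]).
have FG : Filter G.
  apply: filter_from_filter; first by exists [::].
  move=> s1 s2 _ _; exists (s1 ++ s2) => // s' ss'.
  by split=> x xs; apply: ss'; rewrite mem_cat xs ?orbT.
have [s _ sK] : \forall s \near G, K `<=` [set x : X | x \in s].
  apply: cov => x Kx; exists ([set t | K t -> t = x], [set s : seq X | x \in s]) => /=.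
    by split; [exact: H|exists [:: x] => // s; apply; rewrite mem_head].
  by move=> [t s] /= [tx xs] Kt; rewrite (tx Kt).
by exists s => x Kx; apply: (sK s _ x Kx).
Qed.

Section Index.
Variable R : realType.
Notation plane := (R * R)%type.

Lemma plane_hausdorff : hausdorff_space plane.
Proof. exact: norm_hausdorff. Qed.

Lemma tietze_compact (K : set plane) (f : plane -> R) : compact K -> contin K f ->
  exists2 g : plane -> R, continuous g & {in K, f =1 g}.
Proof.
move=> cK cf.
have [->|K0] := eqVneq K set0.
  by exists (fun=> 0) => [|x]; [move=> x; exact: cst_continuous|rewrite inE].
have [c _ cmax] : exists2 c, c \in K & forall t, t \in K -> `|f t| <= `|f c|.
  apply: (@compact_EVT_max _ _ (fun x => `|f x|)) => //; first exact/set0P.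
  by apply/continP; exact: contin_norm.
have clK : closed K by apply: compact_closed => //; exact: plane_hausdorff.
(* The [+ 1] keeps the bound positive when [f] vanishes on [K]. *)
have [|||g [fg cg _]] := @continuous_bounded_extension plane R
  (@pseudometric_normal R plane) K clK f (`|f c| + 1).
- by rewrite ltr_wpDl.
- exact/continP.
- by move=> x Kx; rewrite (le_trans (cmax x _)) ?inE// lerDl.
- by exists g.
Qed.

Lemma nul_image (K : set plane) (phi u : plane -> plane) : compact K -> contin K phi ->
  {in K &, injective phi} -> nul K (fun v => u (phi v)) -> nul (phi @` K) u.
Proof.
move=> cK cphi iphi n.
have [->|/set0P K0] := eqVneq K set0.
  by rewrite image_set0; exists (fun=> 0) => //; exact: contin_cst.
have [psi [cpsi phiK psiK]] := contin_inverse plane_hausdorff cK cphi iphi K0.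
have := nul_comp cpsi (fun y h => (psiK y h).1) n.
by move=> h; apply: (nul_ext h) => y /psiK[_ ->].
Qed.

Lemma cmC (u v : plane) : cm u v = cm v u.
Proof. by apply: pairE => /=; ring. Qed.

Lemma cm_eq0 (u v : plane) : cm u v = 0 -> u = 0 \/ v = 0.
Proof.
move=> e; have [u0|u0] := pselect (u = 0); [by left|right].
by apply: contrapT => v0; case: (cm_neq0 u0 v0).
Qed.

(** The zero [z0] of [u] has index -1. *)
Definition neg_zero (u : plane -> plane) (z0 : plane) :=
  forall U0, nbhs z0 U0 -> exists U, [/\ open U, U z0, closure U `<=` U0 &
    nul (closure U `\` U) (fun z => cm (u z) (z - z0))].

(** Here [P] lies in the open half plane through [a] on the side of [b], where [z - a] stays within
    a right angle of [b - a]. *)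
Lemma nul_near (a b : plane) (P : set plane) :
  (forall z, P z -> 0 < (cm (z - a) (cj (b - a))).1) -> nul P (fun z => z - a).
Proof.
move=> H; have [[z /H Pz]|/set0P/negP/negPn/eqP ->] := pselect (P !=set0); last first.
  by exists (fun=> 0) => //; exact: contin_cst.
have ba : b - a <> 0 by move=> e; move: Pz; rewrite e /cm /cj /= oppr0 !mulr0 subr0 ltxx.
apply: (sim_nul (v := fun=> b - a)); last exact: nul_cst.
apply: nul_pos => //; apply: contin_cm; last exact: contin_cst.
by apply: contin_subp; [exact: contin_id|exact: contin_cst].
Qed.

Definition mulsub (zs : seq plane) (w z : plane) : plane :=
  foldl (fun w a => cm w (z - a)) w zs.

(** Induction on the zeros. Around a zero [a] of index -1 the product [w] of [u] and [z - a] has a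
    continuous logarithm on the frontier of a small [U]; Tietze extends it, and replacing [w] by the
    exponential inside [U] removes the zero without altering [w] near the circle. The other zeros
    keep index -1, since [z - a] has an argument near each of them. *)
Lemma neg_zeros_nul (zs : seq plane) : forall u : plane -> plane,
  contin (disk 1) u -> (forall z, disk 1 z -> u z = 0 -> z \in zs) -> uniq zs ->
  (forall z, z \in zs -> odisk 1 z /\ neg_zero u z) ->
  nul (circle 1) (fun z => mulsub zs (u z) z).
Proof.
elim: zs => [|a zs IH] u cu u0 /=.
  move=> _ _; apply: nul_sub (@circle_disk _ 1) _; apply: nul_disk => //.
  by move=> z dz e; have := u0 z dz e; rewrite in_nil.
move=> /andP[azs uzs] Hz.
have [oa nega] := Hz a (mem_head _ _).
pose U0 := odisk 1 `&` [set z | z \notin zs].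
have nU0 : nbhs a U0.
  apply: open_nbhs_nbhs; split=> //; apply: openI; first exact: open_odisk.
  rewrite (_ : [set z | z \notin zs] = ~` [set` zs]).
    apply: closed_openC; apply: (@accessible_finite_set_closed plane).1.
      by apply: hausdorff_accessible; exact: plane_hausdorff.
    exact: finite_seq.
  by apply/seteqP; split=> z /=; [move/negP|move/negP].
have [U [oU Ua UU0 nU]] := nega _ nU0.
pose C := closure U `\` U.
have clU : closed (closure U) by exact: closed_closure.
have cC : compact C.
  have clC : closed C by apply: closedI => //; exact: open_closedC.
  apply: (subclosed_compact clC (compact_disk ler01)).
  by move=> z [/UU0[h _] _]; exact: ltW.
pose w z := cm (u z) (z - a).
have ctza A : contin A (fun z : plane => z - a).
  by apply: contin_subp; [exact: contin_id|exact: contin_cst].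
have cw : contin (disk 1) w by exact: contin_cm.
have Cd : C `<=` disk 1 by move=> z [/UU0[h _] _]; exact: ltW.
have w0 z : C z -> w z <> 0 by move=> /(nul_neq0 nU).
case: nU => th cth thE.
have [Th cTh ThE] := tietze_compact cC cth.
have cl : contin C (fun z => ln (Num.sqrt (sq (w z)))).
  apply: contin_at => [|z /w0/sq_gt0 h]; last by apply: continuous_ln; rewrite sqrtr_gt0.
  by apply: continc; [apply: contin_sqn; exact: contin_sub cw|exact: sqrt_continuous].
have [L cL LE] := tietze_compact cC cl.
(* Exponential of the extended logarithm [L + i Th]: nowhere zero on the plane, equal to [w] on the
   frontier of [U]. *)
pose e z := sc (expR (L z)) (cis (Th z)).
have eE z : C z -> e z = w z.
  move=> Cz; have [r r0 E] := thE z Cz; rewrite /e -LE ?inE// -ThE ?inE//.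
  have sw : Num.sqrt (sq (w z)) = r.
    by rewrite /w E sq_sc /sq /= cos2Dsin2 mulr1 sqrtr_sqr gtr0_norm.
  by rewrite sw lnK ?posrE// /w E.
have e0 z : e z <> 0.
  by apply: sc_neq0; [rewrite gt_eqF// expR_gt0|exact: cis_neq0].
have ce : continuous e.
  apply: contin_setT; apply: contin_sc.
    by apply: continc; [exact: contin_continuous|exact: continuous_expR].
  by apply: contin_pair; apply: (continc (contin_continuous cTh));
    [exact: continuous_cos|exact: continuous_sin].
pose u' z := if z \in closure U then e z else w z.
have u'A z : ~ U z -> u' z = w z.
  by move=> nUz; rewrite /u'; case: ifPn => //; rewrite inE => cz; apply: eE.
have u'B z : closure U z -> u' z = e z by rewrite /u' -in_setE => ->.
have cu' : contin (disk 1) u'.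
  apply: (@contin_sub _ _ _ ((disk 1 `&` ~` U) `|` closure U)).
    move=> z dz; have [Uz|nUz] := pselect (U z); [right; exact: subset_closure|by left].
  apply: continU => //.
  - by apply: closedI; [exact: closed_disk_set|exact: open_closedC].
  - apply: (contin_eq (f := w)); last by apply: contin_sub cw => z [].
    by move=> z; rewrite inE => -[_ /u'A].
  - apply: (contin_eq (f := e)); last exact: contin_continuous.
    by move=> z; rewrite inE => /u'B.
have := IH u' cu' _ uzs _.
have u'0 z : disk 1 z -> u' z = 0 -> z \in zs.
  move=> dz; rewrite /u'; case: ifPn => [_ /e0//|]; rewrite notin_setE => nz /cm_eq0[].
    move=> /(u0 z dz); rewrite inE => /orP[/eqP za|//].
    by case: nz; apply: subset_closure; rewrite za.
  move=> /eqP; rewrite subr_eq0 => /eqP za.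
  by case: nz; apply: subset_closure; rewrite za.
have u'neg z : z \in zs -> odisk 1 z /\ neg_zero u' z.
  move=> zz; have [|oz negz] := Hz z; first by rewrite inE zz orbT.
  split=> // V0 nV0.
  have za : z - a <> 0.
    by move=> /eqP; rewrite subr_eq0 => /eqP e1; move: azs; rewrite -e1 zz.
  (* In this half plane around [z] the new factor [t - a] has an argument, so it does not change the
     index of [z]. *)
  pose V1 := [set t : plane | 0 < (cm (t - a) (cj (z - a))).1].
  have nV : nbhs z (V0 `&` (~` closure U) `&` V1).
    apply: filterI; first apply: filterI => //.
      apply: open_nbhs_nbhs; split; first exact: closed_openC.
      by move=> /UU0[_]; rewrite /= zz.
    have := @contin_gt R _ setT (fun t : plane => (cm (t - a) (cj (z - a))).1) z 0.
    have h : contin setT (fun t : plane => (cm (t - a) (cj (z - a))).1).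
      by apply: contin_fst; apply: contin_cm => //; exact: contin_cst.
    move=> /(_ h I); have := sq_gt0 za; rewrite /sq /cm /cj /= => h1 h2.
    have : \forall t \near z, setT t -> 0 < (cm (t - a) (cj (z - a))).1.
      apply: h2; rewrite /cm /cj /=; lra.
    by apply: filterS => t; apply.
  have [V [oV Vz VV nV']] := negz _ nV; exists V; split=> //.
    by move=> t /VV[[]].
  have nn : nul (closure V `\` V) (fun t => t - a).
    by apply: (@nul_near a z) => t [/VV[_]].
  apply: (nul_ext (nul_cm nV' nn)) => t [/VV[[_ ncl] _] _].
  rewrite u'A; last by move=> Ut; apply: ncl; exact: subset_closure.
  by rewrite /w; apply: pairE => /=; ring.
move=> /(_ u'0 u'neg) h; apply: (nul_ext h) => z cz.
rewrite /mulsub /= -/(w z) u'A// => Uz.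
have [] : odisk 1 z /\ circle 1 z by split=> //; have [] := UU0 _ (subset_closure Uz).
by rewrite /odisk /circle /= => + e1; rewrite e1 ltxx.
Qed.

(** The homotopy [z - s g z] can vanish on the circle only if [s = 1], as [g z] is in the unit disk;
    that would be a fixed point. *)
Lemma sim_sub_circle (g : plane -> plane) : contin (circle 1) g ->
  (forall z, circle 1 z -> disk 1 (g z) /\ g z <> z) ->
  sim (circle 1) (fun z => z - g z) id.
Proof.
move=> cg H; apply: sim_sym.
pose K (q : plane * R) := q.1 - sc q.2 (g q.1).
have := @homotopy_sim _ _ (circle 1) K (compact_circle ler01).
have -> : (fun x => K (x, 0)) = id.
  by apply/funext => z; rewrite /K /sc /= !mul0r subr0.
have -> : (fun x => K (x, 1)) = (fun z => z - g z).
  by apply/funext => z; rewrite /K sc_id.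
apply.
  apply: contin_subp; first exact: contin_idfst.
  by apply: contin_sc; [exact: contin_idsnd|exact: (contin_cyl cg)].
move=> [z s] [/= cz /andP[s0 s1]] /eqP; rewrite subr_eq0 => /eqP /= e.
have [dg ng] := H z cz.
have : sq z = s ^+ 2 * sq (g z) by rewrite {1}e sq_sc.
move: (cz) (dg); rewrite /circle /disk /= expr1n => -> dg1 e1.
have s2 : s = 1.
  have := sq_ge0 (g z) => h; have : s ^+ 2 <= 1 by rewrite expr_le1.
  move=> h2; have h3 : s ^+ 2 = 1 by nra.
  by apply/eqP; rewrite -(@eqrXn2 _ 2)// expr1n h3.
by apply: ng; rewrite {2}e s2 sc_id.
Qed.

(** Each factor [z - a] with [a] in the open disk adds one to the degree, by [sim_sub_circle] for a
    constant map. *)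
Lemma mulsub_sim (zs : seq plane) : (forall z, z \in zs -> odisk 1 z) ->
  forall m w, sim (circle 1) w (cpow m) ->
  sim (circle 1) (fun z => mulsub zs (w z) z) (cpow (size zs + m)).
Proof.
elim: zs => [|a zs IH] oz m w sw; first exact: sw.
rewrite /mulsub /= addSnnS; apply: IH; first by move=> z zz; apply: oz; rewrite inE zz orbT.
have oa : odisk 1 a by apply: oz; rewrite mem_head.
have sa : sim (circle 1) (fun z => z - a) id.
  apply: (@sim_sub_circle (fun=> a)); first exact: contin_cst.
  move=> z cz; split; first exact: ltW.
  by move=> e; move: oa cz; rewrite e /odisk /circle /= => + e1; rewrite e1 ltxx.
by apply: (nul_ext (sim_cm sw sa)) => z _; rewrite /cpow /= (cmC (cpow m z)).
Qed.

Lemma no_negative_fixed_points (Phi : plane -> plane) :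
  contin (disk 1) Phi -> (forall z, disk 1 z -> disk 1 (Phi z)) ->
  (forall z, disk 1 z -> Phi z = z ->
     [/\ odisk 1 z, neg_zero (fun z => z - Phi z) z &
         exists2 U, nbhs z U & forall t, U t -> disk 1 t -> Phi t = t -> t = z]) -> False.
Proof.
move=> cPhi PhiD H.
pose u z := z - Phi z.
have cu : contin (disk 1) u by apply: contin_subp => //; exact: contin_id.
pose F := [set z | disk 1 z /\ Phi z = z].
have clF : closed F.
  rewrite (_ : F = disk 1 `&` u @^-1` [set 0]).
    apply: contin_preimage_closed => //; first exact: closed_disk_set.
    by apply: accessible_closed_set1; apply: hausdorff_accessible; exact: plane_hausdorff.
  apply/seteqP; split => z [dz] /=; first by move=> e; split=> //; rewrite /u /= e subrr.
  by move=> /eqP; rewrite subr_eq0 => /eqP e; split.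
have cF : compact F.
  by apply: (subclosed_compact clF (compact_disk ler01)) => z [].
have [zs uz zsE] : exists2 zs : seq plane, uniq zs & forall z, z \in zs <-> F z.
  have [s sE] : exists s : seq plane, forall x, F x -> x \in s.
    apply: compact_discrete_seq cF _ => x [dx ex].
    have [_ _ [U nU UE]] := H x dx ex.
    by apply: filterS nU => t Ut [dt et]; exact: UE.
  exists (undup [seq z <- s | `[< F z >]]); first exact: undup_uniq.
  move=> z; rewrite mem_undup mem_filter; split; first by move=> /andP[/asboolP].
  by move=> Fz; rewrite sE// andbT; apply/asboolP.
have n1 : nul (circle 1) (fun z => mulsub zs (u z) z).
  apply: neg_zeros_nul => //.
    move=> z dz /eqP; rewrite subr_eq0 => /eqP e; apply/zsE; split=> //.
  by move=> z /zsE[dz ez]; have [] := H z dz ez.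
have su : sim (circle 1) u (cpow 1).
  apply: (sim_trans (v := id)).
    apply: sim_sub_circle; first by apply: contin_sub cPhi; exact: circle_disk.
    move=> z cz; have dz := circle_disk cz; split; first exact: PhiD.
    by move=> e; have [] := H z dz e; rewrite /odisk /= cz ltxx.
  have E : (id : plane -> plane) = cpow 1.
    by apply/funext => z; rewrite /cpow /=; apply: pairE => /=; ring.
  rewrite -E; apply: sim_refl => z cz; apply: sq_gt0_neq; rewrite cz expr1n//.
have := mulsub_sim _ su => /(_ zs) S.
apply: (@cpow_not_nul R (size zs + 1)%N); first by rewrite addn1.
apply: sim_nul n1; apply: sim_sym; apply: S.
by move=> z /zsE[dz ez]; have [] := H z dz ez.
Qed.

End Index.

(** * Saddles have index -1 *)

Section Transfer.
Variable R : realType.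
Notation plane := (R * R)%type.

Lemma near_diskP (P : plane -> Prop) :
  (\forall v \near (0 : plane), P v) <-> exists2 r, 0 < r & forall v, disk r v -> P v.
Proof.
split.
  by move=> /nbhs_diskP[r r0 H]; exists r => // v /H; rewrite /= add0r.
by move=> [r r0 H]; apply/nbhs_diskP; exists r => // v dv; rewrite /= add0r; exact: H.
Qed.

Lemma open_image_odisk (r : R) (phi : plane -> plane) : contin (disk r) phi ->
  {in disk r &, injective phi} -> open (phi @` odisk r).
Proof.
move=> cphi iphi; rewrite openE => _ [v ov <-].
have sub : odisk r `<=` disk r by move=> w; exact: ltW.
apply: invariance_of_domain; first exact: open_nbhs_nbhs (conj (@open_odisk _ r) ov).
- exact: contin_sub cphi.
- by move=> a b; rewrite !inE => /sub da /sub db; apply: iphi; rewrite inE.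
Qed.

(* At [v] the pair (v, h v) is moved to (R v, 0), R the reflection in the second axis, without ever
   meeting the diagonal; what remains is invariant under R. *)
Lemma saddle_index0 (phi h Phi : plane -> plane) (mu la r0 : R) : 0 < r0 ->
  contin (disk r0) phi -> {in disk r0 &, injective phi} -> contin (disk r0) h ->
  (forall e, 0 < e -> \forall v \near (0 : plane), sq (h v - (mu * v.1, la * v.2)) <= e * sq v) ->
  1 < mu -> la < 1 -> (\forall v \near (0 : plane), Phi (phi v) = phi (h v)) ->
  neg_zero (fun z => z - Phi z) (phi 0) /\
  exists2 U, nbhs (phi 0) U & forall t, U t -> Phi t = t -> t = phi 0.
Proof.
move=> r00 cphi iphi ch est mu1 la1 PhiE.
have inj a b : disk r0 a -> disk r0 b -> phi a = phi b -> a = b.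
  by move=> da db; apply: iphi; rewrite inE.
pose M := mu ^+ 2 + la ^+ 2 + 1.
have M1 : 1 <= M by rewrite /M; have := sqr_ge0 mu; have := sqr_ge0 la; lra.
(* [b] bounds from below the coefficients [(1 - s) (mu - 1) + s] and [(1 - s) (1 - la) + s] that
   appear along the homotopy; the error [e = b^2 / 2] is then too small for a collision. *)
pose b := Num.min (mu - 1) (Num.min (1 - la) 1).
have b0 : 0 < b by rewrite !lt_min; apply/and3P; split; lra.
have b1 : b <= 1 by rewrite !ge_min lexx !orbT.
have b2 : b <= mu - 1 by rewrite ge_min lexx.
have b3 : b <= 1 - la by rewrite !ge_min lexx ?orbT.
pose e := b ^+ 2 / 2.
have e0 : 0 < e by rewrite /e divr_gt0// exprn_gt0.
have e1 : e <= 1 by rewrite /e; nra.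
have [r1 r10 H1] := (near_diskP _).1 (filterI (est e e0) PhiE).
(* On this disk the squared norm of [h v] is at most [4 M] times that of [v], so [h v] and its
   multiples by [s] in [0, 1] stay in the domain of [phi]. *)
pose r2 := Num.min r1 (r0 / (4 * M)).
have r20 : 0 < r2 by rewrite lt_min r10 divr_gt0// mulr_gt0//; lra.
have d20 v : disk r2 v -> 4 * M * sq v <= r0 ^+ 2.
  move=> dv; have h1 : r2 * (4 * M) <= r0 by rewrite -ler_pdivlMr ?ge_min ?lexx ?orbT// mulr_gt0//; lra.
  have h2 : sq v <= r2 ^+ 2 by [].
  have M0 : 0 <= 4 * M by move: M1; clear; lra.
  have h3 : (r2 * (4 * M)) ^+ 2 <= r0 ^+ 2 by rewrite ler_pXn2r ?nnegrE ?(ltW r00) ?(mulr_ge0 (ltW r20) M0).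
  apply: le_trans h3; rewrite exprMn mulrC.
  have h4 : 4 * M <= (4 * M) ^+ 2 by nra.
  have h5 := sqr_ge0 r2; have h6 := sq_ge0 v.
  by apply: ler_pM => //; lra.
have d21 v : disk r2 v -> disk r1 v.
  move=> dv; apply: le_trans (_ : sq v <= r2 ^+ 2) _ => //.
  by rewrite ler_pXn2r ?nnegrE ?(ltW r20) ?(ltW r10)// ge_min lexx.
have d2 v : disk r2 v -> disk r0 v.
  by move=> /d20; rewrite /disk /=; apply: le_trans; have := sq_ge0 v; nra.
have H1e v : disk r2 v -> sq (h v - (mu * v.1, la * v.2)) <= e * sq v.
  by move=> /d21/H1[].
have dh v s : disk r2 v -> 0 <= s <= 1 -> disk r0 (sc s (h v)).
  move=> dv /andP[s0 s1]; rewrite /disk /= sq_sc.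
  apply: le_trans (d20 _ dv); apply: (@le_trans _ _ (sq (h v))).
    by rewrite ler_piMl ?sq_ge0// expr_le1.
  have := H1e v dv; rewrite /sq /= /M.
  set h1 := (h v).1; set h2 := (h v).2; set x := v.1; set y := v.2 => E.
  have q1 := sqr_ge0 (h1 - 2 * (mu * x)); have q2 := sqr_ge0 (h2 - 2 * (la * y)).
  have q3 := sqr_ge0 x; have q4 := sqr_ge0 y.
  have q5 : h1 ^+ 2 + h2 ^+ 2 <= 2 * e * (x ^+ 2 + y ^+ 2) + 2 * (mu ^+ 2 * x ^+ 2 + la ^+ 2 * y ^+ 2) by move: E q1 q2; clear; nra.
  have q6 := mulr_ge0 (sqr_ge0 mu) q4; have q7 := mulr_ge0 (sqr_ge0 la) q3.
  have q8 := mulr_ge0 (sqr_ge0 mu) q3; have q9 := mulr_ge0 (sqr_ge0 la) q4.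
  have q10 : e * (x ^+ 2 + y ^+ 2) <= x ^+ 2 + y ^+ 2 by rewrite ler_piMl// addr_ge0.
  by move: M1 q5 q10 q3 q4 q6 q7 q8 q9; rewrite /M; clear; nra.
have dr v s : disk r2 v -> 0 <= s <= 1 -> disk r0 ((1 - 2 * s) * v.1, v.2).
  move=> dv /andP[s0 s1]; have := d2 _ dv; rewrite /disk /=; apply: le_trans.
  rewrite /sq /= exprMn lerD2r ler_piMl ?sqr_ge0//; nra.
(* A collision at time [s] would express [- x] and [y], times coefficients at least [b], as [1 - s]
   times the errors [f1] and [f2]; then the squared error is at least [b^2 sq v], twice what is
   allowed. *)
have ne v s : disk r2 v -> 0 <= s <= 1 -> v <> 0 -> ((1 - 2 * s) * v.1, v.2) <> sc (1 - s) (h v).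
  move=> dv /andP[s0 s1] /sq_gt0 v0 [E1 E2]; have := H1e v dv; rewrite /sq /=.
  move: v0; rewrite /sq; set x := v.1 in E1 *; set y := v.2 in E2 *.
  set f1 := _ - mu * x; set f2 := _ - la * y => v0 E.
  have F1 : ((1 - s) * (mu - 1) + s) * (- x) = (1 - s) * f1.
    by rewrite /f1 [RHS]mulrBr -E1; ring.
  have F2 : ((1 - s) * (1 - la) + s) * y = (1 - s) * f2.
    by rewrite /f2 [RHS]mulrBr -E2; ring.
  have G (c f w : R) : b <= c -> c * w = (1 - s) * f -> b ^+ 2 * w ^+ 2 <= f ^+ 2.
    move=> bc cw; apply: (@le_trans _ _ ((c * w) ^+ 2)).
      by rewrite exprMn ler_wpM2r ?sqr_ge0// ler_pXn2r ?nnegrE ?(ltW b0) ?(le_trans (ltW b0) bc).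
    have os : 0 <= 1 - s <= 1 by rewrite subr_ge0 s1 gerBl s0.
    by rewrite cw exprMn ler_piMl ?sqr_ge0// expr_le1//; case/andP: os.
  have G1 := G _ _ _ _ F1; have G2 := G _ _ _ _ F2.
  have {}G1 : b ^+ 2 * (- x) ^+ 2 <= f1 ^+ 2 by apply: G1; move: b1 b2 s0 s1; clear; nra.
  have {}G2 : b ^+ 2 * y ^+ 2 <= f2 ^+ 2 by apply: G2; move: b1 b3 s0 s1; clear; nra.
  rewrite sqrrN in G1; have b20 : 0 < b ^+ 2 by rewrite exprn_gt0.
  have := mulr_gt0 b20 v0; rewrite /e in E; move: E G1 G2; clear; nra.
have nfix v : disk r2 v -> v <> 0 -> phi v <> phi (h v).
  move=> dv v0 E; apply: (ne v 0 dv _ v0); first by rewrite lexx ler01.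
  rewrite mulr0 subr0 sc_id mul1r -surjective_pairing; apply: (inj _ _ (d2 _ dv) _ E).
  by rewrite -(sc_id (h v)); apply: dh => //; rewrite ler01 lexx.
have Cd r : 0 < r -> r <= r2 -> disk r `<=` disk r2.
  move=> rp rr v dv; apply: le_trans (_ : sq v <= r ^+ 2) _ => //.
  by rewrite ler_pXn2r ?nnegrE ?(ltW rp) ?(ltW r20).
have main r : 0 < r -> r <= r2 ->
    nul (circle r) (fun v => cm (phi v - Phi (phi v)) (phi v - phi 0)).
  move=> rp rr.
  have D v : circle r v -> disk r2 v by move=> /circle_disk; exact: Cd.
  have Cn v : circle r v -> v <> 0.
    by rewrite /circle /= => cv; apply: sq_gt0_neq; rewrite cv exprn_gt0.
  have cphiC : contin (circle r) phi by apply: contin_sub cphi => v /D/d2.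
  have d00 : disk r0 0 by rewrite /disk /sq /= expr0n /= addr0 sqr_ge0.
  pose H (q : plane * R) := phi ((1 - 2 * q.2) * q.1.1, q.1.2) - phi (sc (1 - q.2) (h q.1)).
  have cs : contin (cyl (circle r)) (fun q : plane * R => q.2) by exact: contin_idsnd.
  have cv : contin (cyl (circle r)) (fun q : plane * R => q.1) by exact: contin_idfst.
  have c1 : contin (cyl (circle r)) (fun _ : plane * R => (1 : R)) by exact: contin_cst.
  have chC : contin (circle r) h by apply: contin_sub ch => v /D/d2.
  have cH : contin (cyl (circle r)) H.
    apply: contin_subp.
      apply: (contin_comp _ cphi) => [|q [/D dq q01]]; last exact: dr.
      apply: contin_pair; last exact: contin_snd.
      apply: continM; last exact: contin_fst.
      by apply: continB => //; apply: continM => //; exact: contin_cst.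
    apply: (contin_comp _ cphi) => [|q [/D dq /andP[q0 q1]]]; last first.
      by apply: (dh _ _ dq); rewrite subr_ge0 q1 gerBl q0.
    by apply: contin_sc; [exact: continB|exact: (contin_cyl chC)].
  have H0 q : cyl (circle r) q -> H q <> 0.
    move=> [cq q01] /eqP; rewrite subr_eq0 => /eqP E.
    apply: (ne q.1 q.2 (D _ cq) q01 (Cn _ cq)); apply: inj E; first exact: dr (D _ cq) q01.
    by case/andP: q01 => q0 q1; apply: (dh _ _ (D _ cq)); rewrite subr_ge0 q1 gerBl q0.
  have S := homotopy_sim (compact_circle (ltW rp)) cH H0.
  have Dr v : circle r v -> disk r0 (- v.1, v.2).
    by move=> /D/d2; rewrite /disk /sq /= sqrrN.
  have S0 : sim (circle r) (fun v => phi v - phi 0) (fun v => phi v - phi 0).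
    apply: sim_refl => v cv' /eqP; rewrite subr_eq0 => /eqP E.
    by apply: (Cn v cv'); apply: inj E => //; exact: d2 (D _ cv').
  apply: (sim_nul (v := fun v => cm (phi (- v.1, v.2) - phi 0) (phi v - phi 0))).
    apply: (nul_ext (sim_cm S S0)) => v cv' /=.
    rewrite /H /= mulr0 !subr0 mul1r mulr1 subrr sc_id -surjective_pairing.
    have [_ ->] := H1 v (d21 _ (D _ cv')).
    have -> : sc 0 (h v) = 0 by rewrite /sc !mul0r.
    by rewrite (_ : 1 - 2 = -1) ?mulN1r//; ring.
  apply: (nul_fold rp).
  - apply: contin_cm; last by apply: contin_subp; [exact: cphiC|exact: contin_cst].
    apply: contin_subp; last exact: contin_cst.
    apply: (contin_comp _ cphi) => [|v cvr]; last exact: Dr cvr.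
    apply: contin_pair; last by apply: contin_snd; exact: contin_id.
    by apply: continN; apply: contin_fst; exact: contin_id.
  - move=> v cv'; apply: cm_neq0 => /eqP; rewrite subr_eq0 => /eqP E; apply: (Cn v cv').
      have := inj _ _ (Dr _ cv') d00 E => -[E1 E2].
      by apply: pairE => //=; apply: oppr_inj; rewrite E1 oppr0.
    by apply: inj E => //; exact: d2 (D _ cv').
  - by move=> v cv' /=; rewrite opprK -surjective_pairing cmC.
have di r : 0 < r -> r <= r2 -> {in disk r &, injective phi}.
  by move=> rp rr a b'; rewrite !inE => /(Cd _ rp rr)/d2 da /(Cd _ rp rr)/d2 db; exact: inj.
have dc r : 0 < r -> r <= r2 -> contin (disk r) phi.
  by move=> rp rr; apply: contin_sub cphi => v /(Cd _ rp rr)/d2.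
split.
  move=> U0 nU0.
  have d00 : nbhs (0 : plane) (disk r0).
    by apply/near_diskP; exists r0.
  have : nbhs (0 : plane) (phi @^-1` U0).
    have oo : odisk r0 (0 : plane) by rewrite /odisk /sq /= expr0n /= addr0 exprn_gt0.
    apply: (contin_open _ (@open_odisk _ r0)) => //.
    by apply: contin_sub cphi => v; exact: ltW.
  move=> /near_diskP[r3 r30 H3].
  pose r := Num.min r2 r3.
  have rp : 0 < r by rewrite lt_min r20.
  have rr : r <= r2 by rewrite ge_min lexx.
  have r3r : disk r `<=` disk r3.
    move=> v dv; apply: le_trans (_ : sq v <= r ^+ 2) _ => //.
    by rewrite ler_pXn2r ?nnegrE ?(ltW rp) ?(ltW r30)// ge_min lexx orbT.
  have clo : closure (phi @` odisk r) `<=` phi @` disk r.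
    have : closed (phi @` disk r).
      apply: compact_closed; first exact: plane_hausdorff.
      by apply: contin_image_compact; [exact: dc|exact: compact_disk (ltW rp)].
    move=> /closure_id ->; apply: closureS => _ [v ov <-]; exists v => //; exact: ltW.
  exists (phi @` odisk r); split.
  - by apply: open_image_odisk; [exact: dc|exact: di].
  - by exists 0 => //; rewrite /odisk /sq /= expr0n /= addr0 exprn_gt0.
  - by move=> z /clo[v dv <-]; apply: H3; exact: r3r.
  - have : nul (phi @` circle r) (fun z => cm (z - Phi z) (z - phi 0)).
      apply: nul_image; [exact: compact_circle (ltW rp)| | |exact: main].
        by apply: contin_sub (dc _ rp rr); exact: circle_disk.
      move=> a b'; rewrite !inE => /circle_disk da /circle_disk db.
      by apply: (di _ rp rr); rewrite inE.
    apply: nul_sub => z [/clo[v dv <-] no]; exists v => //.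
    apply/eqP; rewrite eq_le; apply/andP; split; first exact: dv.
    by rewrite leNgt; apply/negP => ov; apply: no; exists v.
exists (phi @` disk r2).
  by apply: invariance_of_domain0 => //; [exact: dc|exact: di].
move=> t [v dv <-]; have [_ ->] := H1 v (d21 _ dv) => E.
have [->//|v0] := pselect (v = 0).
by case: (nfix v dv v0).
Qed.

Lemma saddle_index (phi h Phi : plane -> plane) (mu la : R) (w0 : plane) (U : set plane) :
  nbhs w0 U -> contin U phi -> {in U &, injective phi} -> contin U h ->
  (forall e, 0 < e -> \forall v \near (0 : plane),
     sq (h (w0 + v) - w0 - (mu * v.1, la * v.2)) <= e * sq v) ->
  1 < mu -> la < 1 -> (\forall w \near w0, Phi (phi w) = phi (h w)) ->
  neg_zero (fun z => z - Phi z) (phi w0) /\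
  exists2 U, nbhs (phi w0) U & forall t, U t -> Phi t = t -> t = phi w0.
Proof.
move=> /nbhs_diskP[r r0 rU] cphi iphi ch est mu1 la1 /nbhs_diskP[r' r'0 PhiE].
have ca : contin (disk r) (fun v : plane => w0 + v).
  by apply: contin_addp; [exact: contin_cst|exact: contin_id].
have := @saddle_index0 (fun v => phi (w0 + v)) (fun v => h (w0 + v) - w0) Phi mu la r r0.
rewrite addr0; apply => //.
- exact: (contin_comp ca cphi).
- move=> a b; rewrite !inE => da db /iphi; rewrite !inE => /(_ (rU _ da) (rU _ db)).
  exact: addrI.
- by apply: contin_subp; [exact: (contin_comp ca ch)|exact: contin_cst].
- by apply/near_diskP; exists r' => // v /PhiE /= ->; congr phi; rewrite [RHS]addrC subrK.
Qed.

End Transfer.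

(** * Arcs on an invariant line *)

Section Power.
Variable R : realType.

Lemma bernoulli (x : R) n : 0 <= x -> 1 + n%:R * x <= (1 + x) ^+ n.
Proof.
move=> x0; elim: n => [|n IH]; first by rewrite mul0r addr0 expr0.
rewrite exprS -natr1; have h : 0 <= n%:R * x * x by rewrite !mulr_ge0.
have : (1 + x) * (1 + n%:R * x) <= (1 + x) * (1 + x) ^+ n by rewrite ler_wpM2l//; lra.
by apply: le_trans; lra.
Qed.

Lemma pow_unbounded (q B : R) : 1 < q -> exists n, B < q ^+ n.
Proof.
move=> q1; pose x := q - 1; have x0 : 0 < x by rewrite /x; lra.
exists (Num.bound (`|B| / x)); set n := Num.bound _.
have h : `|B| / x < n%:R by apply: archi_boundP; rewrite divr_ge0// ltW.
have := bernoulli n (ltW x0); rewrite (_ : 1 + x = q); last by rewrite /x; ring.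
apply: lt_le_trans; rewrite ltr_pdivrMr// in h; have := ler_norm B; lra.
Qed.

Lemma pow_small (q e : R) : 0 <= q -> q < 1 -> 0 < e -> exists n, q ^+ n < e.
Proof.
move=> q0 q1 e0; have [->|qn0] := eqVneq q 0; first by exists 1%N; rewrite expr1.
have qp : 0 < q by rewrite lt_neqAle eq_sym qn0.
have q1' : 1 < q^-1 by rewrite invf_gt1.
have [n nE] := @pow_unbounded q^-1 e^-1 q1'; exists n.
by rewrite -[ltRHS]invrK -[ltLHS]invrK ltf_pV2 ?posrE ?invr_gt0 ?exprn_gt0// -exprVn.
Qed.

(** Expansivity in scalar form: two orbits that separate at the rate [q] but stay at bounded
    distance coincide. *)
Lemma pow_bounded_eq0 (q B x : R) : 1 < q -> (forall n, q ^+ n * `|x| <= B) -> x = 0.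
Proof.
move=> q1 H; apply/eqP; rewrite -normr_eq0; apply/eqP/le_anti; rewrite normr_ge0 andbT leNgt.
apply/negP => x0; have [n nE] := @pow_unbounded q (B / `|x|) q1.
by have := H n; rewrite leNgt -ltr_pdivrMr// nE.
Qed.

(** With this [D], the number [D q^n] is the tail of the series of terms [C q^k] over [k > n]. *)
Lemma geometric_step (C D q : R) n : D * (1 - q) = C * q ->
  D * q ^+ n - D * q ^+ n.+1 = C * q ^+ n.+1.
Proof.
move=> Dq; rewrite exprS; transitivity ((D * (1 - q)) * q ^+ n); first by ring.
by rewrite Dq; ring.
Qed.

End Power.

Section Renormalize.
Variables (R : realType) (E : topologicalType) (K : E -> E) (u : E -> R) (nu C : R).
Hypotheses (cK : continuous K) (cu : continuous u) (nu1 : 1 < `|nu|) (C0 : 0 <= C).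
Hypothesis uK : forall z, `|u (K z) - nu * u z| <= C.

(* U = lim nu^-n (u o K^n), squeezed between the monotone sequences nu^-n (u o K^n) -/+ C' |nu|^-n. *)
Lemma renormalize : exists U : E -> R, [/\ continuous U, (forall z, U (K z) = nu * U z) &
  exists B, forall z, `|U z - u z| <= B].
Proof.
have nu0 : nu != 0 by rewrite -normr_gt0; apply: lt_trans nu1.
pose q := `|nu|^-1.
have q0 : 0 < q by rewrite invr_gt0 normr_gt0.
have q1 : q < 1 by rewrite invf_lt1// normr_gt0.
pose U_ n z := nu ^- n * u (iter n K z).
pose D := C * q / (1 - q).
have step n z : `|U_ n.+1 z - U_ n z| <= C * q ^+ n.+1.
  have -> : U_ n.+1 z - U_ n z = nu ^- n.+1 * (u (K (iter n K z)) - nu * u (iter n K z)).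
    rewrite /U_ iterS mulrBr; congr (_ - _).
    by rewrite exprS invfM mulrACA mulVf// mul1r.
  by rewrite normrM normfV normrX -exprVn -/q mulrC ler_wpM2r// exprn_ge0// ltW.
have Dq : D * (1 - q) = C * q by rewrite /D mulfVK// subr_eq0 gt_eqF.
have lo n z : U_ n z - D * q ^+ n <= U_ n.+1 z - D * q ^+ n.+1.
  have := step n z; rewrite ler_norml => /andP[h _].
  have : D * q ^+ n - D * q ^+ n.+1 = C * q ^+ n.+1.
    exact: (geometric_step n Dq).
  lra.
have hi n z : U_ n.+1 z + D * q ^+ n.+1 <= U_ n z + D * q ^+ n.
  have := step n z; rewrite ler_norml => /andP[_ h].
  have : D * q ^+ n - D * q ^+ n.+1 = C * q ^+ n.+1.
    exact: (geometric_step n Dq).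
  lra.
have D0 : 0 <= D by rewrite /D divr_ge0 ?mulr_ge0 ?(ltW q0)//; lra.
have lom z m n : (m <= n)%N -> U_ m z - D * q ^+ m <= U_ n z - D * q ^+ n.
  elim: n => [|n IH]; first by rewrite leqn0 => /eqP ->.
  by rewrite leq_eqVlt => /orP[/eqP -> //|/IH h]; apply: le_trans h (lo _ _).
have him z m n : (m <= n)%N -> U_ n z + D * q ^+ n <= U_ m z + D * q ^+ m.
  elim: n => [|n IH]; first by rewrite leqn0 => /eqP ->.
  by rewrite leq_eqVlt => /orP[/eqP -> //|/IH h]; apply: le_trans (hi _ _) h.
have mid z n : U_ n z - D * q ^+ n <= U_ n z + D * q ^+ n.
  have := mulr_ge0 D0 (exprn_ge0 n (ltW q0)); lra.
have lohi z m n : U_ m z - D * q ^+ m <= U_ n z + D * q ^+ n.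
  have [mn|/ltnW nm] := leqP m n.
    exact: le_trans (lom z _ _ mn) (mid z n).
  exact: le_trans (mid z m) (him z _ _ nm).
pose S z := range (fun n => U_ n z - D * q ^+ n).
pose U z := sup (S z).
have Sne z : S z !=set0 by exists (U_ 0%N z - D * q ^+ 0), 0%N.
have Uapp z n : `|U z - U_ n z| <= D * q ^+ n.
  have ubS : ubound (S z) (U_ n z + D * q ^+ n) by move=> _ [m _ <-]; exact: lohi.
  have h1 : U z <= U_ n z + D * q ^+ n by apply: ge_sup.
  have h2 : U_ n z - D * q ^+ n <= U z.
    apply: ub_le_sup; first by exists (U_ n z + D * q ^+ n).
    by exists n.
  by rewrite ler_norml; apply/andP; split; lra.
exists U; split.
- have cUn n : continuous (U_ n).
    apply: contin_setT; apply: continM; first exact: contin_cst.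
    apply: contin_continuous => z; apply: continuous_comp; last exact: cu.
    elim: n z => [|n IH] z; first exact: cvg_id.
    by apply: continuous_comp; [exact: IH|exact: cK].
  move=> z; apply/(@cvgrPdist_lt _ R^o) => e e0.
  have eD : 0 < e / (3 * (D + 1)) by rewrite divr_gt0// mulr_gt0//; have := D0; lra.
  have [n nE] := pow_small (ltW q0) q1 eD.
  have Dn : D * q ^+ n < e / 3.
    rewrite ltr_pdivlMr in nE; last by have := D0; lra.
    have := exprn_gt0 n q0; have := D0; nra.
  have := cUn n z => /(@cvgrPdist_lt _ R^o)/(_ (e / 3)).
  move=> /(_ ltac:(lra)); apply: filterS => t /= h.
  have := Uapp z n; have := Uapp t n; move: h.
  rewrite ltr_norml !ler_norml ltr_norml => /andP[a1 a2] /andP[a3 a4] /andP[a5 a6].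
  by apply/andP; split; lra.
- move=> z; apply/eqP; rewrite -subr_eq0 -normr_eq0; apply/eqP/le_anti; rewrite normr_ge0 andbT.
  rewrite leNgt; apply/negP => e0; set e := `|_| in e0.
  have eD : 0 < e / (2 * (D + 1)) by rewrite divr_gt0// mulr_gt0//; have := D0; lra.
  have [n nE] := pow_small (ltW q0) q1 eD.
  have Dn : 2 * (D * q ^+ n) < e.
    rewrite ltr_pdivlMr in nE; last by have := D0; lra.
    have := exprn_gt0 n q0; have := D0; nra.
  have E1 : U_ n (K z) = nu * U_ n.+1 z.
    by rewrite /U_ -iterSr exprS invfM !mulrA mulfV// mul1r.
  have h1 := Uapp (K z) n; have h2 := Uapp z n.+1.
  have h3 : `|nu * U z - U_ n (K z)| <= D * q ^+ n.
    rewrite E1 -mulrBr normrM; apply: le_trans (ler_wpM2l (normr_ge0 nu) h2) _.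
    by rewrite exprS (mulrCA D) !mulrA /q mulfV ?normr_eq0// mul1r.
  have : e <= `|U (K z) - U_ n (K z)| + `|U_ n (K z) - nu * U z|.
    by rewrite /e -{1}(subrK (U_ n (K z)) (U (K z))) -addrA; exact: ler_normD.
  rewrite [X in _ + X]distrC; lra.
- exists D => z; have := Uapp z 0%N.
  by rewrite /U_ expr0 invr1 !mul1r mulr1.
Qed.

End Renormalize.

Section Segment.
Variable R : realType.
Implicit Types a b : R.

Definition seg a b : set R := [set t | a <= t <= b].

Lemma segE a b : seg a b = `[a, b]%classic.
Proof. by apply/seteqP; split=> t; rewrite /seg /= in_itv. Qed.

Lemma compact_seg a b : compact (seg a b).
Proof. by rewrite segE; exact: segment_compact. Qed.

Lemma closed_seg a b : closed (seg a b).
Proof. by rewrite segE; exact: itv_closed. Qed.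

Lemma connected_seg a b : connected (seg a b).
Proof. by rewrite segE; exact: segment_connected. Qed.

Lemma ivt_seg a b v (h : R -> R) : a <= b -> contin (seg a b) h ->
  Num.min (h a) (h b) <= v <= Num.max (h a) (h b) -> exists2 c, seg a b c & h c = v.
Proof.
move=> ab; rewrite segE => /continP ch hv.
by have [c cab <-] := IVT ab ch hv; exists c.
Qed.

Lemma seg_between a b t (h : R -> R) : seg a b t -> contin (seg a b) h ->
  {in seg a b &, injective h} -> Num.min (h a) (h b) <= h t <= Num.max (h a) (h b).
Proof.
move=> /andP[at_ tb] ch ih; have ab := le_trans at_ tb.
have ch' : {within [set` `[a, b]], continuous h} by apply/continP; rewrite -segE.
have ih' : {in `[a, b] &, injective h}.
  by move=> x y; rewrite !in_itv /= => hx hy; apply: ih; rewrite inE.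
have [-> | nat_] := eqVneq a t; first by rewrite ge_min le_max lexx.
have [<- | ntb] := eqVneq t b; first by rewrite ge_min le_max lexx !orbT.
have lat : a < t by rewrite lt_neqAle nat_.
have ltb : t < b by rewrite lt_neqAle ntb.
have [ia iab it] : [/\ a \in `[a, b], b \in `[a, b] & t \in `[a, b]].
  by split; rewrite in_itv /= ?lexx ?ab ?at_ ?tb.
have [M|M] := itv_continuous_inj_mono ch' ih'.
  by rewrite ge_min le_max (ltW (M _ _ ia it lat)) (ltW (M _ _ it iab ltb)) orbT.
by rewrite ge_min le_max (ltW (M _ _ it ia lat)) (ltW (M _ _ iab it ltb)) orbT.
Qed.

Definition bdd (tau : R -> R) (A : R -> Prop) := exists M : R, forall t, A t -> `|tau t| <= M.

End Segment.

Section InvariantLine.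
Variables (R : realType) (T : topologicalType).
Variables (f finv : T -> T) (w : R -> T) (la : R) (p : T).
Hypotheses (hT : hausdorff_space T) (cfinv : continuous finv) (cw : continuous w).
Hypotheses (iw : injective w) (la0 : 0 < la) (la1 : la < 1) (w0 : w 0 = p).
Hypotheses (fw : forall s, f (w s) = w (la * s)) (finvw : forall s, finv (w s) = w (s / la)).

Let inI (t : R) := 0 <= t <= 1.

Lemma iter_finv_line m s : iter m finv (w s) = w (s / la ^+ m).
Proof.
elim: m => [|m IH]; first by rewrite expr0 divr1.
by rewrite iterS IH finvw exprSr invfM mulrA.
Qed.

(** The line [w] is only injectively immersed: its inverse is continuous on the images of compact
    segments, and this is why [tau] must be bounded. *)
Lemma line_param_contin (A : set R) (d : R -> T) (tau : R -> R) :
  contin A d -> (forall t, A t -> d t = w (tau t)) -> bdd tau A -> contin A tau.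
Proof.
move=> cd dw [M HM].
have K0 : seg (- `|M|) `|M| !=set0 by exists 0; rewrite /seg /= oppr_le0 normr_ge0.
have [psi [cpsi wK _]] := @contin_inverse R T (seg (- `|M|) `|M|) w hT (@compact_seg _ _ _)
  (contin_continuous cw) (in2W iw) K0.
have inK t : A t -> seg (- `|M|) `|M| (tau t).
  by move=> /HM h; rewrite /seg /= -ler_norml (le_trans h)// ler_norm.
apply: (contin_eq (f := fun t => psi (d t))).
  by move=> t; rewrite inE => At; rewrite dw// wK//; exact: inK.
apply: (contin_comp cd cpsi) => t At; exists (tau t); [exact: inK|by rewrite dw].
Qed.

Lemma pow_la_large (B : R) : exists N : nat, forall m, (N <= m)%N -> B < (la ^+ m)^-1.
Proof.
have q1 : 1 < la^-1 by rewrite invf_gt1.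
have [N HN] := pow_unbounded B q1; exists N => m Nm; apply: lt_le_trans HN _.
by rewrite -exprVn; apply: ler_weXn2l => //; exact: ltW.
Qed.

Section Escape.
Variables (d : R -> T) (tau : R -> R).
Hypotheses (cd : contin (seg 0 1) d) (injd : {in seg 0 1 &, injective d}).
Hypothesis dw : forall t, 0 < t <= 1 -> d t = w (tau t).
Hypothesis loc_bdd : forall e, 0 < e <= 1 -> bdd tau (fun t => e <= t <= 1).
Hypothesis unbdd : ~ bdd tau (fun t => 0 < t <= 1).

(** An arc in the line whose parameter is unbounded only at the end 0. The parameter is monotone, so
    it runs off to one end [e] of the line. The points [w (s / la^m)] then converge to [d 0], and
    since [finv] shifts this sequence by one, [d 0] is fixed. *)
Lemma escape_end : exists e : R, [/\ e = 1 \/ e = -1,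
  (forall t, 0 < t <= 1 -> e * tau 1 <= e * tau t),
  (forall s, e * tau 1 <= e * s -> exists2 t, 0 < t <= 1 & tau t = s),
  (forall s, 0 < e * s -> (fun m => w (s / la ^+ m)) @ \oo --> d 0) &
  finv (d 0) = d 0].
Proof.
pose I : set R := `]0, 1]%classic.
have IE t : I t = (0 < t <= 1) :> Prop by rewrite /I /= in_itv.
have ctau : contin I tau.
  apply: contin_local => t; rewrite IE => /andP[t0 t1].
  exists [set s | t / 2 < s].
    by apply: lt_nbhsr; lra.
  apply: (@contin_sub _ _ _ (seg (t / 2) 1)).
    by move=> s []; rewrite IE => /andP[s0 s1] /= s2; rewrite /seg /= s1 (ltW s2).
  apply: (@line_param_contin _ d).
  - by apply: contin_sub cd => s /andP[s1 s2]; apply/andP; split; lra.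
  - by move=> s /andP[s1 s2]; apply: dw; rewrite s2 andbT; lra.
  - have [M HM] := @loc_bdd (t / 2) ltac:(apply/andP; split; lra).
    by exists M => s; exact: HM.
have itau : {in `]0, 1] &, injective tau}.
  move=> s t; rewrite !in_itv /= => hs ht E; apply: injd.
  - by move: hs => /andP[a b]; apply/mem_set; rewrite /seg /= b ltW.
  - by move: ht => /andP[a b]; apply/mem_set; rewrite /seg /= b ltW.
  - by rewrite dw// dw// E.
have [e e1 mono] : exists2 e : R, e = 1 \/ e = -1 &
    forall s t, 0 < s -> s <= t -> t <= 1 -> e * tau t <= e * tau s.
  have ctau' : {within [set` `]0, 1]], continuous tau} by apply/continP.
  have [M|M] := itv_continuous_inj_mono ctau' itau.
    exists (-1); first by right.
    move=> s t s0 st t1; rewrite !mulN1r lerN2.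
    have [->//|ne] := eqVneq s t.
    by apply/ltW/M; rewrite ?in_itv /= ?s0 ?t1 ?(lt_le_trans s0 st) ?(le_trans st t1)//; rewrite lt_neqAle ne.
  exists 1; first by left.
  move=> s t s0 st t1; rewrite !mul1r.
  have [->//|ne] := eqVneq s t.
  by apply/ltW/M; rewrite ?in_itv /= ?s0 ?t1 ?(lt_le_trans s0 st) ?(le_trans st t1)//; rewrite lt_neqAle ne.
have e2 : e * e = 1 by case: e1 => ->; ring.
have en x : `|e * x| = `|x| by case: e1 => ->; rewrite ?mul1r ?mulN1r ?normrN.
have lo t : 0 < t <= 1 -> e * tau 1 <= e * tau t by move=> /andP[a b]; apply: mono.
have large B : exists2 t, 0 < t <= 1 & B < e * tau t.
  apply: contrapT => nB; apply: unbdd; exists (`|B| + `|tau 1|) => t ht.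
  have h1 : e * tau t <= B by rewrite leNgt; apply/negP => h; apply: nB; exists t.
  have h2 := lo t ht; rewrite -(en (tau t)) ler_norml.
  have := ler_norm B; have := lerNnormlW (lexx `|e * tau 1|); rewrite en => h3 h4.
  have := normr_ge0 B; have := normr_ge0 (tau 1); have := ler_norm (- (e * tau 1)).
  by rewrite normrN en => *; apply/andP; split; lra.
have hit s : e * tau 1 <= e * s -> exists2 t, 0 < t <= 1 & tau t = s.
  move=> hs; have [t0 ht0 lt0] := large (e * s); have /andP[t00 t01] := ht0.
  have [t] : exists2 t, seg t0 1 t & e * tau t = e * s.
    apply: (@ivt_seg _ _ _ _ (fun t => e * tau t)) => //.
      apply: continM; first exact: contin_cst.
      by apply: contin_sub ctau => t /andP[a b]; rewrite IE b (lt_le_trans t00 a).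
    by rewrite ge_min le_max hs orbT (ltW lt0).
  move=> /andP[a b] E; exists t; first by rewrite (lt_le_trans t00 a).
  by rewrite -[LHS]mul1r -[RHS]mul1r -e2 -!mulrA E.
have conv s : 0 < e * s -> (fun m => w (s / la ^+ m)) @ \oo --> d 0.
  move=> s0 W Wd.
  have d01 : seg (0 : R) 1 0 by rewrite /seg /= lexx ler01.
  have := cd d01 Wd; rewrite /= nbhs_simpl /within /= => /nbhs_ballP[r /= r0 rW].
  pose r' := Num.min (r / 2) 1.
  have r'0 : 0 < r' by rewrite lt_min divr_gt0//=.
  have r'1 : r' <= 1 by rewrite ge_min lexx orbT.
  have r'r : r' < r by rewrite gt_min; apply/orP; left; lra.
  have [M HM] := @loc_bdd r' ltac:(by rewrite r'0 r'1).
  (* Past this index the parameter exceeds the bound of [tau] on [[r', 1]], so the point sits on the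
     arc at a time below [r'], which is close to [d 0]. *)
  have [N HN] := pow_la_large ((`|M| + `|tau 1| + 1) / (e * s)).
  exists N => // m /= /HN; rewrite ltr_pdivrMr// => h.
  set x := s / la ^+ m.
  have xE : e * x = (la ^+ m)^-1 * (e * s) by rewrite /x; ring.
  have [t ht tx] : exists2 t, 0 < t <= 1 & tau t = x.
    apply: hit; rewrite xE; apply: ltW; apply: le_lt_trans h.
    by have := ler_norm (e * tau 1); rewrite en; have := normr_ge0 M; lra.
  rewrite -tx -dw//; move: (ht) => /andP[t0 t1].
  apply: (rW t); last by rewrite /seg /= t1 ltW.
  rewrite /ball /= sub0r normrN gtr0_norm//.
  rewrite ltNge; apply/negP => rt.
  have := HM t ltac:(apply/andP; split; lra).
  rewrite tx -en xE => h2; have := ler_norm ((la ^+ m)^-1 * (e * s)).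
  have := ler_norm M; have := normr_ge0 (tau 1); lra.
exists e; split=> //.
have ee : 0 < e * e by rewrite e2.
have c1 := conv e ee.
have c2 : (fun m => w (e / la ^+ m.+1)) @ \oo --> d 0.
  by move=> W /c1[N _ HN]; exists N => // m /= Nm; apply: (HN m.+1); exact: leqW.
have c3 : (fun m => w (e / la ^+ m.+1)) @ \oo --> finv (d 0).
  have -> : (fun m => w (e / la ^+ m.+1)) = (fun m => finv (w (e / la ^+ m))).
    by apply/funext => m; rewrite finvw exprSr invfM mulrA.
  by move=> W /cfinv /c1[N HN1 HN]; exists N.
exact: (cvg_unique hT c3 c2).
Qed.

End Escape.

Lemma fixed_line s : finv (w s) = w s -> s = 0.
Proof.
rewrite finvw => /iw /eqP; rewrite -subr_eq0 -{2}(mulr1 s) -mulrBr mulf_eq0 => /orP[/eqP//|].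
have q1 : 1 < la^-1 by rewrite invf_gt1.
by rewrite subr_eq0 => /eqP E; move: q1; rewrite E ltxx.
Qed.

Variable g : R -> T.
Hypotheses (cg : contin (seg 0 1) g) (ig : {in seg 0 1 &, injective g}).
Hypotheses (g0 : g 0 = p) (gw : forall t, inI t -> exists s, g t = w s).

(** The parameter of [g] can be unbounded only near time 0, because another end of an unbounded
    stretch would be a fixed point of [finv] on the line other than [p]. If it is bounded, [g] is a
    segment of the line; otherwise [g] arrives at [p] from one end of the line and is stable under
    [finv]. *)
Lemma arc_on_line :
  (exists s1, [/\ s1 != 0, g 1 = w s1 & forall x, (exists2 t, inI t & g t = x) <-> (exists2 t, inI t & w (t * s1) = x)]) \/
  [/\ forall x, (exists2 t, inI t & g t = x) -> exists2 t, inI t & g t = finv x,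
      ~ (exists2 t, inI t & g t = f (g 1)) &
      forall x, (exists2 t, inI t & g t = x) -> (fun k => iter k finv x) @ \oo --> p].
Proof.
have [sg sgE] : exists sg : R -> R, forall t, inI t -> g t = w (sg t).
  have H t : exists s, inI t -> g t = w s.
    by have [/gw[s E]|n] := pselect (inI t); [exists s|exists 0].
  by have [sg sgE] := choice H; exists sg.
have isg s t : inI s -> inI t -> sg s = sg t -> s = t.
  by move=> hs ht E; apply: ig; rewrite ?inE// !sgE// E.
have cont (A : set R) : A `<=` seg 0 1 -> bdd sg A -> contin A sg.
  move=> AI bA; apply: (@line_param_contin _ g) => //; first exact: contin_sub cg.
  by move=> t /AI; exact: sgE.
have i1 : inI 1 by rewrite /inI ler01 lexx.
have i0 : inI 0 by rewrite /inI ler01 lexx.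
have sg0 : sg 0 = 0 by apply: iw; rewrite -sgE// g0.
(* boundedness extends to an end point b > 0, from the side of u *)
have ext b u : inI b -> inI u -> b != 0 -> b != u ->
    (forall e, 0 < e <= 1 -> bdd sg (fun x => exists2 t, e <= t <= 1 & x = b + (u - b) * t)) ->
    bdd sg (fun x => exists2 t, 0 <= t <= 1 & x = b + (u - b) * t).
  move=> ib iu b0 bu H; apply: contrapT => nb.
  pose k t := b + (u - b) * t.
  have ik t : 0 <= t <= 1 -> inI (k t).
    by move: ib iu; rewrite /inI /k => /andP[? ?] /andP[? ?] /andP[? ?]; apply/andP; split; nra.
  have ck A : contin A k.
    by apply: continD; [exact: contin_cst|apply: continM; [exact: contin_cst|exact: contin_id]].
  have [] := @escape_end (fun t => g (k t)) (fun t => sg (k t)).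
  - by apply: (contin_comp (@ck _) cg) => t /ik.
  - move=> s t; rewrite !inE => /ik hs /ik ht /ig; rewrite !inE => /(_ hs ht) /addrI.
    by apply: mulfI; rewrite subr_eq0 eq_sym.
  - by move=> t /andP[t0 t1]; apply/sgE/ik; rewrite t1 ltW.
  - by move=> e he; have [M HM] := H e he; exists M => t ht; apply: HM; exists t.
  - move=> [M HM]; apply: nb; exists (Num.max M `|sg b|) => x [t /andP[t0 t1] ->].
    have [->|tn0] := eqVneq t 0; first by rewrite mulr0 addr0 le_max lexx orbT.
    by rewrite le_max HM// t1 andbT lt_neqAle eq_sym tn0.
  move=> e [_ _ _ _]; rewrite /k mulr0 addr0 sgE// => /fixed_line E.
  by move/eqP: b0; apply; apply: isg => //; rewrite sg0.
have bdd_sub A B : (forall x, A x -> B x) -> bdd sg B -> bdd sg A.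
  by move=> AB [M HM]; exists M => x /AB; exact: HM.
have bddU A B : bdd sg A -> bdd sg B -> bdd sg (fun x => A x \/ B x).
  move=> [M HM] [N HN]; exists (Num.max M N) => x [/HM|/HN] h.
    by rewrite le_max h.
  by rewrite le_max h orbT.
have extR u b : 0 <= u -> u < b -> b <= 1 ->
    (forall b', u <= b' -> b' < b -> bdd sg (fun x => u <= x <= b')) -> bdd sg (fun x => u <= x <= b).
  move=> u0 ub b1 H.
  have := @ext b u; rewrite /inI => E.
  apply: (bdd_sub _ (fun x => exists2 t, 0 <= t <= 1 & x = b + (u - b) * t)).
    move=> x /andP[x1 x2]; exists ((b - x) / (b - u)); last by field; rewrite subr_eq0 gt_eqF.
    by rewrite divr_ge0 ?ler_pdivrMr ?mul1r//; lra.
  apply: E; try (apply/andP; split; lra); try (rewrite gt_eqF//; lra).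
  move=> e /andP[e0 e1]; apply: (bdd_sub _ (fun x => u <= x <= b + (u - b) * e)).
    by move=> x [t /andP[t0 t1] ->]; apply/andP; split; nra.
  by apply: H; nra.
have extL u b : 0 < b -> b < u -> u <= 1 ->
    (forall b', b < b' -> b' <= u -> bdd sg (fun x => b' <= x <= u)) -> bdd sg (fun x => b <= x <= u).
  move=> b0 bu u1 H.
  have := @ext b u; rewrite /inI => E.
  apply: (bdd_sub _ (fun x => exists2 t, 0 <= t <= 1 & x = b + (u - b) * t)).
    move=> x /andP[x1 x2]; exists ((x - b) / (u - b)); last by field; rewrite subr_eq0 gt_eqF.
    by rewrite divr_ge0 ?ler_pdivrMr ?mul1r//; lra.
  apply: E; try (apply/andP; split; lra); try (by rewrite gt_eqF//; lra); try (by rewrite lt_eqF//; lra).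
  move=> e /andP[e0 e1]; apply: (bdd_sub _ (fun x => b + (u - b) * e <= x <= u)).
    by move=> x [t /andP[t0 t1] ->]; apply/andP; split; nra.
  by apply: H; nra.
have bdd1 x : bdd sg (fun y => x <= y <= x).
  by exists `|sg x| => y /andP[h1 h2]; rewrite (le_anti (_ : x <= y <= x)) ?h1.
(* If no such subinterval existed, the parameter would be bounded on every interval missing the
   closed set [C] of times with [|sg| <= k], hence up to the adjacent points of [C], and finally on
   [[u, v]]. *)
have stp u v (k : R) : 0 < u -> u <= v -> v <= 1 -> 0 <= k -> ~ bdd sg (fun x => u <= x <= v) ->
    exists u' v', [/\ u <= u', u' <= v', v' <= v, ~ bdd sg (fun x => u' <= x <= v') &
      forall t, u' <= t <= v' -> k < `|sg t|].
  move=> u0 uv v1 k0 nb; apply: contrapT => nex.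
  have good u' v' : u <= u' -> u' <= v' -> v' <= v -> (forall t, u' <= t <= v' -> k < `|sg t|) ->
      bdd sg (fun x => u' <= x <= v').
    by move=> h1 h2 h3 h4; apply: contrapT => h5; apply: nex; exists u', v'.
  pose C t := u <= t <= v /\ `|sg t| <= k.
  have nC t : u <= t <= v -> ~ C t -> k < `|sg t|.
    by move=> tuv nc; rewrite ltNge; apply/negP => h; apply: nc.
  have CI t : u <= t <= v -> inI t by move=> /andP[h1 h2]; apply/andP; split; [exact: (le_trans (ltW u0) h1)|exact: (le_trans h2 v1)].
  have clC : closed C.
    have -> : C = seg u v `&` g @^-1` (w @` seg (- k) k).
      apply/seteqP; split => t [tuv].
        by move=> sk; split=> //=; exists (sg t); [rewrite /seg /= -ler_norml|rewrite -sgE//; exact: CI].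
      by move=> [s sk sE]; split=> //; rewrite ler_norml; rewrite sgE ?CI// in sE; rewrite -(iw sE).
    apply: contin_preimage_closed; last 1 first.
    - apply: compact_closed => //; apply: contin_image_compact; last exact: compact_seg.
      exact: contin_continuous.
    - by apply: contin_sub cg => t /CI.
    - exact: closed_seg.
  have cC x y : compact (C `&` seg x y).
    by rewrite setIC; apply: compact_closedI => //; exact: compact_seg.
  have maxC x y t0 : C t0 -> x <= t0 <= y -> exists a, [/\ C a, x <= a <= y & forall t, C t -> x <= t <= y -> t <= a].
    move=> Ct0 xy; have ne : (C `&` seg x y) !=set0 by exists t0.
    have [c] := compact_EVT_max ne (cC x y) ((continP _ _).2 (@contin_id _ _)).
    rewrite inE => -[c1 c2] H; exists c; split=> // t t1 t2; apply: H; rewrite inE; split=> //.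
  have minC x y t0 : C t0 -> x <= t0 <= y -> exists a, [/\ C a, x <= a <= y & forall t, C t -> x <= t <= y -> a <= t].
    move=> Ct0 xy; have ne : (C `&` seg x y) !=set0 by exists t0.
    have [c] := compact_EVT_min ne (cC x y) ((continP _ _).2 (@contin_id _ _)).
    rewrite inE => -[c1 c2] H; exists c; split=> // t t1 t2; apply: H; rewrite inE; split=> //.
  have [[t0 Ct0]|noC] := pselect (exists t, C t); last first.
    by apply: nb; apply: good => // t ht; apply: nC => // Ct; apply: noC; exists t.
  have [a [Ca /andP[ua av] amin]] := minC u v t0 Ct0 Ct0.1.
  have [b [Cb /andP[ub bv] bmax]] := maxC u v t0 Ct0 Ct0.1.
  have B1 : bdd sg (fun x => u <= x <= a).
    have [->|ne] := eqVneq u a; first exact: bdd1.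
    have ult : u < a by rewrite lt_neqAle ne ua.
    apply: (extR _ _ (ltW u0) ult (le_trans av v1)).
    move=> b' h1 h2; have bv' := le_trans (ltW h2) av; apply: (good _ _ (lexx u) h1 bv').
    move=> t /andP[h3 h4]; have tv := le_trans h4 bv'.
    apply: nC; first by apply/andP; split; [exact: h3|exact: tv].
    move=> Ct; have := amin t Ct; rewrite h3 tv => /(_ isT); rewrite leNgt => /negP; apply.
    exact: le_lt_trans h4 h2.
  have B2 : bdd sg (fun x => b <= x <= v).
    have [->|ne] := eqVneq b v; first exact: bdd1.
    have blv : b < v by rewrite lt_neqAle ne bv.
    apply: (extL _ _ (lt_le_trans u0 ub) blv v1).
    move=> b' h1 h2; have ub' := le_trans ub (ltW h1); apply: (good _ _ ub' h2 (lexx v)).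
    move=> t /andP[h3 h4]; have ut := le_trans ub' h3.
    apply: nC; first by apply/andP; split; [exact: ut|exact: h4].
    move=> Ct; have := bmax t Ct; rewrite ut h4 => /(_ isT); rewrite leNgt => /negP; apply.
    exact: lt_le_trans h1 h3.
  (* Between consecutive points of [C] the parameter is bounded, hence continuous, and injective,
     hence monotone: its values lie between two values of modulus at most [k]. *)
  have B3 t : a <= t <= b -> `|sg t| <= k.
    move=> /andP[at_ tb]; rewrite leNgt; apply/negP => kt.
    have nCt : ~ C t by move=> [_]; rewrite leNgt kt.
    have [x [Cx /andP[ux xt] xmax]] := maxC u t a Ca ltac:(by rewrite ua at_).
    have [y [Cy /andP[ty yv] ymin]] := minC t v b Cb ltac:(by rewrite tb bv).
    have xlt : x < t by rewrite lt_neqAle xt andbT; apply/eqP => E; apply: nCt; rewrite -E.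
    have lty : t < y by rewrite lt_neqAle ty andbT; apply/eqP => E; apply: nCt; rewrite E.
    have b1 : bdd sg (fun z => x <= z <= t).
      apply: (extL _ _ (lt_le_trans u0 ux) xlt (le_trans tb (le_trans bv v1))).
      move=> b' h1 h2; apply: (good _ _ (le_trans ux (ltW h1)) h2 (le_trans tb bv)).
      move=> z /andP[h3 h4]; have uz : u <= z := le_trans ux (le_trans (ltW h1) h3).
      apply: nC; first by apply/andP; split; [exact: uz|exact: (le_trans h4 (le_trans tb bv))].
      move=> Cz; have := xmax z Cz; rewrite uz h4 => /(_ isT); rewrite leNgt => /negP; apply.
      exact: lt_le_trans h1 h3.
    have b2 : bdd sg (fun z => t <= z <= y).
      apply: (extR _ _ (ltW (lt_le_trans u0 (le_trans ua at_))) lty (le_trans yv v1)).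
      move=> b' h1 h2; apply: (good _ _ (le_trans ua at_) h1 (le_trans (ltW h2) yv)).
      move=> z /andP[h3 h4]; have zv : z <= v := le_trans h4 (le_trans (ltW h2) yv).
      apply: nC; first by apply/andP; split; [exact: (le_trans ua (le_trans at_ h3))|exact: zv].
      move=> Cz; have := ymin z Cz; rewrite h3 zv => /(_ isT); rewrite leNgt => /negP; apply.
      exact: le_lt_trans h4 h2.
    have xyI : seg x y `<=` seg 0 1.
      move=> z /andP[h1 h2]; apply: CI; apply/andP; split; first exact: le_trans ux h1.
      exact: le_trans h2 yv.
    have b3 : bdd sg (seg x y).
      apply: bdd_sub (bddU _ _ b1 b2) => z /andP[h1 h2].
      by have /orP[h|h] := le_total z t; [left|right]; exact/andP.
    have := @seg_between R x y t sg ltac:(by rewrite /seg /= xt ty) (cont _ xyI b3).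
    have inj : {in seg x y &, injective sg}.
      by move=> s t'; rewrite !inE => /xyI hs /xyI ht; exact: isg.
    move=> /(_ inj); case: Cx => _; case: Cy => _; move: kt.
    rewrite !ler_norml => kt /andP[h1 h2] /andP[h3 h4]; rewrite ge_min le_max => /andP[h5 h6].
    move: kt; rewrite ltNge ler_norml => /negP; apply.
    apply/andP; split; [case/orP: h5 => h5|case/orP: h6 => h6].
    - exact: le_trans h3 h5.
    - exact: le_trans h1 h5.
    - exact: le_trans h6 h4.
    - exact: le_trans h6 h2.
  apply: nb; have B4 : bdd sg (fun x => a <= x <= b) by exists k.
  apply: bdd_sub (bddU _ _ (bddU _ _ B1 B4) B2) => z /andP[h1 h2].
  have /orP[za|az] := le_total z a; first by left; left; exact/andP.
  have /orP[zb|bz] := le_total z b; first by left; right; exact/andP.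
  by right; exact/andP.
(* Iterating [stp] with [k = 0, 1, 2, ...] gives nested intervals; at a common point the parameter
   would exceed every integer. *)
have bddpos u : 0 < u -> u <= 1 -> bdd sg (fun x => u <= x <= 1).
  move=> u0 u1; apply: contrapT => nb.
  pose valid (I : R * R) := [/\ 0 < I.1, I.1 <= I.2, I.2 <= 1 & ~ bdd sg (fun x => I.1 <= x <= I.2)].
  have H (In : (R * R) * nat) : exists I' : R * R, valid In.1 ->
      [/\ valid I', In.1.1 <= I'.1, I'.2 <= In.1.2 & forall t, I'.1 <= t <= I'.2 -> In.2%:R < `|sg t|].
    have [[v1 v2 v3 v4]|nv] := pselect (valid In.1); last by exists In.1.
    have [u' [v' [h1 h2 h3 h4 h5]]] := stp _ _ In.2%:R v1 v2 v3 (ler0n _ _) v4.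
    exists (u', v') => _; split=> //; split=> //=; [exact: lt_le_trans h1|exact: le_trans h3 v3].
  have [F FE] := choice H.
  pose I_ := fix I_ n := if n is m.+1 then F (I_ m, m) else (u, 1).
  have val n : valid (I_ n).
    elim: n => [|n IH]; first by split=> //=.
    by have [] := FE (I_ n, n) IH.
  have nest n : [/\ (I_ n).1 <= (I_ n.+1).1, (I_ n.+1).2 <= (I_ n).2 &
      forall t, (I_ n.+1).1 <= t <= (I_ n.+1).2 -> n%:R < `|sg t|].
    by have [] := FE (I_ n, n) (val n).
  have lom m n : (m <= n)%N -> (I_ m).1 <= (I_ n).1.
    elim: n => [|n IH]; first by rewrite leqn0 => /eqP ->.
    rewrite leq_eqVlt => /orP[/eqP -> //|/IH h]; apply: le_trans h _.
    by have [] := nest n.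
  have him m n : (m <= n)%N -> (I_ n).2 <= (I_ m).2.
    elim: n => [|n IH]; first by rewrite leqn0 => /eqP ->.
    rewrite leq_eqVlt => /orP[/eqP -> //|/IH h]; apply: le_trans h.
    by have [] := nest n.
  have cross m n : (I_ m).1 <= (I_ n).2.
    have [_ le1 _ _] := val (maxn m n).
    apply: le_trans (lom _ _ (leq_maxl m n)) _; apply: le_trans le1 _.
    exact: him (leq_maxr m n).
  pose S := range (fun n => (I_ n).1).
  have S0 : S !=set0 by exists (I_ 0%N).1, 0%N.
  have ts n : (I_ n).1 <= sup S <= (I_ n).2.
    apply/andP; split.
      apply: ub_le_sup; last by exists n.
      by exists (I_ 0%N).2 => _ [m _ <-]; exact: cross.
    by apply: ge_sup => // _ [m _ <-]; exact: cross.
  have := archi_boundP (normr_ge0 (sg (sup S))); set n := Num.bound _ => h.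
  have [_ _ /(_ _ (ts n.+1))] := nest n.
  by move=> /(lt_trans h); rewrite ltxx.
have [b01|nb01] := pselect (bdd sg (fun t => 0 < t <= 1)).
  left; exists (sg 1).
  have b1 : bdd sg (seg 0 1).
    have [M HM] := b01; exists (Num.max M 0) => t /andP[t0 t1].
    have [->|tn] := eqVneq t 0; first by rewrite sg0 normr0 le_max lexx orbT.
    by rewrite le_max HM// t1 andbT lt_neqAle eq_sym tn.
  have cs := cont _ (fun t h => h) b1.
  have s1 : sg 1 != 0.
    by apply/eqP => E; have := isg 1 0 i1 i0; rewrite sg0 E => /(_ erefl) /eqP; rewrite oner_eq0.
  have inj : {in seg 0 1 &, injective sg} by move=> s t; rewrite !inE; exact: isg.
  split=> //; first exact: sgE.
  move=> x; split=> [[t it <-]|[t /andP[t0 t1] <-]].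
    have := @seg_between R 0 1 t sg it cs inj; rewrite sg0 => H.
    exists (sg t / sg 1); last by rewrite divfK// sgE.
    rewrite /inI.
    have [sp|sn] := ltP 0 (sg 1).
      move: H; rewrite min_l ?max_r ?(ltW sp)// => /andP[h1 h2].
      by rewrite divr_ge0 ?(ltW sp)//= ler_pdivrMr// mul1r.
    have {}sn : sg 1 < 0 by rewrite lt_neqAle s1.
    move: H; rewrite min_r ?max_l ?(ltW sn)// => /andP[h1 h2].
    by rewrite -mulrNN -invrN divr_ge0 ?oppr_ge0 ?(ltW sn)//= ler_pdivrMr ?oppr_gt0// mul1r lerN2.
  have [t' it' E] : exists2 t', seg 0 1 t' & sg t' = t * sg 1.
    apply: (ivt_seg ler01 cs); rewrite sg0.
    by have [sp|sn] := ltP 0 (sg 1); apply/andP; split; nra.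
  by exists t' => //; rewrite sgE// E.
(* The parameter runs off to the end [e] of the line: the arc consists of [p] and of all [w s] with
   [e * sg 1 <= e * s], a set that [finv] pushes further out. *)
right.
have lb e : 0 < e <= 1 -> bdd sg (fun t => e <= t <= 1) by move=> /andP[h1 h2]; exact: bddpos.
have sgE' t : 0 < t <= 1 -> g t = w (sg t) by move=> /andP[t0 t1]; apply: sgE; rewrite /inI t1 ltW.
have [e [e1 lo hit conv _]] := escape_end cg ig sgE' lb nb01.
have e2 : e * e = 1 by case: e1 => ->; ring.
have spos : 0 < e * sg 1.
  rewrite ltNge; apply/negP => h.
  have [t /andP[t0 t1] E] := hit 0 ltac:(by rewrite mulr0).
  have it : inI t by rewrite /inI t1 ltW.
  by have := isg t 0 it i0; rewrite E sg0 => /(_ erefl) E2; move: t0; rewrite E2 ltxx.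
have inJ x : (exists2 t, inI t & g t = x) -> x = p \/ exists2 s, e * sg 1 <= e * s & x = w s.
  move=> [t /andP[t0 t1] <-]; have [->|tn] := eqVneq t 0; first by left.
  have ht : 0 < t <= 1 by rewrite t1 andbT lt_neqAle eq_sym tn.
  by right; exists (sg t); [exact: lo|exact: sgE'].
have outJ s : e * sg 1 <= e * s -> exists2 t, inI t & g t = w s.
  move=> /hit[t /andP[t0 t1] E]; have it : inI t by rewrite /inI t1 ltW.
  by exists t => //; rewrite sgE// E.
have finvp : finv p = p by rewrite -w0 finvw mul0r.
have q1 : 1 < la^-1 by rewrite invf_gt1.
split.
- move=> x /inJ[->|[s hs ->]]; first by exists 0 => //; rewrite finvp.
  rewrite finvw; apply: outJ; apply: (le_trans hs).
  have : 0 < e * s by apply: lt_le_trans hs.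
  by rewrite mulrA; nra.
- have E1 : f (g 1) = w (la * sg 1) by rewrite sgE// fw.
  rewrite E1 => /inJ[|[s hs /iw E]].
    rewrite -w0 => /iw /eqP; rewrite mulf_eq0 gt_eqF//= => /eqP E.
    by move: spos; rewrite E mulr0 ltxx.
  by move: hs; rewrite -E mulrCA leNgt gtr_pMl// la1.
- move=> x /inJ[->|[s hs ->]].
    have -> : (fun k => iter k finv p) = (fun=> p).
      by apply/funext => k; elim: k => [//|k IH]; rewrite iterS IH.
    exact: cvg_cst.
  have -> : (fun k => iter k finv (w s)) = (fun k => w (s / la ^+ k)).
    by apply/funext => k; exact: iter_finv_line.
  by rewrite -g0; apply: conv; apply: lt_le_trans hs.
Qed.

End InvariantLine.

(** * Linearization of planar saddles *)

Section Clamp.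
Variable R : realType.

Lemma eq_ler (x y : R) : x = y -> x <= y.
Proof. by move=> ->. Qed.

Implicit Types d x y : R.

Definition clamp d x : R := Num.max (- d) (Num.min d x).

Lemma clamp_norm d x : 0 <= d -> `|clamp d x| <= d.
Proof.
move=> d0; rewrite /clamp ler_norml le_max lexx /= ge_max; apply/andP; split; first lra.
by rewrite ge_min lexx.
Qed.

Lemma clamp_id d x : `|x| <= d -> clamp d x = x.
Proof.
rewrite ler_norml => /andP[h1 h2]; rewrite /clamp (min_idPr h2); exact/max_idPr.
Qed.

Lemma clamp_mono d x y : 0 <= d -> x <= y -> 0 <= clamp d y - clamp d x <= y - x.
Proof.
move=> d0 xy.
have clampE t : clamp d t = if t < - d then - d else if d < t then d else t.
  rewrite /clamp; case: (ltP t (- d)) => h1.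
    by rewrite min_r ?max_l//; lra.
  by case: (ltP d t) => h2; rewrite max_r//; lra.
rewrite !clampE; do 4?[case: ltP => ?]; apply/andP; split; lra.
Qed.

Lemma clamp_lip d x y : 0 <= d -> `|clamp d x - clamp d y| <= `|x - y|.
Proof.
move=> d0; have [xy|/ltW yx] := leP x y.
  rewrite (distrC x) (distrC (clamp d x)).
  have /andP[h1 h2] := clamp_mono d0 xy; rewrite !ger0_norm//; lra.
by have /andP[h1 h2] := clamp_mono d0 yx; rewrite !ger0_norm//; lra.
Qed.

Lemma continuous_clamp d : continuous (clamp d).
Proof.
apply: contin_setT; apply: contin_max; first exact: contin_cst.
by apply: contin_min; [exact: contin_cst|exact: contin_id].
Qed.

End Clamp.

Section Linearize.
Variable R : realType.
Notation plane := (R * R)%type.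

Definition box (d : R) : set plane := [set z | `|z.1| <= d /\ `|z.2| <= d].
Definition nm (z : plane) : R := Num.max `|z.1| `|z.2|.

(** [h] is strictly differentiable at 0 with derivative diag(mu, la). *)
Definition strict_diag (h : plane -> plane) (mu la : R) := forall e, 0 < e ->
  exists2 d, 0 < d & forall z w, box d z -> box d w ->
    `|(h z).1 - (h w).1 - mu * (z.1 - w.1)| <= e * nm (z - w) /\
    `|(h z).2 - (h w).2 - la * (z.2 - w.2)| <= e * nm (z - w).

Lemma box_nbhs d : 0 < d -> nbhs (0 : plane) (box d).
Proof.
move=> d0; apply/near_diskP; exists d => // v /(abs_le_sq (ltW d0)).
by [].
Qed.

Lemma nbhs_box (U : set plane) : nbhs (0 : plane) U -> exists2 d, 0 < d & box d `<=` U.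
Proof.
move=> /near_diskP[r r0 H]; exists (r / 2); first by rewrite divr_gt0.
move=> v [h1 h2]; apply: H; rewrite /disk /sq /=.
by move: h1 h2; rewrite !ler_norml => /andP[a1 a2] /andP[b1 b2]; nra.
Qed.

(** Continuity of the inverse is invariance of domain. *)
Lemma plane_homeo (f : plane -> plane) : continuous f -> injective f ->
  (forall y, exists x, f x = y) ->
  exists g : plane -> plane, [/\ continuous g, cancel f g & cancel g f].
Proof.
move=> cf inj surj; have [g fg] := choice surj.
have gf : cancel f g by move=> x; apply: inj; rewrite fg.
exists g; split=> // y U gU; rewrite /= nbhs_simpl /=.
have := @invariance_of_domain R (interior U) f (g y) _ _ _.
rewrite fg => H; apply: filterS (H _ _ _) => [_ [x Ux <-]|||].
- by rewrite /= gf; exact: interior_subset.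
- by apply: open_nbhs_nbhs; split=> //; exact: open_interior.
- exact: contin_continuous.
- by move=> a b _ _ /inj.
Qed.

Lemma lipschitz_continuous (f : plane -> R) (k : R) :
  (forall z w, `|f z - f w| <= k * nm (z - w)) -> continuous f.
Proof.
move=> H z; apply/(@cvgrPdist_le _ R^o) => e e0.
have k0 : 0 < `|k| + 1 by rewrite ltr_wpDl.
have := box_nbhs (divr_gt0 e0 k0); rewrite -(subrr z).
move=> /(@nbhs_diskP R)[r r0 rH]; apply/nbhs_diskP; exists r => // v dv /=.
have [/=] := rH v dv; rewrite !subrr !add0r => h1 h2.
apply: le_trans (H _ _) _; apply: (@le_trans _ _ ((`|k| + 1) * nm (z - (z + v)))).
  by rewrite ler_wpM2r// ?le_max ?normr_ge0// (le_trans (ler_norm k))// lerDl.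
rewrite mulrC -ler_pdivlMr// /nm ge_max /= !opprD !addrA !subrr !add0r !normrN.
by rewrite h1 h2.
Qed.

(** [X] is the first coordinate renormalized along [H]. The horizontal cone is invariant and [H]
    stretches it by at least [|mu| - e > 1]; two points of one level of [X] in a common cone would
    separate exponentially in the first coordinate, from which [X] differs by a bounded amount. *)
Lemma unstable_coordinate (H : plane -> plane) (mu la e B : R) :
  (forall z w, `|(H z).1 - (H w).1 - mu * (z.1 - w.1)| <= e * nm (z - w)) ->
  (forall z w, `|(H z).2 - (H w).2 - la * (z.2 - w.2)| <= e * nm (z - w)) ->
  0 <= B -> (forall z, `|(H z).1 - mu * z.1| <= B) ->
  continuous H -> 1 < `|mu| - e -> `|la| + e < 1 -> 0 < e ->
  exists X : plane -> R, [/\ continuous X, (forall z, X (H z) = mu * X z),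
    (exists C, forall z, `|X z - z.1| <= C) &
    forall z w, `|z.2 - w.2| <= `|z.1 - w.1| -> X z = X w -> z = w].
Proof.
move=> H1 H2 B0 HB cH q1 ka1 e0.
have mu1 : 1 < `|mu| by lra.
have cfst : continuous (fst : plane -> R).
  by apply: contin_setT; apply: contin_fst; exact: contin_id.
have [X [cX XH [C1 XC]]] := renormalize cH cfst mu1 B0 HB.
exists X; split=> //; first by exists C1.
set q := `|mu| - e in q1; set ka := `|la| + e in ka1.
have cone z w : `|z.2 - w.2| <= `|z.1 - w.1| ->
    q * `|z.1 - w.1| <= `|(H z).1 - (H w).1| /\ `|(H z).2 - (H w).2| <= `|(H z).1 - (H w).1|.
  move=> zw; have nE : nm (z - w) = `|z.1 - w.1| by rewrite /nm /=; apply/max_idPl.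
  have E1 : q * `|z.1 - w.1| <= `|(H z).1 - (H w).1|.
    have := H1 z w; rewrite nE; set A := (H z).1 - _; set t := z.1 - w.1.
    have : `|mu * t| <= `|A - mu * t| + `|A|.
      by rewrite distrC -{1}(subrK A (mu * t)); exact: ler_normD.
    by rewrite normrM /q; clear; lra.
  split=> //; have := H2 z w; rewrite nE.
  set A := (H z).2 - _; set t := z.1 - w.1 in E1 nE zw *; set s := z.2 - w.2 in zw * => n1.
  have n2 : `|A| <= `|A - la * s| + `|la * s| by rewrite -{1}(subrK (la * s) A); exact: ler_normD.
  rewrite normrM in n2; have n3 := ler_wpM2l (normr_ge0 la) zw.
  have n4 : ka * `|t| <= q * `|t| by rewrite ler_wpM2r// ltW// (lt_trans ka1).
  move: n1 n2 n3 n4 E1; rewrite /ka; clear; lra.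
move=> z w zw Xzw.
suff E : z.1 - w.1 = 0.
  move: zw; rewrite E normr0 normr_le0 subr_eq0 => /eqP; move/eqP: E.
  by rewrite subr_eq0 => /eqP; exact: pairE.
apply: (@pow_bounded_eq0 _ q (2 * C1)) => // n.
have [g1 g2] : q ^+ n * `|z.1 - w.1| <= `|(iter n H z).1 - (iter n H w).1| /\
   `|(iter n H z).2 - (iter n H w).2| <= `|(iter n H z).1 - (iter n H w).1|.
  elim: n => [|n [g1 g2]]; first by rewrite expr0 mul1r.
  have [k1 k2] := cone _ _ g2; rewrite !iterS; split=> //; apply: le_trans k1.
  by rewrite exprS -mulrA ler_wpM2l// ltW// (lt_trans ltr01).
have XE v : X (iter n H v) = mu ^+ n * X v.
  elim: n {g1 g2} => [|n IH]; first by rewrite expr0 mul1r.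
  by rewrite iterS XH IH exprS mulrA.
apply: (le_trans g1); have := XC (iter n H z); have := XC (iter n H w).
rewrite !XE Xzw; clear.
set A := _ * X w; set a := (iter n H z).1; set b := (iter n H w).1.
by rewrite !ler_norml => /andP[? ?] /andP[? ?]; apply/andP; split; lra.
Qed.

(** In the coordinates [(c, y)], with [c] the unstable one, the map is [(mu c, G (c, y))]: it
    contracts the fibres by [ka] and preserves or reverses their order according to [s]. Only
    topological conjugacy is sought, so the rate in the fibres may be taken to be [s * ka]. *)
Lemma stable_coordinate (G : plane -> R) (a B s ka mu : R) : 0 < a -> 0 < ka -> ka < 1 ->
  `|s| = 1 -> 1 < `|mu| -> continuous G ->
  (forall c y y', `|G (c, y) - G (c, y')| <= ka * `|y - y'|) ->
  (forall c y y', `|c| <= a -> `|y| <= a -> `|y'| <= a -> y < y' -> s * G (c, y) < s * G (c, y')) ->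
  (forall c y, `|y| <= a -> `|G (c, y)| <= B) ->
  exists Y : plane -> R, [/\ continuous Y, (forall c y y', Y (c, y) = Y (c, y') -> y = y') &
    forall c y, `|c| <= a -> `|y| <= a -> Y (mu * c, G (c, y)) = s * ka * Y (c, y)].
Proof.
move=> a0 ka0 ka1 s1 mu1 cG Flip Fmono FB.
have age : 0 <= a by exact: ltW.
have ss : s * s = 1.
  by rewrite -expr2 -real_normK ?num_real// s1 expr1n.
(* Outside the box the fibre maps are continued with slope [s * ka], which makes [Hh] a
   homeomorphism of the whole plane with the same fibrewise bounds. *)
pose Fh c y := G (clamp a c, clamp a y) + s * (ka * (y - clamp a y)).
have Fhlip c y y' : `|Fh c y - Fh c y'| <= ka * `|y - y'|.
  wlog yy : y y' / y <= y'.
    move=> W; have [|/ltW] := leP y y'; first exact: W.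
    by rewrite distrC (distrC y); exact: W.
  have /andP[m1 m2] := clamp_mono age yy.
  have := Flip (clamp a c) (clamp a y) (clamp a y').
  rewrite (distrC (clamp a y)) (ger0_norm m1) (distrC y) (ger0_norm (_ : 0 <= y' - y)) ?subr_ge0// => E.
  have -> : Fh c y - Fh c y' = (G (clamp a c, clamp a y) - G (clamp a c, clamp a y')) -
     s * (ka * ((y' - y) - (clamp a y' - clamp a y))) by rewrite /Fh; ring.
  have e3 : 0 <= (y' - y) - (clamp a y' - clamp a y) by rewrite subr_ge0.
  apply: le_trans (ler_normB _ _) _.
  rewrite [X in _ + X]normrM s1 mul1r normrM (gtr0_norm ka0) (ger0_norm e3).
  by move: E; clear; lra.
have Fhmono c y y' : y < y' -> s * Fh c y < s * Fh c y'.
  move=> yy; have /andP[m1 m2] := clamp_mono age (ltW yy).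
  have e1 t : s * Fh c t = s * G (clamp a c, clamp a t) + ka * (t - clamp a t).
    by rewrite /Fh mulrDr mulrA ss mul1r.
  rewrite !e1; have [E|ne] := eqVneq (clamp a y) (clamp a y').
    by rewrite -E ltrD2l ltr_pM2l// ltrD2r.
  have lt : clamp a y < clamp a y' by rewrite lt_neqAle ne -subr_ge0.
  have := Fmono (clamp a c) _ _ (clamp_norm c age) (clamp_norm y age) (clamp_norm y' age) lt.
  have : ka * (y - clamp a y) <= ka * (y' - clamp a y').
    by rewrite ler_wpM2l// ?(ltW ka0)//; move: m2; clear; lra.
  by clear; lra.
pose Hh (z : plane) : plane := (mu * z.1, Fh z.1 z.2).
have mu0 : mu != 0 by rewrite -normr_gt0; apply: lt_trans mu1.
have cfst : continuous (fst : plane -> R).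
  by apply: contin_setT; apply: contin_fst; exact: contin_id.
have csnd : continuous (snd : plane -> R).
  by apply: contin_setT; apply: contin_snd; exact: contin_id.
have cHh : continuous Hh.
  have ca1 : contin setT (fun z : plane => clamp a z.1).
    by apply: continc; [exact: contin_continuous|exact: continuous_clamp].
  have ca2 : contin setT (fun z : plane => clamp a z.2).
    by apply: continc; [exact: contin_continuous|exact: continuous_clamp].
  apply: contin_setT; apply: contin_pair.
    by apply: continM; [exact: contin_cst|exact: contin_continuous].
  apply: continD.
    apply: (contin_comp (B := setT) _ (contin_continuous cG)) => //.
    exact: contin_pair.
  apply: continM; first exact: contin_cst.
  apply: continM; first exact: contin_cst.
  by apply: continB => //; exact: contin_continuous.
have iHh : injective Hh.
  move=> z w [/(mulfI mu0) E1 E2]; apply: pairE => //; rewrite E1 in E2.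
  by have [lt|lt|//] := ltgtP z.2 w.2; have := Fhmono w.1 _ _ lt; rewrite E2 ltxx.
pose C2 := B + ka * a.
have FhC c y : `|Fh c y - s * ka * y| <= C2.
  have -> : Fh c y - s * ka * y = G (clamp a c, clamp a y) - s * (ka * clamp a y).
    by rewrite /Fh; ring.
  apply: le_trans (ler_normB _ _) _; rewrite [X in _ + X]normrM s1 mul1r normrM (gtr0_norm ka0).
  by rewrite lerD ?FB ?clamp_norm// ler_wpM2l ?clamp_norm// ltW.
have C20 : 0 <= C2 by apply: le_trans (FhC 0 0); exact: normr_ge0.
have cFh c : contin setT (Fh c).
  apply: (contin_snd (f := fun y => Hh (c, y))).
  apply: (contin_comp (B := setT) _ (contin_continuous cHh)) => //.
  by apply: contin_pair; [exact: contin_cst|exact: contin_id].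
have kan0 : ka != 0 by rewrite gt_eqF.
have sFh c v : exists y, Fh c y = v.
  have kaC : 0 <= C2 / ka by rewrite divr_ge0// ltW.
  have bnd y : `|s * Fh c y - ka * y| <= C2.
    rewrite (_ : _ - _ = s * (Fh c y - s * ka * y)); first by rewrite normrM s1 mul1r.
    by rewrite mulrBr !mulrA ss mul1r.
  have le12 : s * v / ka - C2 / ka <= s * v / ka + C2 / ka by move: kaC; clear; lra.
  have cI : contin (seg (s * v / ka - C2 / ka) (s * v / ka + C2 / ka)) (fun y => s * Fh c y).
    by apply: continM; [exact: contin_cst|apply: contin_sub (cFh c)].
  have [y _ yE] : exists2 y, seg (s * v / ka - C2 / ka) (s * v / ka + C2 / ka) y & s * Fh c y = s * v.
    apply: (ivt_seg le12 cI).
    have := bnd (s * v / ka - C2 / ka); have := bnd (s * v / ka + C2 / ka).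
    have -> : ka * (s * v / ka - C2 / ka) = s * v - C2 by field.
    have -> : ka * (s * v / ka + C2 / ka) = s * v + C2 by field.
    rewrite !ler_norml => /andP[a1 a2] /andP[b1 b2]; rewrite ge_min le_max.
    by apply/andP; split; apply/orP; [left; move: b2|right; move: a1]; clear; lra.
  by exists y; rewrite -[LHS]mul1r -[RHS]mul1r -ss -!mulrA yE.
have sHh z : exists x, Hh x = z.
  have [y yE] := sFh (z.1 / mu) z.2.
  exists (z.1 / mu, y); rewrite /Hh /= yE mulrC divfK//.
  by rewrite -surjective_pairing.
have [K [cK HK KH]] := plane_homeo cHh iHh sHh.
have sn0 : s != 0 by rewrite -normr_eq0 s1 oner_eq0.
(* [renormalize] wants an expanding factor, so it is applied to the inverse [K] of [Hh]. *)
pose nu := (s * ka)^-1.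
have nuka : `|nu| = ka^-1 by rewrite normfV normrM s1 mul1r gtr0_norm.
have nu1 : 1 < `|nu| by rewrite nuka invf_gt1.
have Ck0 : 0 <= C2 / ka by rewrite divr_ge0// ltW.
have KC z : `|(K z).2 - nu * z.2| <= C2 / ka.
  rewrite -{2}(KH z); set w := K z.
  rewrite (_ : _ - _ = - (nu * (Fh w.1 w.2 - s * ka * w.2))).
    by rewrite normrN normrM nuka mulrC ler_wpM2r ?invr_ge0// ltW.
  by rewrite mulrBr mulrA mulVf ?mulf_neq0// mul1r opprB.
have [Y [cY YK [C3 YC]]] := renormalize cK csnd nu1 Ck0 KC.
have YH z : Y (Hh z) = s * ka * Y z.
  by rewrite -{2}(HK z) YK mulrA mulfV ?mulf_neq0// mul1r.
have Kfib z w : z.1 = w.1 -> (K z).1 = (K w).1 /\ `|z.2 - w.2| <= ka * `|(K z).2 - (K w).2|.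
  move=> zw; have E : (K z).1 = (K w).1.
    apply: (mulfI mu0); have Ez := KH z; have Ew := KH w.
    by move: zw; rewrite -{1}Ez -{1}Ew.
  split=> //; have Ez := KH z; have Ew := KH w.
  by rewrite -{1}Ez -{1}Ew /= E; exact: Fhlip.
exists Y; split=> //.
  move=> c y y' E; suff : y - y' = 0 by move/eqP; rewrite subr_eq0 => /eqP.
  apply: (@pow_bounded_eq0 _ ka^-1 (2 * C3)); first by rewrite invf_gt1.
  move=> n; pose z := iter n K (c, y); pose w := iter n K (c, y').
  have [_ g] : z.1 = w.1 /\ ka^-1 ^+ n * `|y - y'| <= `|z.2 - w.2|.
    rewrite /z /w; elim: n {z w} => [|n [g1 g2]]; first by rewrite expr0 mul1r.
    have [k1 k2] := Kfib _ _ g1; rewrite !iterS; split=> //.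
    by rewrite exprS -mulrA ler_pdivrMl// (le_trans g2).
  have YE v : Y (iter n K v) = nu ^+ n * Y v.
    elim: n {z w g} => [|n IH]; first by rewrite expr0 mul1r.
    by rewrite iterS YK IH exprS mulrA.
  apply: (le_trans g); have := YC z; have := YC w.
  rewrite !YE E; clear; set A := _ * Y _; rewrite !ler_norml => /andP[? ?] /andP[? ?].
  by apply/andP; split; lra.
move=> c y ca ya; rewrite -YH /Hh /=; congr (Y (_, _)).
by rewrite /Fh !clamp_id// subrr !mulr0 addr0.
Qed.

(** An injective continuous function on a fibre is monotone; its direction is the sign of
    [G (c, a) - G (c, - a)], which never vanishes and so does not depend on [c]. *)
Lemma fiber_sign (G : plane -> R) (a : R) : 0 < a -> continuous G ->
  (forall c y y', `|c| <= a -> `|y| <= a -> `|y'| <= a -> G (c, y) = G (c, y') -> y = y') ->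
  exists2 s, `|s| = 1 &
  forall c y y', `|c| <= a -> `|y| <= a -> `|y'| <= a -> y < y' -> s * G (c, y) < s * G (c, y').
Proof.
move=> a0 cG Ginj.
pose s : R := if 0 < G (0, a) - G (0, - a) then 1 else -1.
have s1 : `|s| = 1 by rewrite /s; case: ifP; rewrite ?normrN normr1.
have ss : s * s = 1 by rewrite /s; case: ifP => _; ring.
exists s => //.
have aa : `|a| <= a by rewrite gtr0_norm.
have aNa : `|- a| <= a by rewrite normrN gtr0_norm.
have aia : - a < a by move: a0; clear; lra.
have Gne c : `|c| <= a -> G (c, a) - G (c, - a) != 0.
  move=> ca; rewrite subr_eq0; apply/eqP => /(Ginj _ _ _ ca aa aNa) E.
  by move: aia; rewrite {2}E ltxx.
have IE x : seg (- a) a x = (`|x| <= a) :> Prop by rewrite /seg /= -ler_norml.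
have cGp (k : R -> R) : contin (seg (- a) a) k ->
    contin (seg (- a) a) (fun c => G (c, k c)) /\ forall c, contin (seg (- a) a) (fun y => s * G (c, k y)).
  move=> ck; split=> [|c]; last (apply: continM; first exact: contin_cst).
    apply: (contin_comp (B := setT) _ (contin_continuous cG)) => //.
    by apply: contin_pair => //; exact: contin_id.
  apply: (contin_comp (B := setT) _ (contin_continuous cG)) => //.
  by apply: contin_pair => //; exact: contin_cst.
have Gsgn c : `|c| <= a -> 0 < s * (G (c, a) - G (c, - a)).
  move=> ca.
  have cD : contin (seg (- a) a) (fun c => s * (G (c, a) - G (c, - a))).
    apply: continM; first exact: contin_cst.
    by apply: continB; apply: (cGp (fun=> _) _).1; exact: contin_cst.
  have c0 : seg (- a) a 0 by rewrite IE normr0 ltW.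
  apply: (sign_const (@connected_seg _ _ _) cD _ c0); last first.
  - rewrite /s; case: ifPn; first by rewrite mul1r.
    rewrite -leNgt mulN1r oppr_gt0 => Dle.
    by rewrite lt_neqAle Dle andbT Gne// normr0 ltW.
  - by rewrite IE.
  - move=> x; rewrite IE => xa; rewrite mulf_neq0 ?Gne//.
    by rewrite -normr_eq0 s1 oner_eq0.
move=> c y y' ca ya ya' yy.
have Ia : forall x, (x \in `[- a, a]) = (`|x| <= a) by move=> x; rewrite in_itv /= -ler_norml.
have cI : {within [set` `[- a, a]], continuous (fun y => s * G (c, y))}.
  by apply/continP; rewrite -segE; exact: (cGp id (@contin_id _ _)).2.
have iI : {in `[- a, a] &, injective (fun y => s * G (c, y))}.
  move=> x x'; rewrite !Ia => xa xa' E; apply: (Ginj c) => //.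
  by rewrite -[LHS]mul1r -[RHS]mul1r -ss -!mulrA E.
have SG := Gsgn c ca; rewrite mulrBr subr_gt0 in SG.
have i1 : - a \in `[- a, a] by rewrite Ia.
have i2 : a \in `[- a, a] by rewrite Ia.
have [M|M] := itv_continuous_inj_mono cI iI; first by apply: M => //; rewrite Ia.
by have := M _ _ i2 i1 aia; move=> /(lt_trans SG); rewrite ltxx.
Qed.

(** Strict differentiability makes [h], cut off outside a small box, a global Lipschitz perturbation
    of its linear part. The level sets of the unstable coordinate [X] give an invariant vertical
    foliation, and [stable_coordinate] linearizes the action on its leaves. Thus [mu] survives and
    [la] is replaced by [s * ka]. *)
Lemma linearize (h : plane -> plane) (mu la d0 : R) : h 0 = 0 -> strict_diag h mu la ->
  0 < d0 -> {in box d0 &, injective h} -> 1 < `|mu| -> `|la| < 1 ->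
  exists (Psi : plane -> plane) (la' : R), [/\ 0 < `|la'| < 1, continuous Psi, injective Psi, Psi 0 = 0 &
    exists2 r, 0 < r & forall z, box r z -> Psi (h z) = (mu * (Psi z).1, la' * (Psi z).2)].
Proof.
move=> h0 sd d00 ih mu1 la1.
(* Half of each spectral gap, so that [|mu| - e > 1] and [|la| + e < 1]. *)
pose e := Num.min ((`|mu| - 1) / 2) ((1 - `|la|) / 2).
have e0 : 0 < e by rewrite lt_min; apply/andP; split; lra.
have em : e <= (`|mu| - 1) / 2 by rewrite ge_min lexx.
have el : e <= (1 - `|la|) / 2 by rewrite ge_min lexx orbT.
have [d1 d10 sdE] := sd e e0.
pose d := Num.min d0 d1.
have dp : 0 < d by rewrite lt_min d00.
have dge : 0 <= d by exact: ltW.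
have dd0 z : box d z -> box d0 z.
  by move=> [a b]; split; [apply: le_trans a _|apply: le_trans b _]; rewrite ge_min lexx.
have dd1 z : box d z -> box d1 z.
  by move=> [a b]; split; [apply: le_trans a _|apply: le_trans b _]; rewrite ge_min lexx orbT.
pose cl (z : plane) : plane := (clamp d z.1, clamp d z.2).
have clB z : box d (cl z) by split; exact: clamp_norm.
have clid z : box d z -> cl z = z.
  by move=> [a b]; apply: pairE => /=; exact: clamp_id.
have nm_ge1 (z : plane) : `|z.1| <= nm z by rewrite le_max lexx.
have nm_ge2 (z : plane) : `|z.2| <= nm z by rewrite le_max lexx orbT.
have nmcl z w : nm (cl z - cl w) <= nm (z - w).
  rewrite {1}/nm ge_max /=; apply/andP; split.
    exact: le_trans (clamp_lip _ _ dge) (nm_ge1 (z - w)).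
  exact: le_trans (clamp_lip _ _ dge) (nm_ge2 (z - w)).
pose eta1 z := (h z).1 - mu * z.1.
pose eta2 z := (h z).2 - la * z.2.
pose H z : plane := (mu * z.1 + eta1 (cl z), la * z.2 + eta2 (cl z)).
have Hh z : box d z -> H z = h z.
  by move=> bz; rewrite /H /eta1 /eta2 (clid z bz) !(addrC (_ * _)) !subrK -surjective_pairing.
have L1 z w : `|eta1 (cl z) - eta1 (cl w)| <= e * nm (z - w).
  apply: (@le_trans _ _ (e * nm (cl z - cl w))); last by rewrite ler_wpM2l// ltW.
  have [E _] := sdE _ _ (dd1 _ (clB z)) (dd1 _ (clB w)); apply: le_trans E.
  by rewrite /eta1; apply: eq_ler; congr `|_|; ring.
have L2 z w : `|eta2 (cl z) - eta2 (cl w)| <= e * nm (z - w).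
  apply: (@le_trans _ _ (e * nm (cl z - cl w))); last by rewrite ler_wpM2l// ltW.
  have [_ E] := sdE _ _ (dd1 _ (clB z)) (dd1 _ (clB w)); apply: le_trans E.
  by rewrite /eta2; apply: eq_ler; congr `|_|; ring.
have cl0 : cl 0 = 0 by apply: clid; split; rewrite /= normr0.
have nmb z : box d z -> nm z <= d by move=> [a b]; rewrite ge_max a b.
have B1 z : `|eta1 (cl z)| <= e * d.
  have clcl : cl (cl z) = cl z by rewrite clid.
  have := L1 (cl z) 0; rewrite clcl cl0 {2}/eta1 h0 /= mulr0 !subr0 => E.
  by apply: le_trans E _; rewrite ler_wpM2l ?nmb// ltW.
have B2 z : `|eta2 (cl z)| <= e * d.
  have clcl : cl (cl z) = cl z by rewrite clid.
  have := L2 (cl z) 0; rewrite clcl cl0 {2}/eta2 h0 /= mulr0 !subr0 => E.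
  by apply: le_trans E _; rewrite ler_wpM2l ?nmb// ltW.
have H1 z w : `|(H z).1 - (H w).1 - mu * (z.1 - w.1)| <= e * nm (z - w).
  by apply: le_trans (L1 z w); apply: eq_ler; congr `|_|; rewrite /H /=; ring.
have H2 z w : `|(H z).2 - (H w).2 - la * (z.2 - w.2)| <= e * nm (z - w).
  by apply: le_trans (L2 z w); apply: eq_ler; congr `|_|; rewrite /H /=; ring.
have cH : continuous H.
  have cc1 : continuous (fun z => (H z).1).
    apply: (@lipschitz_continuous _ (`|mu| + e)) => z w.
    have := H1 z w; have := nm_ge1 (z - w); set A := (H z).1 - _; set B := mu * _ => n1 n2.
    have : `|A| <= `|A - B| + `|B| by rewrite -{1}(subrK B A); exact: ler_normD.
    by rewrite /B normrM mulrDl; have := ler_wpM2l (normr_ge0 mu) n1; rewrite /=; lra.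
  have cc2 : continuous (fun z => (H z).2).
    apply: (@lipschitz_continuous _ (`|la| + e)) => z w.
    have := H2 z w; have := nm_ge2 (z - w); set A := (H z).2 - _; set B := la * _ => n1 n2.
    have : `|A| <= `|A - B| + `|B| by rewrite -{1}(subrK B A); exact: ler_normD.
    by rewrite /B normrM mulrDl; have := ler_wpM2l (normr_ge0 la) n1; rewrite /=; lra.
  by apply: contin_setT; apply: contin_pair; exact: contin_continuous.
have ed0 : 0 <= e * d by rewrite mulr_ge0// ltW.
pose ka := `|la| + e.
have q1 : 1 < `|mu| - e by move: em mu1; clear; lra.
have ka0 : 0 < ka by rewrite ltr_wpDl.
have ka1 : ka < 1 by rewrite /ka; move: el la1; clear; lra.
have HB z : `|(H z).1 - mu * z.1| <= e * d by rewrite /H /= addrAC subrr add0r.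
have [X [cX XH [C1 XC] Xcone]] := unstable_coordinate H1 H2 ed0 HB cH q1 ka1 e0.
have csnd : continuous (snd : plane -> R).
  by apply: contin_setT; apply: contin_snd; exact: contin_id.
(* [Th] straightens the levels of [X]; it is injective because two points at equal height lie in a
   common horizontal cone. *)
pose Th (z : plane) : plane := (X z, z.2).
have cTh : continuous Th.
  by apply: contin_setT; apply: contin_pair; exact: contin_continuous.
have iTh : injective Th.
  by move=> z w [Xzw zw]; apply: Xcone => //; rewrite zw subrr normr0.
have sTh y : exists x, Th x = y.
  have C10 : 0 <= C1 by apply: le_trans (XC 0); exact: normr_ge0.
  have [x _ xE] : exists2 x, x \in `[y.1 - C1, y.1 + C1] & X (x, y.2) = y.1.
    apply: IVT; first by move: C10; clear; lra.
      apply/continP; apply: (contin_comp (B := setT) _ (contin_continuous cX)) => //.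
      by apply: contin_pair; [exact: contin_id|exact: contin_cst].
    have := XC (y.1 - C1, y.2); have := XC (y.1 + C1, y.2); rewrite /= !ler_norml.
    move=> /andP[a1 a2] /andP[b1 b2]; rewrite ge_min le_max.
    by apply/andP; split; apply/orP; [left; move: b2|right; move: a1]; clear; lra.
  by exists (x, y.2); rewrite /Th /= xE -surjective_pairing.
have [Ti [cTi ThK TiK]] := plane_homeo cTh iTh sTh.
have X0 : X 0 = 0.
  have := XH 0; have -> : H 0 = 0 by rewrite Hh ?h0//; split; rewrite /= normr0.
  move=> /eqP; rewrite -{1}(mul1r (X 0)) -subr_eq0 -mulrBl mulf_eq0 => /orP[|/eqP//].
  by rewrite subr_eq0 => /eqP E; move: mu1; rewrite -E normr1 ltxx.
have Ti0 : Ti 0 = 0 by rewrite -[RHS]ThK /Th X0.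
have [a a0 aE] : exists2 a, 0 < a & box a `<=` Ti @^-1` (box d).
  by apply: nbhs_box; have := @cTi 0 (box d); rewrite Ti0; apply; exact: box_nbhs.
have fiber z w : X z = X w -> `|(H z).2 - (H w).2| <= ka * `|z.2 - w.2|.
  move=> Xzw; have zw : `|z.1 - w.1| <= `|z.2 - w.2|.
    have [zw|/ltW//] := leP `|z.2 - w.2| `|z.1 - w.1|.
    by rewrite (Xcone _ _ zw Xzw) !subrr.
  have nE : nm (z - w) = `|z.2 - w.2| by rewrite /nm /=; apply/max_idPr.
  have := H2 z w; rewrite nE; set A := (H z).2 - _; set t := z.2 - w.2.
  have : `|A| <= `|A - la * t| + `|la * t| by rewrite -{1}(subrK (la * t) A); exact: ler_normD.
  by rewrite normrM /ka; lra.
pose G (z : plane) := (H (Ti z)).2.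
have TiX c y : X (Ti (c, y)) = c by have [] := TiK (c, y).
have Ti2 c y : (Ti (c, y)).2 = y by have [] := TiK (c, y).
have Glip c y y' : `|G (c, y) - G (c, y')| <= ka * `|y - y'|.
  by have := @fiber (Ti (c, y)) (Ti (c, y')); rewrite !TiX !Ti2 => /(_ erefl).
have Ginj c y y' : `|c| <= a -> `|y| <= a -> `|y'| <= a -> G (c, y) = G (c, y') -> y = y'.
  move=> ca ya ya' E; have b1 := aE (c, y) (conj ca ya); have b2 := aE (c, y') (conj ca ya').
  have : Th (H (Ti (c, y))) = Th (H (Ti (c, y'))) by rewrite /Th !XH !TiX; congr (_, _).
  move=> /iTh; rewrite !Hh// => /ih; rewrite !inE => /(_ (dd0 _ b1) (dd0 _ b2)) E2.
  by rewrite -(Ti2 c y) E2 Ti2.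
have cG : continuous G.
  apply: contin_setT; apply: contin_snd.
  apply: (contin_comp (B := setT) _ (contin_continuous cH)) => //.
  exact: contin_continuous.
have GB c y : `|y| <= a -> `|G (c, y)| <= a + e * d.
  move=> ya; rewrite /G /H /=; apply: le_trans (ler_normD _ _) _; rewrite lerD//.
  rewrite normrM Ti2 -[leRHS]mul1r ler_pM//; exact: ltW.
have [s s1 Gmono] := fiber_sign a0 cG Ginj.
have [Y [cY Yinj YG]] := stable_coordinate a0 ka0 ka1 s1 mu1 cG Glip Gmono GB.
exists (fun z => (X z, Y (X z, z.2))), (s * ka); split.
- by rewrite normrM s1 mul1r gtr0_norm// ka0.
- apply: contin_setT; apply: contin_pair; first exact: contin_continuous.
  apply: (contin_comp (B := setT) _ (contin_continuous cY)) => //.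
  by apply: contin_pair; exact: contin_continuous.
- move=> z w [E1]; rewrite E1 => /Yinj E2; apply: iTh.
  by rewrite /Th E1 E2.
- rewrite X0 /=; congr (_, _).
  have z0 : `|0 : R| <= a by rewrite normr0 ltW.
  have := YG 0 0 z0 z0; have -> : G (0, 0) = 0.
    by rewrite /G Ti0 Hh ?h0//; split; rewrite /= normr0.
  rewrite mulr0 => /eqP; rewrite -{1}(mul1r (Y _)) -subr_eq0 -mulrBl mulf_eq0 => /orP[|/eqP//].
  rewrite subr_eq0 => /eqP E; have : `|s * ka| = 1 by rewrite -E normr1.
  by rewrite normrM s1 mul1r gtr0_norm// => E2; move: ka1; rewrite E2 ltxx.
have : nbhs (0 : plane) (Th @^-1` box a).
  by have := @cTh 0 (box a); rewrite /Th X0; apply; exact: box_nbhs.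
move=> /nbhs_box[r r0 rH]; exists r => // z /rH [/= xa ya].
have bz : box d z by rewrite -(ThK z); apply: aE; split.
rewrite -(Hh z bz) XH; congr (_, _); rewrite /= -YG//; congr (Y (_, _)).
by rewrite /G (_ : (X z, z.2) = Th z)// ThK.
Qed.

End Linearize.

(** * Saddles on surfaces *)

Section Topology.
Variable R : realType.
Notation plane := (R * R)%type.

Lemma star_connected (N : set plane) z0 : N z0 ->
  (forall z t, N z -> 0 <= t <= 1 -> N (z0 + sc t (z - z0))) -> connected N.
Proof.
move=> Nz0 H.
pose C z : set plane := (fun t => z0 + sc t (z - z0)) @` seg 0 1.
have -> : N = \bigcup_(z in N) C z.
  apply/seteqP; split=> z.
    move=> Nz; exists z => //; exists 1; first by rewrite /seg /= ler01 lexx.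
    by rewrite sc_id addrC subrK.
  by move=> [y Ny [t ht <-]]; exact: H.
apply: bigcup_connected.
  exists z0 => z Nz; exists 0; first by rewrite /seg /= ler01 lexx.
  by rewrite /sc !mul0r addr0.
move=> z Nz; apply: connected_continuous_connected; first exact: connected_seg.
apply/continP; apply: contin_addp; first exact: contin_cst.
by apply: contin_sc; [exact: contin_id|exact: contin_cst].
Qed.

Lemma box_le (d d' : R) : d <= d' -> box d `<=` (box d' : set plane).
Proof. by move=> dd z [h1 h2]; split; [exact: le_trans h1 dd|exact: le_trans h2 dd]. Qed.

Lemma box0 (d : R) : 0 <= d -> box d (0 : plane).
Proof. by move=> d0; split; rewrite /= normr0. Qed.

Lemma nbhs_translate (z : plane) (U : set plane) :
  nbhs z U <-> exists2 e, 0 < e & forall v, box e v -> U (z + v).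
Proof.
split.
  move=> /nbhs_diskP[r r0 H].
  have := nbhs_box (U := [set v | U (z + v)]) _ => /(_ _)[|e e0 eU].
    by apply/near_diskP; exists r.
  by exists e.
move=> [e e0 H]; apply/nbhs_diskP; exists e => // v /(abs_le_sq (ltW e0)) hv; exact: H.
Qed.

Lemma compact_boxset (d : R) : compact (box d : set plane).
Proof.
rewrite (_ : box d = seg (- d) d `*` seg (- d) d).
  by apply: compact_setX; exact: compact_seg.
by apply/seteqP; split=> z [h1 h2]; split; move: h1 h2; rewrite /seg /= -?ler_norml.
Qed.

Variable T : topologicalType.
Implicit Types (c : chart R T) (x y q : T).

Lemma chart_inj c x y : is_chart c -> ch_dom c x -> ch_dom c y ->
  ch_map c x = ch_map c y -> x = y.
Proof.
move=> [_ [H _]] dx dy E; have [_ <-] := H x dx; have [_ <-] := H y dy.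
by rewrite E.
Qed.

Lemma chart_contin c : is_chart c -> contin (ch_dom c) (ch_map c).
Proof. by move=> [_ [_ [_ [h _]]]]; apply/continP. Qed.

Lemma chart_inv_contin c : is_chart c -> contin (ch_img c) (ch_inv c).
Proof. by move=> [_ [_ [_ [_ [h _]]]]]; apply/continP. Qed.

(** Invariance of domain read in a chart. It applies even if the chart at [k z] is one of boundary
    type, since the image of [k] there is open in the plane. *)
Lemma open_param (N : set plane) (k : plane -> T) z : surface R T -> contin N k ->
  {in N &, injective k} -> nbhs z N -> nbhs (k z) (k @` N).
Proof.
move=> [_ charts] ck ik Nz.
have [c [cc dc]] := charts (k z); have [od _] := cc.
pose U := interior N `&` k @^-1` ch_dom c.
have nU : nbhs z U.
  apply: filterI; first by apply: open_nbhs_nbhs; split; [exact: open_interior|exact: Nz].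
  apply: (@contin_open _ _ (interior N)) => //; first by apply: contin_sub ck; exact: interior_subset.
    exact: open_interior.
  exact: open_nbhs_nbhs.
have UN : U `<=` N by move=> v [/interior_subset].
have cU : contin U (fun v => ch_map c (k v)).
  apply: (contin_comp _ (chart_contin cc)) => [|v []//].
  exact: contin_sub ck.
have iU : {in U &, injective (fun v => ch_map c (k v))}.
  move=> u v; rewrite !inE => hu hv /(chart_inj cc hu.2 hv.2).
  by apply: ik; rewrite inE; exact: UN.
have := invariance_of_domain nU cU iU => H.
have := contin_open (chart_contin cc) od dc H.
have := open_nbhs_nbhs (conj od dc); apply: filter_app2; near=> t => dt [v hv E].
by exists v; [exact: UN|apply: (chart_inj cc hv.2 dt)].
Unshelve. all: by end_near. Qed.

Lemma cell_open (e : plane -> T) : surface R T -> contin (disk 1) e ->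
  {in disk 1 &, injective e} -> open (e @` odisk 1).
Proof.
move=> sT ce ie; rewrite openE => _ [v ov <-].
have sub : odisk 1 `<=` (disk 1 : set plane) by move=> u; exact: ltW.
apply: (open_param sT).
- exact: contin_sub ce.
- by move=> a b; rewrite !inE => /sub da /sub db; apply: ie; rewrite inE.
- exact: open_nbhs_nbhs (conj (@open_odisk R 1) ov).
Qed.

(** Pulled back to the disk by the inverse of [e], the map [k] would cover a neighbourhood of a
    point [u] of the unit circle, including points [(1 + r / 2) u] outside the disk. *)
Lemma cell_boundary_not_interior (e k : plane -> T) (N : set plane) z : hausdorff_space T ->
  contin (disk 1) e -> {in disk 1 &, injective e} -> nbhs z N -> contin N k ->
  {in N &, injective k} -> (forall v, N v -> (e @` disk 1) (k v)) -> ~ (e @` circle 1) (k z).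
Proof.
move=> hT ce ie Nz ck ik kD.
have D0 : (disk 1 : set plane) !=set0 by exists 0; rewrite /disk /sq /= expr0n /= addr0 sqr_ge0.
have [psi [cpsi eK psiK]] := contin_inverse hT (compact_disk ler01) ce ie D0.
have H := @invariance_of_domain R N (fun v => psi (k v)) z Nz (contin_comp ck cpsi kD) _.
have {}H : nbhs (psi (k z)) ((fun v => psi (k v)) @` N).
  apply: H => a b; rewrite !inE => Na Nb E; apply: ik; rewrite ?inE//.
  by rewrite -(psiK _ (kD _ Na)).2 -(psiK _ (kD _ Nb)).2 E.
move=> [u cu ku].
have pu : psi (k z) = u by rewrite -ku eK//; exact: circle_disk.
move: H; rewrite pu => /nbhs_diskP[r r0 H].
have dr : disk r (sc (r / 2) u).
  rewrite /disk /= sq_sc cu expr1n mulr1; nra.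
have [v Nv E] := H _ dr; have [] := psiK _ (kD _ Nv); rewrite E.
have -> : u + sc (r / 2) u = sc (1 + r / 2) u by apply: pairE => /=; ring.
rewrite /disk /= sq_sc cu expr1n mulr1 => h _.
have : 1 < (1 + r / 2) ^+ 2 by move: r0; clear; nra.
by rewrite ltNge h.
Qed.

(** [io] parametrizes a neighbourhood of the fixed point [p] on which [f] is
    (x, y) |-> (mu x, la y). *)
Record lin_saddle (f : T -> T) p (io : plane -> T) (a mu la : R) : Prop := LinSaddle {
  ls_a : 0 < a; ls_mu : 1 < mu; ls_la0 : 0 < la; ls_la1 : la < 1;
  ls_p : io 0 = p;
  ls_c : contin (box (mu * a)) io;
  ls_i : {in box (mu * a) &, injective io};
  ls_f : forall z, box a z -> f (io z) = io (mu * z.1, la * z.2) }.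

Lemma ls_inj f p io a mu la z z' : lin_saddle f p io a mu la -> box (mu * a) z ->
  box (mu * a) z' -> io z = io z' -> z = z'.
Proof. by move=> L bz bz'; apply: (ls_i L); rewrite inE. Qed.

Lemma direct_saddle_lin f p : direct_saddle R f p -> exists io a mu la, lin_saddle f p io a mu la.
Proof.
move=> [fp [_ [mu [la [mu1 la0 la1 [c [W [cc [dc [cp [oW [W0 [WI WE]]]]]]]]]]]]].
have [b b0 bW] := nbhs_box (open_nbhs_nbhs (conj oW W0)).
have mu0 : 0 < mu by lra.
have E : mu * (b / mu) = b by rewrite mulrC divfK// gt_eqF.
have [_ [H1 [H2 _]]] := cc.
(* Radius [b / mu]: the image of the small box must still lie in [box b], where the chart is
   linear. *)
exists (ch_inv c), (b / mu), mu, la; split=> //; rewrite ?E //.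
- by rewrite divr_gt0.
- by have [_ <-] := H1 p dc; rewrite cp.
- by apply: contin_sub (chart_inv_contin cc) => z /bW /WI.
- move=> z z'; rewrite !inE => /bW /WI hz /bW /WI hz' E'.
  by have [_ <-] := H2 z hz; have [_ <-] := H2 z' hz'; rewrite E'.
- move=> z bz; have /bW Wz : box b z.
    by apply: box_le bz; rewrite ler_pdivrMr//; nra.
  by have [d1 <-] := WE z Wz; have [_ ->] := H1 _ d1.
Qed.

Lemma lin_saddle_shrink f p io a mu la a' : 0 < a' -> a' <= a ->
  lin_saddle f p io a mu la -> lin_saddle f p io a' mu la.
Proof.
move=> a'0 aa [a0 mu1 la0 la1 ip ic ii iF].
have sub : box (mu * a') `<=` (box (mu * a) : set plane) by apply: box_le; nra.
split=> //.
- exact: contin_sub ic.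
- by move=> x y; rewrite !inE => /sub hx /sub hy; apply: ii; rewrite inE.
- by move=> z bz; apply: iF; exact: box_le bz.
Qed.

(** Exchanging the coordinates exchanges the expanding and contracting directions. The radius is
    [la * a] because its multiple by the new expanding factor [la^-1] must be [a]. *)
Lemma lin_saddle_dual f finv p io a mu la : cancel f finv -> lin_saddle f p io a mu la ->
  lin_saddle finv p (fun z => io (z.2, z.1)) (la * a) la^-1 mu^-1.
Proof.
move=> fK [a0 mu1 la0 la1 ip ic ii iF].
have mu0 : 0 < mu by lra.
have E : la^-1 * (la * a) = a by rewrite mulKf// gt_eqF.
have sub : box a `<=` (box (mu * a) : set plane) by apply: box_le; nra.
split=> //; rewrite ?E.
- by rewrite mulr_gt0.
- by rewrite invf_gt1.
- by rewrite invr_gt0.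
- by rewrite invf_lt1.
- apply: (contin_comp _ ic) => [|z [h1 h2]]; last by apply: sub; split.
  by apply: contin_pair; [apply: contin_snd|apply: contin_fst]; exact: contin_id.
- move=> [x1 x2] [y1 y2]; rewrite !inE => -[/= h1 h2] [/= k1 k2] /ii.
  have bx : box (mu * a) ((x2, x1) : plane) by apply: sub.
  have by_ : box (mu * a) ((y2, y1) : plane) by apply: sub.
  by rewrite !inE => /(_ bx by_) [-> ->].
- move=> z [h1 h2] /=; rewrite -[RHS]fK iF /=.
    by congr (finv (io (_, _))); rewrite mulrA mulfV ?mul1r// gt_eqF.
  split; rewrite /= normrM gtr0_norm ?invr_gt0// mulrC ler_pdivrMr//; nra.
Qed.

(** Serves to place the two arcs of the loop on the positive half axes. *)
Lemma lin_saddle_reflect f p io a mu la (s t : R) : `|s| = 1 -> `|t| = 1 ->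
  lin_saddle f p io a mu la -> lin_saddle f p (fun z => io (s * z.1, t * z.2)) a mu la.
Proof.
move=> s1 t1 [a0 mu1 la0 la1 ip ic ii iF].
have bE d (z : plane) : box d z -> box d (s * z.1, t * z.2).
  by move=> [h1 h2]; split; rewrite /= normrM ?s1 ?t1 mul1r.
have s0 : s != 0 by rewrite -normr_eq0 s1 oner_eq0.
have t0 : t != 0 by rewrite -normr_eq0 t1 oner_eq0.
split=> //.
- by rewrite /= !mulr0.
- apply: (contin_comp _ ic) => [|z /bE//].
  by apply: contin_pair; apply: continM; try exact: contin_cst;
    [apply: contin_fst|apply: contin_snd]; exact: contin_id.
- move=> x y; rewrite !inE => /bE hx /bE hy /ii; rewrite !inE => /(_ hx hy) [E1 E2].
  by apply: pairE; [exact: (mulfI s0)|exact: (mulfI t0)].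
- by move=> z bz; rewrite iF; [rewrite /= !(mulrCA mu) !(mulrCA la)|exact: bE].
Qed.

(** The vertical axis is prolonged by [finv]: [w s] is the [k]-th preimage of the axis point
    [la^k s], for any [k] large enough to bring it into the chart. A point attracted to [p]
    eventually stays in the box, which forces its expanding coordinate to vanish; hence the line
    contains the whole stable set. *)
Lemma stable_line f finv p io a mu la : surface R T -> continuous finv ->
  cancel f finv -> cancel finv f -> lin_saddle f p io a mu la ->
  exists w : R -> T, [/\ continuous w, injective w,
    forall s, `|s| <= a -> w s = io (0, s),
    forall s, f (w s) = w (la * s) /\ finv (w s) = w (s / la) &
    forall x, (fun k => iter k f x) @ \oo --> p -> exists s, x = w s].
Proof.
move=> sT cfinv fK finvK L; have [a0 mu1 la0 la1 ip ic ii iF] := L.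
have lapow n : 0 < la ^+ n by rewrite exprn_gt0.
have b0 s : `|s| <= a -> box a ((0, s) : plane).
  by move=> h; split; rewrite /= ?normr0// ltW.
have step s : `|s| <= a -> f (io (0, s)) = io (0, la * s).
  by move=> h; rewrite iF ?mulr0//; exact: b0.
have shr s : `|s| <= a -> `|la * s| <= a.
  by rewrite normrM gtr0_norm// => h; have := normr_ge0 s; nra.
have Kex (s : R) : exists k : nat, la ^+ k * `|s| <= a.
  have e0 : 0 < a / (`|s| + 1) by rewrite divr_gt0// ltr_wpDl.
  have [n nE] := pow_small (ltW la0) la1 e0; exists n.
  rewrite ltr_pdivlMr ?ltr_wpDl// in nE; have := lapow n; nra.
have [kk kkE] := choice Kex.
pose w s := iter (kk s) finv (io (0, la ^+ kk s * s)).
have wE m n s : la ^+ m * `|s| <= a ->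
    iter (n + m) finv (io (0, la ^+ (n + m) * s)) = iter m finv (io (0, la ^+ m * s)).
  move=> h; elim: n => [|n IH]; first by rewrite add0n.
  rewrite -IH addSn iterSr; congr iter; rewrite -[RHS]fK step ?exprS ?mulrA//.
  rewrite normrM (gtr0_norm (lapow _)) exprD -mulrA.
  apply: (le_trans _ h); rewrite ler_piMl ?mulr_ge0 ?(ltW (lapow _))//.
  by rewrite exprn_ile1 ?(ltW la0) ?(ltW la1).
(* The value does not depend on the admissible exponent; the other claims choose one exponent for
   all points involved. *)
have wK : forall k t, la ^+ k * `|t| <= a -> w t = iter k finv (io (0, la ^+ k * t)).
  move=> k t h; have [lek|/ltnW lek] := leqP k (kk t).
    by have := @wE k (kk t - k)%N t h; rewrite subnK.
  by have := @wE (kk t) (k - kk t)%N t (kkE t); rewrite subnK.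
have comm k y : f (iter k finv y) = iter k finv (f y).
  elim: k => [//|k IH]; rewrite iterS finvK iterS -IH fK//.
have iterfK k : cancel (iter k f) (iter k finv).
  by move=> y; elim: k => [//|k IH]; rewrite iterSr iterS fK.
have iterfinvK k : cancel (iter k finv) (iter k f).
  by move=> y; elim: k => [//|k IH]; rewrite iterSr iterS finvK.
have fw s : f (w s) = w (la * s).
  have [k kE] := Kex s.
  have kE' : `|la ^+ k * s| <= a by rewrite normrM gtr0_norm.
  have kE2 : la ^+ k * `|la * s| <= a.
    rewrite normrM (gtr0_norm la0) mulrCA; apply: le_trans kE.
    by rewrite ler_piMl ?mulr_ge0 ?(ltW (lapow _))// ltW.
  by rewrite (wK k s kE) (wK k _ kE2) comm step// mulrCA.
have finvw s : finv (w s) = w (s / la).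
  by rewrite -[RHS]fK fw mulrC divfK// gt_eqF.
have w0 s : `|s| <= a -> w s = io (0, s).
  by move=> h; rewrite (wK 0%N) ?expr0 ?mul1r.
have finvwn n s : iter n finv (w s) = w (s / la ^+ n).
  elim: n => [|n IH]; first by rewrite expr0 divr1.
  by rewrite iterS IH finvw exprSr invfM mulrA.
have boxsub : box a `<=` (box (mu * a) : set plane) by apply: box_le; nra.
exists w; split=> //.
- apply: contin_setT; apply: contin_local => s _.
  exists [set t | `|t| < `|s| + 1].
    have : `|s| < `|s| + 1 by rewrite ltrDl.
    move=> h; have := @contin_gt R _ setT (fun t : R => - `|t|) s (- (`|s| + 1)).
    have ck : contin setT (fun t : R => - `|t|).
      by apply: continN; apply: contin_norm; exact: contin_id.
    move=> /(_ ck I); rewrite ltrN2 => /(_ h); apply: filterS => t /(_ I).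
    by rewrite /= ltrN2.
  have [k kE] := Kex (`|s| + 1).
  have tk t : `|t| < `|s| + 1 -> la ^+ k * `|t| <= a.
    move=> ht; apply: le_trans kE; rewrite ler_wpM2l ?(ltW (lapow _))//.
    by rewrite ger0_norm ?addr_ge0// ltW.
  apply: (contin_eq (f := fun t => iter k finv (io (0, la ^+ k * t)))).
    by move=> t; rewrite inE => -[_ /tk /wK ->].
  apply: (contin_comp (B := setT)) => //; last first.
    apply: contin_continuous; elim: k {kE tk} => [|k IH]; first by move=> ?; exact: cvg_id.
    by move=> y; apply: (@continuous_comp _ _ _ (iter k finv) finv); [exact: IH|exact: cfinv].
  apply: (contin_comp _ ic) => [|t [_ /tk h]].
    apply: contin_pair; first exact: contin_cst.
    by apply: continM; [exact: contin_cst|exact: contin_id].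
  by apply: boxsub; apply: b0; rewrite normrM gtr0_norm.
- move=> s t E; have [k kE] := Kex (`|s| + `|t|).
  have Es : la ^+ k * `|s| <= a.
    apply: le_trans kE; rewrite ler_wpM2l ?(ltW (lapow _))//.
    by rewrite (ger0_norm (addr_ge0 (normr_ge0 s) (normr_ge0 t))) lerDl normr_ge0.
  have Et : la ^+ k * `|t| <= a.
    apply: le_trans kE; rewrite ler_wpM2l ?(ltW (lapow _))//.
    by rewrite (ger0_norm (addr_ge0 (normr_ge0 s) (normr_ge0 t))) lerDr normr_ge0.
  move: E; rewrite (wK k s Es) (wK k t Et) => /(can_inj (iterfinvK k)) /(ls_inj L) h.
  have hs : box (mu * a) ((0, la ^+ k * s) : plane).
    by apply: boxsub; apply: b0; rewrite normrM gtr0_norm.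
  have ht : box (mu * a) ((0, la ^+ k * t) : plane).
    by apply: boxsub; apply: b0; rewrite normrM gtr0_norm.
  by have := h hs ht => -[] /(mulfI _); apply; rewrite gt_eqF.
- move=> x cx.
  have Np : nbhs p (io @` box a).
    rewrite -ip; apply: (open_param sT).
    - exact: contin_sub ic.
    - by move=> u v; rewrite !inE => /boxsub hu /boxsub hv; apply: ii; rewrite inE.
    - exact: box_nbhs.
  have [N _ HN] := cx _ Np.
  have [z bz zE] := HN N (leqnn N).
  have zk k : iter (k + N) f x = io (mu ^+ k * z.1, la ^+ k * z.2) /\ box a ((mu ^+ k * z.1, la ^+ k * z.2) : plane).
    elim: k => [|k [IH1 IH2]]; first by rewrite !expr0 !mul1r add0n -zE -surjective_pairing; split=> //; case: z {zE} bz.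
    have E : iter (k.+1 + N) f x = io (mu ^+ k.+1 * z.1, la ^+ k.+1 * z.2).
      by rewrite addSn iterS IH1 iF// !exprS !mulrA.
    split=> //; have [z' bz' zE'] := HN (k.+1 + N)%N (leq_addl _ _).
    rewrite (_ : (_, _) = z')//; apply: (ls_inj L); [|exact: boxsub|by rewrite zE' E].
    move: IH2 => [/= h1 h2]; split; rewrite /= exprS -mulrA normrM.
      by rewrite gtr0_norm ?ler_pM2l//; lra.
    by rewrite gtr0_norm//; have := normr_ge0 (la ^+ k * z.2); nra.
  have z10 : z.1 = 0.
    apply: (@pow_bounded_eq0 _ mu a) => // k; have [_ [/= h _]] := zk k.
    by rewrite normrM normrX gtr0_norm in h; last lra.
  exists (z.2 / la ^+ N); rewrite -finvwn w0; last by case: bz.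
  by rewrite -z10 -surjective_pairing zE iterfK.
Qed.

End Topology.

(** * Sides of the cell *)

Section Sides.
Variables (R : realType) (T : topologicalType).
Notation plane := (R * R)%type.

Definition is_cell (e : plane -> T) := contin (disk 1) e /\ {in disk 1 &, injective e}.
Definition cell_int (e : plane -> T) := e @` odisk 1.
Definition cell_bd (e : plane -> T) := e @` circle 1.

Lemma odisk_disk (r : R) : odisk r `<=` (disk r : set plane).
Proof. by move=> v; exact: ltW. Qed.

Lemma cell_disjoint e y : is_cell e -> cell_int e y -> cell_bd e y -> False.
Proof.
move=> [ce ie] [u ou <-] [v cv /ie]; rewrite !inE => /(_ (circle_disk cv) (odisk_disk ou)) E.
by move: ou; rewrite -E /odisk /= cv ltxx.
Qed.

Lemma cell_split e y : (e @` disk 1) y <-> cell_int e y \/ cell_bd e y.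
Proof.
split=> [[v dv <-]|[[v ov <-]|[v cv <-]]]; first last.
- by exists v => //; exact: circle_disk.
- by exists v => //; exact: odisk_disk.
have [h|h] := ltP (sq v) (1 ^+ 2); first by left; exists v.
by right; exists v => //; apply/eqP; rewrite eq_le; apply/andP; split.
Qed.

Lemma cell_closed e : hausdorff_space T -> is_cell e -> closed (e @` disk 1).
Proof.
move=> hT [ce ie]; by apply: compact_closed => //; apply: contin_image_compact ce (compact_disk ler01).
Qed.

Lemma boundary_adherent e y U : is_cell e -> cell_bd e y -> nbhs y U ->
  exists2 x, cell_int e x & U x.
Proof.
move=> [ce ie] [v cv <-] Uy.
have := ce _ (circle_disk cv) _ Uy; rewrite /= nbhs_simpl /within /= => /nbhs_diskP[r r0 H].
pose t := Num.min (1 / 2) (r / 2).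
have t0 : 0 < t by rewrite lt_min !divr_gt0.
have t1 : t <= 1 / 2 by rewrite ge_min lexx.
have t2 : t <= r / 2 by rewrite ge_min lexx orbT.
have E : v + sc (- t) v = sc (1 - t) v by apply: pairE => /=; ring.
have o : odisk 1 (sc (1 - t) v).
  rewrite /odisk /= sq_sc cv expr1n mulr1; move: t0 t1; clear; nra.
exists (e (sc (1 - t) v)); first by exists (sc (1 - t) v).
rewrite -E; apply: H; last by rewrite E; exact: odisk_disk.
rewrite /disk /= sq_sc cv expr1n mulr1 sqrrN; move: r0 t0 t2; clear; nra.
Qed.

(** Near a boundary point the complement of the boundary has two connected pieces, each inside or
    outside the cell as a whole. Both inside contradicts [cell_boundary_not_interior]; both outside
    contradicts that boundary points are limits of interior ones. *)
Lemma two_sides (e k : plane -> T) (eta : R) (N1 N2 : set plane) :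
  surface R T -> is_cell e -> 0 < eta ->
  contin (box eta) k -> {in box eta &, injective k} -> connected N1 -> connected N2 ->
  N1 `<=` box eta -> N2 `<=` box eta ->
  (forall z, box eta z -> [\/ N1 z, N2 z | cell_bd e (k z)]) ->
  (forall z, N1 z -> ~ cell_bd e (k z)) -> (forall z, N2 z -> ~ cell_bd e (k z)) -> cell_bd e (k 0) ->
  ((forall z, N1 z -> cell_int e (k z)) /\ (forall z, N2 z -> ~ cell_int e (k z))) \/
  ((forall z, N1 z -> ~ cell_int e (k z)) /\ (forall z, N2 z -> cell_int e (k z))).
Proof.
move=> sT cell_e eta0 ck ik cN1 cN2 s1 s2 cov n1 n2 Bk0.
have side N : connected N -> N `<=` box eta -> (forall z, N z -> ~ cell_bd e (k z)) ->
    (forall z, N z -> cell_int e (k z)) \/ (forall z, N z -> ~ cell_int e (k z)).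
  move=> cN sN nN.
  have loc z : N z -> \forall t \near z, N t -> (cell_int e (k t) <-> cell_int e (k z)).
    move=> Nz; have ckN : contin N k by apply: contin_sub ck.
    have [Vz|nVz] := pselect (cell_int e (k z)).
      have HH : nbhs z [set t | N t -> cell_int e (k t)] :=
        ckN z Nz _ (open_nbhs_nbhs (conj (cell_open sT cell_e.1 cell_e.2) Vz)).
      by apply: filterS HH => t H /H.
    have oD : nbhs (k z) (~` (e @` disk 1)).
      apply: open_nbhs_nbhs; split; first by apply: closed_openC; exact: (cell_closed sT.1 cell_e).
      by move=> /cell_split[//|/(nN _ Nz)].
    have HH : nbhs z [set t | N t -> (~` (e @` disk 1)) (k t)] := ckN z Nz _ oD.
    apply: filterS HH => t H /H nD.
    by split=> // Vt; case: nD; apply/cell_split; left.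
  have [[z [Nz Vz]]|nex] := pselect (exists z, N z /\ cell_int e (k z)).
    by left=> t Nt; exact: (locally_constant_connected cN loc Nz Nt Vz).
  by right=> z Nz Vz; apply: nex; exists z.
have b0 : box eta (0 : plane) by apply: box0; exact: ltW.
have nk : nbhs (k 0) (k @` box eta).
  by apply: (open_param sT ck ik); exact: box_nbhs.
have [h1|h1] := side _ cN1 s1 n1; have [h2|h2] := side _ cN2 s2 n2.
- have [] := cell_boundary_not_interior sT.1 cell_e.1 cell_e.2 (box_nbhs eta0) ck ik _ Bk0.
  move=> z /cov[/h1|/h2|] h; apply/cell_split; by [left|right].
- by left.
- by right.
have [x Vx [z bz zx]] := boundary_adherent cell_e Bk0 nk.
by case: (cov z bz) => [/h1|/h2|]; rewrite zx => // h; case: (cell_disjoint cell_e Vx h).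
Qed.

(** The cell [e] is bounded by an arc of the stable line [w] and a segment of the local unstable line
    of [p], which meet only in their end points. *)
Record arms (f : T -> T) (p : T) (io : plane -> T) (a mu la : R) (w : R -> T)
    (e : plane -> T) (s' x' : R) : Prop := Arms {
  ar_L : lin_saddle f p io a mu la;
  ar_cw : continuous w;
  ar_iw : injective w;
  ar_io : forall s, `|s| <= a -> w s = io (0, s);
  ar_e : is_cell e;
  ar_s : 0 < s';
  ar_x : 0 < x';
  ar_xa : x' <= a;
  ar_B : cell_bd e = (w @` seg 0 s') `|` ((fun x => io (x, 0)) @` seg 0 x');
  ar_meet : forall s x, seg 0 s' s -> seg 0 x' x -> w s = io (x, 0) -> x = 0 \/ x = x' }.

Lemma connected_half (eta s : R) : 0 < eta -> `|s| = 1 ->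
  connected [set z : plane | box eta z /\ 0 < s * z.2].
Proof.
move=> eta0 s1; have s2 : s * s = 1 by rewrite -expr2 -real_normK ?num_real// s1 expr1n.
apply: (@star_connected R _ (0, s * eta)).
  split; last by rewrite /= mulrA s2 mul1r.
  by split; rewrite /= ?normr0 ?normrM ?s1 ?mul1r ?gtr0_norm// ltW.
move=> z t [[h1 h2] h3] /andP[t0 t1]; split.
  split => /=.
    by rewrite subr0 add0r normrM ger0_norm//; move: h1 t1 (normr_ge0 z.1); clear; nra.
  rewrite (_ : _ + _ = (1 - t) * (s * eta) + t * z.2); last by ring.
  apply: le_trans (ler_normD _ _) _; have t1' : 0 <= 1 - t by rewrite subr_ge0.
  rewrite !normrM s1 mul1r (gtr0_norm eta0) (ger0_norm t0) (ger0_norm t1').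
  by move: h2 t0 t1; clear; nra.
rewrite /= (_ : s * _ = (1 - t) * (s * s) * eta + t * (s * z.2)); last by ring.
rewrite s2 mulr1; move: eta0 h3 t0 t1; clear.
set q := s * z.2; rewrite le_eqVlt => eta0 q0 /orP[/eqP <-|t0] t1; first by lra.
by apply: ltr_wpDl; [rewrite mulr_ge0//; lra|rewrite mulr_gt0].
Qed.

Lemma connected_quadrant (eta : R) : 0 < eta ->
  connected [set z : plane | box eta z /\ (0 < z.1 /\ 0 < z.2)].
Proof.
move=> eta0; apply: (@star_connected R _ (eta, eta)).
  by split=> //; split; rewrite /= gtr0_norm.
move=> z t [[h1 h2] [h3 h4]] /andP[t0 t1].
rewrite /= (gtr0_norm h3) in h1; rewrite /= (gtr0_norm h4) in h2.
have E x : eta + t * (x - eta) = (1 - t) * eta + t * x by ring.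
have P (x : R) : 0 < x -> 0 < (1 - t) * eta + t * x.
  move=> x0; have [->|tn] := eqVneq t 0; first by rewrite subr0 mul1r mul0r addr0.
  apply: ltr_wpDl; first by rewrite mulr_ge0// ?subr_ge0// ltW.
  by rewrite mulr_gt0// lt_neqAle eq_sym tn.
split; last by rewrite /= !E; split; exact: P.
split; rewrite /= E gtr0_norm ?P//.
  by move: h1 t0 t1 eta0; clear; nra.
by move: h2 t0 t1 eta0; clear; nra.
Qed.

Lemma connected_coquadrant (eta : R) : 0 < eta ->
  connected [set z : plane | box eta z /\ ~ (0 <= z.1 /\ 0 <= z.2)].
Proof.
move=> eta0; apply: (@star_connected R _ (- eta, - eta)).
  split; first by split; rewrite /= normrN gtr0_norm.
  by move=> [/= h _]; move: h; rewrite oppr_ge0 leNgt eta0.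
move=> z t [[h1 h2] h3] /andP[t0 t1].
have E x : - eta + t * (x - - eta) = (1 - t) * (- eta) + t * x by ring.
have P (x : R) : ~ 0 <= x -> ~ 0 <= (1 - t) * (- eta) + t * x.
  move=> x0; rewrite leNgt; have {}x0 : x < 0 by rewrite ltNge; apply/negP.
  apply/negP/negPn; have [->|tn] := eqVneq t 0.
    by rewrite subr0 mul1r mul0r addr0 oppr_lt0.
  have tp : 0 < t by rewrite lt_neqAle eq_sym tn.
  by move: tp x0 t1 eta0; clear; nra.
have t1' : 0 <= 1 - t by rewrite subr_ge0.
split.
  split; rewrite /= E (le_trans (ler_normD _ _))// !normrM normrN (gtr0_norm eta0) (ger0_norm t0) (ger0_norm t1').
    by move: h1 t0 t1; clear; nra.
  by move: h2 t0 t1; clear; nra.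
rewrite /= !E => -[k1 k2]; apply: h3; split.
  by apply: contrapT => /P.
by apply: contrapT => /P.
Qed.

(** The part of the stable arc outside the chart is compact and, as [w] is injective, misses [p];
    near [p] only the two half axes remain. *)
Lemma arms_near_p f p io a mu la w e s' x' : surface R T -> arms f p io a mu la w e s' x' ->
  exists2 d, 0 < d <= Num.min a x' & forall z, box d z ->
  (cell_bd e (io z) <-> (z.1 = 0 /\ 0 <= z.2) \/ (z.2 = 0 /\ 0 <= z.1)).
Proof.
move=> sT A; have [L cw iw w_io cell_e s'0 x'0 x'a eB meet] := A.
have a0 := ls_a L; have mu1 := ls_mu L.
have sub : box a `<=` (box (mu * a) : set plane) by apply: box_le; move: a0 mu1; clear; nra.
have hT := sT.1.
have cK : closed (w @` seg a s').
  apply: compact_closed => //; apply: contin_image_compact; last exact: compact_seg.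
  exact: contin_continuous.
have np : nbhs (io 0) (~` (w @` seg a s')).
  apply: open_nbhs_nbhs; split; first exact: closed_openC.
  rewrite (_ : io 0 = w 0); last by rewrite w_io ?normr0// ltW.
  by move=> [s /andP[h1 h2]] /iw E; move: h1; rewrite E leNgt a0.
have bm : nbhs (0 : plane) (box (mu * a)) by apply: box_nbhs; rewrite mulr_gt0// (lt_trans ltr01).
have : nbhs (0 : plane) (io @^-1` (~` (w @` seg a s'))).
  have := ls_c L (nbhs_singleton bm) np; rewrite /= nbhs_simpl /within /=.
  by move: bm; apply: filter_app2; near=> t => bt; apply.
move=> /nbhs_box[d d0 H].
exists (Num.min (Num.min d s') (Num.min a x')).
  by rewrite !lt_min d0 s'0 a0 x'0 /= ge_min lexx orbT.
move=> z bz.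
have bd : box d z by apply: box_le bz; rewrite !ge_min lexx.
have bs : box s' z by apply: box_le bz; rewrite !ge_min lexx !orbT.
have ba : box a z by apply: box_le bz; rewrite !ge_min lexx !orbT.
have bx : box x' z by apply: box_le bz; rewrite !ge_min lexx !orbT.
rewrite eB; split.
  move=> [[s /andP[h1 h2] E]|[x /andP[h1 h2] E]].
    have sa : s < a.
      by rewrite ltNge; apply/negP => h; apply: (H z bd); exists s => //; apply/andP.
    have ba' : box a ((0, s) : plane) by split; rewrite /= ?normr0 ?ger0_norm// ltW.
    left; have := ls_inj L (sub _ ba') (sub _ ba); rewrite -w_io ?ger0_norm ?(ltW sa)// => /(_ E) <-.
    by [].
  have ba' : box a ((x, 0) : plane).
    by split; rewrite /= ?normr0 ?(ltW a0)// ger0_norm// (le_trans h2).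
  by right; have := ls_inj L (sub _ ba') (sub _ ba) E => <-.
move=> [[z1 z2]|[z2 z1]].
  left; exists z.2; first by case: bs => _ h; rewrite /seg /= z2 -(ger0_norm z2).
  by rewrite w_io -?z1 -?surjective_pairing//; case: ba.
right; exists z.1; last by rewrite -z2 -surjective_pairing.
by case: bx => h _; rewrite /seg /= z1 -(ger0_norm z1).
Unshelve. all: by end_near. Qed.

Lemma arms_near_x f p io a mu la w e s' x' x : surface R T -> arms f p io a mu la w e s' x' -> 0 < x < x' ->
  exists2 d, 0 < d & [/\ d <= x, d <= x' - x,
  (forall z, box d z -> box (mu * a) ((x + z.1, z.2) : plane)) &
  forall z, box d z -> (cell_bd e (io (x + z.1, z.2)) <-> z.2 = 0)].
Proof.
move=> sT A; have [L cw iw w_io cell_e s'0 x'0 x'a eB meet] := A.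
have a0 := ls_a L; have mu1 := ls_mu L.
have sub : box a `<=` (box (mu * a) : set plane) by apply: box_le; move: a0 mu1; clear; nra.
have hT := sT.1.
move=> /andP[x0 xx].
have cK : closed (w @` seg 0 s').
  apply: compact_closed => //; apply: contin_image_compact; last exact: compact_seg.
  exact: contin_continuous.
have np : nbhs (io (x, 0)) (~` (w @` seg 0 s')).
  apply: open_nbhs_nbhs; split; first exact: closed_openC.
  move=> [s hs E]; have [] := meet _ _ hs _ E; first by rewrite /seg /= (ltW x0) (ltW xx).
    by move=> E2; move: x0; rewrite E2 ltxx.
  by move=> E2; move: xx; rewrite E2 ltxx.
pose d1 := Num.min x (Num.min (x' - x) ((mu - 1) * a)).
have d10 : 0 < d1.
  by rewrite !lt_min x0 subr_gt0 xx mulr_gt0// subr_gt0.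
have d1x : d1 <= x by rewrite ge_min lexx.
have d1x' : d1 <= x' - x by rewrite !ge_min lexx orbT.
have d1m : d1 <= (mu - 1) * a by rewrite !ge_min lexx !orbT.
have bm z : box d1 z -> box (mu * a) ((x + z.1, z.2) : plane).
  move=> [h1 h2]; split => /=.
    rewrite (le_trans (ler_normD _ _))// (gtr0_norm x0).
    by move: h1 d1x' x'a a0 mu1; clear; nra.
  by move: h2 d1m a0 mu1; clear; nra.
have ck : contin (box d1) (fun z : plane => io (x + z.1, z.2)).
  apply: (contin_comp _ (ls_c L)) => [|z /bm//].
  apply: contin_pair; last by apply: contin_snd; exact: contin_id.
  by apply: continD; [exact: contin_cst|apply: contin_fst; exact: contin_id].
have b1 : nbhs (0 : plane) (box d1) by exact: box_nbhs.
have : nbhs (0 : plane) ((fun z : plane => io (x + z.1, z.2)) @^-1` (~` (w @` seg 0 s'))).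
  have := ck 0 (nbhs_singleton b1); rewrite /= addr0 => /(_ _ np); rewrite /= nbhs_simpl /within /=.
  by move: b1; apply: filter_app2; near=> t => bt; apply.
move=> /nbhs_box[d d0 H]; exists (Num.min d d1); first by rewrite lt_min d0.
have s1 : Num.min d d1 <= d1 by rewrite ge_min lexx orbT.
have sd z : box (Num.min d d1) z -> box d z by apply: box_le; rewrite ge_min lexx.
have sd1 z : box (Num.min d d1) z -> box d1 z by exact: box_le.
split.
- exact: le_trans s1 d1x.
- exact: le_trans s1 d1x'.
- by move=> z /sd1 /bm.
move=> z bz; rewrite eB; split.
  move=> [h|[t /andP[h1 h2] E]]; first by case: (H z (sd z bz)).
  have bt : box (mu * a) ((t, 0) : plane).
    apply: sub; split; rewrite /= ?normr0 ?(ltW a0)// ger0_norm//; exact: le_trans h2 x'a.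
  by have := ls_inj L bt (bm _ (sd1 _ bz)) E => -[_ <-].
move=> z2; right; exists (x + z.1); last by rewrite z2.
case: (sd1 _ bz) => h1 _; move: h1; rewrite ler_norml => /andP[k1 k2].
by move: k1 k2 d1x d1x'; rewrite /seg /=; clear; move=> *; apply/andP; split; lra.
Unshelve. all: by end_near. Qed.

(** For [s] true the cell is the open quadrant near [p], for [s] false the complement of the closed
    one. The side of the unstable segment that it occupies is locally constant along the segment, so
    the situation at [p] determines it everywhere. *)
Lemma cell_sides f p io a mu la w e s' x' : surface R T -> arms f p io a mu la w e s' x' -> exists s : bool,
  (exists2 d, 0 < d <= Num.min a x' & forall z, box d z ->
     (cell_int e (io z) <-> if s then 0 < z.1 /\ 0 < z.2 else ~ (0 <= z.1 /\ 0 <= z.2))) /\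
  (forall x, 0 < x < x' -> exists2 d, 0 < d & forall z, box d z -> 
     [/\ box (mu * a) ((x + z.1, z.2) : plane), 0 <= x + z.1, x + z.1 <= x' &
     (cell_int e (io (x + z.1, z.2)) <-> if s then 0 < z.2 else z.2 < 0)]).
Proof.
move=> sT A; have [L cw iw w_io cell_e s'0 x'0 x'a eB meet] := A.
have a0 := ls_a L; have mu1 := ls_mu L.
have sub : box a `<=` (box (mu * a) : set plane) by apply: box_le; move: a0 mu1; clear; nra.
have [d /andP[d0 dm] dB] := arms_near_p sT A.
have da : d <= a by move: dm; rewrite le_min => /andP[].
have dx : d <= x' by move: dm; rewrite le_min => /andP[].
have bd : box d `<=` (box (mu * a) : set plane) by move=> z bz; apply: sub; exact: box_le bz.
have B0 : cell_bd e (io 0) by apply/dB; [apply: box0; exact: ltW|left; split=> /=].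
have iod : {in box d &, injective io}.
  by move=> u v; rewrite !inE => /bd hu /bd hv; exact: ls_inj L hu hv.
have P := @two_sides e io d _ _ sT cell_e d0 (contin_sub bd (ls_c L)) iod
  (connected_quadrant d0) (connected_coquadrant d0).
have {P} [s sE] : exists s : bool, forall z, box d z ->
     (cell_int e (io z) <-> if s then 0 < z.1 /\ 0 < z.2 else ~ (0 <= z.1 /\ 0 <= z.2)).
  have axis z : box d z -> ~ (0 < z.1 /\ 0 < z.2) -> 0 <= z.1 /\ 0 <= z.2 -> cell_bd e (io z).
    move=> bz n12 [z1 z2]; apply/(dB z bz).
    have [z1'|z1'] := eqVneq z.1 0; first by left.
    have [z2'|z2'] := eqVneq z.2 0; first by right.
    by case: n12; split; rewrite lt_neqAle eq_sym ?z1' ?z2'.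
  have [] := P.
  - by move=> z [].
  - by move=> z [].
  - move=> z bz; have [h|h] := pselect (0 < z.1 /\ 0 < z.2); first by apply: Or31.
    have [k|k] := pselect (0 <= z.1 /\ 0 <= z.2); last by apply: Or32.
    by apply: Or33; exact: axis.
  - by move=> z [bz [z1 z2]] /(dB z bz)[[E _]|[E _]]; [move: z1|move: z2]; rewrite E ltxx.
  - by move=> z [bz n12] /(dB z bz)[[E h]|[E h]]; apply: n12; rewrite E.
  - exact: B0.
  - move=> [h1 h2]; exists true => z bz; split; last by move=> h; apply: h1.
    move=> Vz; apply: contrapT => n12.
    have [k|k] := pselect (0 <= z.1 /\ 0 <= z.2); last by apply: (h2 z).
    by apply: (cell_disjoint cell_e Vz); exact: axis.
  - move=> [h1 h2]; exists false => z bz; split; last by move=> h; apply: h2.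
    move=> Vz k; have [k'|k'] := pselect (0 < z.1 /\ 0 < z.2); first by apply: (h1 z).
    by apply: (cell_disjoint cell_e Vz); exact: axis.
have alt x : 0 < x < x' -> exists2 eta, 0 < eta <= x & (forall z, box eta z ->
    [/\ box (mu * a) ((x + z.1, z.2) : plane), 0 <= x + z.1, x + z.1 <= x' & z.2 = 0 -> ~ cell_int e (io (x + z.1, z.2))]) /\
    (((forall z, box eta z -> 0 < z.2 -> cell_int e (io (x + z.1, z.2))) /\ (forall z, box eta z -> z.2 < 0 -> ~ cell_int e (io (x + z.1, z.2)))) \/
     ((forall z, box eta z -> 0 < z.2 -> ~ cell_int e (io (x + z.1, z.2))) /\ (forall z, box eta z -> z.2 < 0 -> cell_int e (io (x + z.1, z.2))))).
  move=> hx; have [eta eta0 [ex ex' em eB']] := arms_near_x sT A hx; exists eta; first by rewrite eta0.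
  split.
    move=> z bz; split; first exact: em.
    - by case: bz => h _; move: h; rewrite ler_norml => /andP[k1 k2]; move: ex k1; clear; lra.
    - by case: bz => h _; move: h; rewrite ler_norml => /andP[k1 k2]; move: ex' k2; clear; lra.
    - by move=> z2 Vz; apply: (cell_disjoint cell_e Vz); apply/(eB' z bz).
  have ck : contin (box eta) (fun z : plane => io (x + z.1, z.2)).
    apply: (contin_comp _ (ls_c L)) => [|z /em//].
    apply: contin_pair; last by apply: contin_snd; exact: contin_id.
    by apply: continD; [exact: contin_cst|apply: contin_fst; exact: contin_id].
  have ik : {in box eta &, injective (fun z : plane => io (x + z.1, z.2))}.
    move=> u v; rewrite !inE => hu hv /(ls_inj L (em _ hu) (em _ hv)) [/addrI E1 E2].
    exact: pairE.
  have n1 : `|1 : R| = 1 by rewrite normr1.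
  have n1' : `|-1 : R| = 1 by rewrite normrN normr1.
  have [] := @two_sides e _ eta _ _ sT cell_e eta0 ck ik (connected_half eta0 n1) (connected_half eta0 n1').
  - by move=> z [].
  - by move=> z [].
  - move=> z bz; have [z2|z2|z2] := ltgtP 0 z.2.
    + by apply: Or31; split=> //; rewrite mul1r.
    + by apply: Or32; split=> //; rewrite mulN1r oppr_gt0.
    + by apply: Or33; apply/(eB' z bz).
  - by move=> z [bz z2] /(eB' z bz) E; move: z2; rewrite E mulr0 ltxx.
  - by move=> z [bz z2] /(eB' z bz) E; move: z2; rewrite E mulr0 ltxx.
  - by apply/(eB' 0 (box0 (ltW eta0))).
  - move=> [h1 h2]; left; split=> z bz z2; first by apply: h1; rewrite /= mul1r.
    by apply: h2; rewrite /= mulN1r oppr_gt0.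
  - move=> [h1 h2]; right; split=> z bz z2; first by apply: h1; rewrite /= mul1r.
    by apply: h2; rewrite /= mulN1r oppr_gt0.
(* [S x] says that the cell is just above the unstable segment at [x]; it is compared with the
   sector at [p] at the point [d / 2]. *)
pose S x := exists2 eta, 0 < eta & forall z, box eta z -> 0 < z.2 -> cell_int e (io (x + z.1, z.2)).
pose I : set R := `]0, x'[%classic.
have IE x : I x = (0 < x < x') :> Prop by rewrite /I /= in_itv.
have cI : connected I by apply/connected_intervalP; exact: interval_is_interval.
have locS x : I x -> \forall t \near x, I t -> (S t <-> S x).
  rewrite IE => hx; have [eta /andP[eta0 etax] [_ AA]] := alt x hx.
  apply/nbhs_ballP; exists (eta / 2); first by rewrite /= divr_gt0.
  move=> t /= xt _.
  have tx : `|t - x| <= eta / 2 by rewrite distrC; exact: ltW.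
  have sh z : box (eta / 2) z -> box eta ((t - x + z.1, z.2) : plane).
    move=> [h1 h2]; split => /=; last by move: h2 eta0; clear; lra.
    by rewrite (le_trans (ler_normD _ _))//; move: h1 tx; clear; lra.
  have she z : x + (t - x + z.1) = t + z.1 by ring.
  have e2 : 0 < eta / 2 by rewrite divr_gt0.
  case: AA => [[h1 h2]|[h1 h2]].
    split=> _; first by exists eta.
    by exists (eta / 2) => // z /sh bz z2; have := h1 _ bz z2; rewrite /= she.
  split=> -[eta' eta'0 H].
    pose r := Num.min (eta / 2) eta'.
    have r0 : 0 < r by rewrite lt_min e2.
    have b1 : box (eta / 2) ((0, r) : plane).
      by split; rewrite /= ?normr0 ?(ltW e2)// gtr0_norm// ge_min lexx.
    have b2 : box eta' ((0, r) : plane).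
      by split; rewrite /= ?normr0 ?(ltW eta'0)// gtr0_norm// ge_min lexx orbT.
    by have := h1 _ (sh _ b1) r0; rewrite she => -[]; exact: H.
  pose r := Num.min eta eta'.
  have r0 : 0 < r by rewrite lt_min eta0.
  have b1 : box eta ((0, r) : plane).
    by split; rewrite /= ?normr0 ?(ltW eta0)// gtr0_norm// ge_min lexx.
  have b2 : box eta' ((0, r) : plane).
    by split; rewrite /= ?normr0 ?(ltW eta'0)// gtr0_norm// ge_min lexx orbT.
  by case: (h1 _ b1 r0); exact: H.
have d2 : 0 < d / 2 by rewrite divr_gt0.
have I2 : I (d / 2) by rewrite IE d2 /=; move: dx d0; clear; lra.
have bq z : box (d / 2) z -> box d ((d / 2 + z.1, z.2) : plane).
  move=> [h1 h2]; split => /=; last by move: h2 d0; clear; lra.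
  by rewrite (le_trans (ler_normD _ _))// (gtr0_norm d2); move: h1; clear; lra.
exists s; split; first by exists d => //; rewrite d0.
move=> x hx; have [eta /andP[eta0 etax] [bnd AA]] := alt x hx; exists eta => // z bz.
have [k1 k2 k3 k4] := bnd z bz; split=> //.
have Ix : I x by rewrite IE.
case: s sE => sE.
  have S2 : S (d / 2).
    exists (d / 4); first by rewrite divr_gt0.
    move=> t bt t2; have bt2 : box (d / 2) t by apply: box_le bt; move: d0; clear; lra.
    apply/(sE _ (bq _ bt2)); split=> //=; case: bt => h _; move: h.
    by rewrite ler_norml => /andP[h1 h2]; move: h1 d0; clear; lra.
  have [eta' eta'0 H] : S x := locally_constant_connected cI locS I2 Ix S2.
  case: AA => [[h1 h2]|[h1 _]].
    split=> [Vz|]; last exact: h1.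
    by have [z2|z2|z2] := ltgtP 0 z.2 => //; [case: (h2 z bz z2)|case: (k4 (esym z2))].
  pose r := Num.min eta eta'.
  have r0 : 0 < r by rewrite lt_min eta0.
  have b1 : box eta ((0, r) : plane).
    by split; rewrite /= ?normr0 ?(ltW eta0)// gtr0_norm// ge_min lexx.
  have b2 : box eta' ((0, r) : plane).
    by split; rewrite /= ?normr0 ?(ltW eta'0)// gtr0_norm// ge_min lexx orbT.
  by case: (h1 _ b1 r0); exact: H.
have nS2 : ~ S (d / 2).
  move=> [eta' eta'0 H].
  pose r := Num.min (d / 2) eta'.
  have r0 : 0 < r by rewrite lt_min d2.
  have b1 : box (d / 2) ((0, r) : plane).
    by split; rewrite /= ?normr0 ?(ltW d2)// gtr0_norm// ge_min lexx.
  have b2 : box eta' ((0, r) : plane).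
    by split; rewrite /= ?normr0 ?(ltW eta'0)// gtr0_norm// ge_min lexx orbT.
  have := (sE _ (bq _ b1)).1 (H _ b2 r0); apply; rewrite /= addr0.
  by split; exact: ltW.
case: AA => [[h1 h2]|[h1 h2]].
  case: nS2; apply: (locally_constant_connected cI locS Ix I2).
  by exists eta.
split=> [Vz|]; last exact: h2.
by have [z2|z2|z2] := ltgtP 0 z.2 => //; [case: (h1 z bz z2)|case: (k4 (esym z2))].
Qed.

End Sides.

(** * The return map of the cell *)

Section Return.
Variables (R : realType) (T : topologicalType).
Notation plane := (R * R)%type.
Implicit Types (f finv : T -> T) (e io : plane -> T) (w : R -> T) (a mu la : R).

(** [f] shortens the stable arm by [la] and lengthens the unstable one by [mu]; the bound on
    [mu * x1] keeps the latter in the chart. *)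
Lemma arms_image f finv p io a mu la w e s1 x1 : continuous f -> cancel f finv ->
  (forall s, f (w s) = w (la * s)) -> mu * x1 <= a ->
  arms f p io a mu la w e s1 x1 ->
  arms f p io a mu la w (fun z => f (e z)) (la * s1) (mu * x1).
Proof.
move=> cf fK fw mx A; have [L cw iw w_io [ce ie] s10 x10 x1a eB meet] := A.
have la0 := ls_la0 L; have mu0 : 0 < mu := lt_trans ltr01 (ls_mu L).
have fio x : seg 0 x1 x -> f (io (x, 0)) = io (mu * x, 0).
  move=> /andP[h1 h2]; rewrite (ls_f L) /= ?mulr0//; split; rewrite /= ?normr0 ?(ltW (ls_a L))//.
  by rewrite ger0_norm// (le_trans h2).
split=> //.
- split; first by apply: (contin_comp (B := setT) ce (contin_continuous cf)).
  by move=> u v hu hv /(can_inj fK); exact: ie.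
- by rewrite mulr_gt0.
- by rewrite mulr_gt0.
- have -> : cell_bd (fun z => f (e z)) = f @` cell_bd e by rewrite /cell_bd -image_comp.
  rewrite eB image_setU; congr (_ `|` _); apply/seteqP; split => y.
  + move=> [_ [s /andP[h1 h2] <-] <-]; exists (la * s); last by rewrite fw.
    by apply/andP; rewrite mulr_ge0 ?(ltW la0)// ler_pM2l.
  + move=> [s /andP[h1 h2] <-]; exists (w (s / la)); last by rewrite fw mulrC divfK// gt_eqF.
    exists (s / la) => //; apply/andP; rewrite divr_ge0 ?(ltW la0)//.
    by rewrite ler_pdivrMr// mulrC.
  + move=> [_ [x hx <-] <-]; exists (mu * x); last by rewrite fio.
    case/andP: hx => h1 h2; apply/andP; rewrite mulr_ge0 ?(ltW mu0)//.
    by rewrite ler_pM2l.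
  + move=> [x /andP[h1 h2] <-].
    have hx : seg 0 x1 (x / mu).
      by apply/andP; rewrite divr_ge0 ?(ltW mu0)// ler_pdivrMr// mulrC.
    by exists (io (x / mu, 0)); [exists (x / mu)|rewrite fio// mulrC divfK// gt_eqF].
- move=> s x /andP[h1 h2] /andP[h3 h4] E.
  have hs : seg 0 s1 (s / la).
    by apply/andP; rewrite divr_ge0 ?(ltW la0)// ler_pdivrMr// mulrC.
  have hx : seg 0 x1 (x / mu).
    by apply/andP; rewrite divr_ge0 ?(ltW mu0)// ler_pdivrMr// mulrC.
  have E' : w (s / la) = io (x / mu, 0).
    apply: (can_inj fK); rewrite fw fio//.
    by rewrite ![_ * (_ / _)]mulrC !divfK ?gt_eqF.
  have [k|k] := meet _ _ hs hx E'; [left|right].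
    by rewrite -(divfK (lt0r_neq0 mu0) x) k mul0r.
  by rewrite -(divfK (lt0r_neq0 mu0) x) k mulrC.
Qed.

(** Closed and open sector occupied at [p] by the closed cell and by its interior: one quadrant, or
    the other three. *)
Definition sector (s : bool) (z : plane) :=
  if s then 0 <= z.1 /\ 0 <= z.2 else z.1 <= 0 \/ z.2 <= 0.
Definition osector (s : bool) (z : plane) :=
  if s then 0 < z.1 /\ 0 < z.2 else ~ (0 <= z.1 /\ 0 <= z.2).

(** The linear map preserves the quadrant, so the cell and its image by [f] lie on the same side at
    [p], hence along the unstable arm. Near a point of the closed cell off the stable arc the image
    of the cell is therefore contained in the cell: exits occur across the stable arc only. *)
Lemma cell_sector f finv p io a mu la w e s1 x1 : surface R T -> continuous f ->
  cancel f finv -> cancel finv f ->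
  (forall s, f (w s) = w (la * s)) -> mu * x1 <= a -> w s1 = io (x1, 0) ->
  arms f p io a mu la w e s1 x1 ->
  exists s, (exists2 d, 0 < d <= a & forall z, box d z ->
     ((e @` disk 1) (io z) <-> sector s z) /\ (cell_int e (io z) <-> osector s z)) /\
  (forall y, (e @` disk 1) y -> ~ (w @` seg 0 s1) y ->
     nbhs y [set t | (e @` disk 1) (finv t) -> (e @` disk 1) t]).
Proof.
move=> sT cf fK finvK fw mx wx A; have A' := arms_image cf fK fw mx A.
have [L cw iw w_io [ce ie] s10 x10 x1a eB meet] := A.
have a0 := ls_a L; have mu1 := ls_mu L; have la0 := ls_la0 L; have la1 := ls_la1 L.
have mu0 : 0 < mu by exact: lt_trans ltr01 mu1.
have [s [[d /andP[d0 dm] dE] sideE]] := cell_sides sT A.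
have [s' [[d' /andP[d'0 dm'] dE'] sideE']] := cell_sides sT A'.
have [d1 /andP[d10 dm1] dB] := arms_near_p sT A.
(* A point [(t, t)] of the quadrant and its image [(mu t, la t)] decide the side for the cell and
   for its image simultaneously. *)
have ss' : s = s'.
  pose t := Num.min d (d' / mu).
  have t0 : 0 < t by rewrite lt_min d0 divr_gt0.
  have td : t <= d by rewrite ge_min lexx.
  have td' : mu * t <= d' by rewrite mulrC -ler_pdivlMr// ge_min lexx orbT.
  have bt : box d ((t, t) : plane) by split; rewrite /= gtr0_norm.
  have ba : box a ((t, t) : plane).
    by apply: box_le bt; move: dm; rewrite le_min => /andP[].
  have bt' : box d' ((mu * t, la * t) : plane).
    by split; rewrite /= gtr0_norm ?mulr_gt0//; move: td' t0 mu1 la1; clear; nra.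
  have E : cell_int (fun z => f (e z)) (io (mu * t, la * t)) <-> cell_int e (io (t, t)).
    rewrite -(ls_f L ba); split=> -[v ov]; first by move=> /(can_inj fK) <-; exists v.
    by move=> <-; exists v.
  have mt : 0 < mu * t by rewrite mulr_gt0.
  have lt : 0 < la * t by rewrite mulr_gt0.
  move: (dE _ bt) (dE' _ bt') => /=; case: (s); case: (s') => //= h1 h2.
    by case: (h2.1 (E.2 (h1.2 (conj t0 t0)))); split; exact: ltW.
  by case: (h1.1 (E.1 (h2.2 (conj mt lt)))); split; exact: ltW.
exists s; split.
  exists (Num.min d d1).
    by rewrite lt_min d0 d10 /= ge_min; move: dm; rewrite le_min => /andP[-> _].
  move=> z bz.
  have bd : box d z by apply: box_le bz; rewrite ge_min lexx.
  have bd1 : box d1 z by apply: box_le bz; rewrite ge_min lexx orbT.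
  split; last by have := dE z bd; rewrite /osector.
  have h1 := dE z bd; have h2 := dB z bd1; split.
    move=> /cell_split[/h1|/h2]; rewrite /sector.
      case: (s) => [[k1 k2]|k]; first by split; exact: ltW.
      have [l1|l1] := leP z.1 0; first by left.
      have [l2|l2] := leP z.2 0; first by right.
      by case: k; split; exact: ltW.
    by case: (s) => -[[-> k]|[-> k]]; [split|split|left|right].
  rewrite /sector => k; apply/cell_split.
  have [E|E] := pselect (cell_bd e (io z)); [by right|left; apply/h1; move: k].
  have nE : ~ ((z.1 = 0 /\ 0 <= z.2) \/ (z.2 = 0 /\ 0 <= z.1)) by move=> /h2.
  case: (s) => [[k1 k2]|k [k1 k2]].
    have [l1|l1] := eqVneq z.1 0; first by case: nE; left.
    have [l2|l2] := eqVneq z.2 0; first by case: nE; right.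
    by split; rewrite lt_neqAle eq_sym ?l1 ?l2.
  apply: nE; case: k => k; [left|right]; split=> //; apply/eqP; rewrite eq_le k //.
move=> y /cell_split[Vy _|].
  have := open_nbhs_nbhs (conj (cell_open sT ce ie) Vy).
  by apply: filterS => t Vt _; apply/cell_split; left.
rewrite eB => -[//|[x /andP[h1 h2] <-] nJ].
have hx : 0 < x < x1.
  rewrite !lt_neqAle h1 h2 !andbT; apply/andP; split; apply/eqP => E; apply: nJ.
    exists 0; first by rewrite /seg /= lexx ltW.
    by rewrite -E w_io ?normr0 // ltW.
  by exists s1; [rewrite /seg /= lexx ltW|rewrite E].
have hx' : 0 < x < mu * x1.
  by case/andP: hx => k1 k2; rewrite k1 (lt_trans k2)// ltr_pMl.
have [eta eta0 etaE] := sideE x hx.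
have [eta' eta'0 etaE'] := sideE' x hx'.
pose r := Num.min eta eta'.
have r0 : 0 < r by rewrite lt_min eta0.
have br z : box r z -> box eta z by apply: box_le; rewrite ge_min lexx.
have br' z : box r z -> box eta' z by apply: box_le; rewrite ge_min lexx orbT.
pose k (z : plane) := io (x + z.1, z.2).
have ck : contin (box r) k.
  apply: (contin_comp _ (ls_c L)) => [|z /br /etaE[]//].
  apply: contin_pair; last by apply: contin_snd; exact: contin_id.
  by apply: continD; [exact: contin_cst|apply: contin_fst; exact: contin_id].
have ik : {in box r &, injective k}.
  move=> u v; rewrite !inE => /br /etaE[hu _ _ _] /br /etaE[hv _ _ _].
  by move=> /(ls_inj L hu hv) [/addrI E1 E2]; exact: pairE.
have := open_param sT ck ik (box_nbhs r0); rewrite {1}/k /= addr0.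
apply: filterS => t [z bz <-] ft.
have [b1 b2 b3 b4] := etaE z (br z bz); have [_ _ _ b4'] := etaE' z (br' z bz).
have ft' : ((fun z => f (e z)) @` disk 1) (k z).
  by have [v dv E] := ft; exists v => //; rewrite E finvK.
apply/cell_split; move: ft' => /cell_split[Vt|]; first by left; apply/b4; rewrite ss'; apply/b4'.
rewrite (ar_B A') => -[[q /andP[q1 q2] E]|[q /andP[q1 q2] E]]; right; rewrite eB.
  left; exists q => //; apply/andP; split=> //; apply: le_trans q2 _.
  by rewrite ler_piMl// ltW.
right; exists (x + z.1); first exact/andP.
have bq : box (mu * a) ((q, 0) : plane).
  split; rewrite /= ?normr0 ?mulr_ge0 ?(ltW mu0) ?(ltW a0)// ger0_norm//.
  by apply: le_trans q2 _; apply: (le_trans mx); rewrite ler_peMl// ltW.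
by have := ls_inj L bq b1 E; rewrite /k => -[_ <-].
Qed.

(* Points that [f] carries out of the cell are sent to the stable arc, so that [f] followed by this
   retraction is a self-map of the cell. *)
Lemma return_map f finv e w s1 : surface R T -> continuous f -> cancel f finv -> is_cell e ->
  continuous w -> injective w -> 0 < s1 -> w @` seg 0 s1 `<=` cell_bd e ->
  (forall y, (e @` disk 1) y -> ~ (w @` seg 0 s1) y ->
     nbhs y [set t | (e @` disk 1) (finv t) -> (e @` disk 1) t]) ->
  exists G : plane -> plane, [/\ contin (disk 1) G, (forall z, disk 1 z -> disk 1 (G z)),
    (forall z, disk 1 z -> (e @` disk 1) (f (e z)) -> e (G z) = f (e z)) &
    (forall z, disk 1 z -> ~ (e @` disk 1) (f (e z)) -> (w @` seg 0 s1) (e (G z)))].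
Proof.
move=> sT cf fK [ce ie] cw iw s10 JB near_in; have hT := sT.1.
pose D := e @` disk 1; pose J := w @` seg 0 s1.
have D0 : (disk 1 : set plane) !=set0 by exists 0; rewrite /disk /sq /= expr0n /= addr0 sqr_ge0.
have [psi [cpsi eK psiK]] := contin_inverse hT (compact_disk ler01) ce ie D0.
have S0 : (seg 0 s1) !=set0 by exists 0; rewrite /seg /= lexx ltW.
have [rho [crho wK rhoK]] := contin_inverse hT (@compact_seg R 0 s1) (contin_continuous cw) (in2W iw) S0.
have JD : J `<=` D by move=> y /JB By; apply/cell_split; right.
have clJ : closed J.
  apply: compact_closed => //; apply: contin_image_compact; last exact: compact_seg.
  exact: contin_continuous.
have clD : closed D by exact: cell_closed.
have cfe : contin (disk 1) (fun z => f (e z)).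
  exact: (contin_comp (B := setT) ce (contin_continuous cf)).
have cld : closed (disk 1 : set plane) by exact: closed_disk_set.
pose E1 := disk 1 `&` (fun z => f (e z)) @^-1` D.
pose E2 := disk 1 `&` (fun z => f (e z)) @^-1` J.
have cE1 : closed E1 by exact: contin_preimage_closed.
have cE2 : closed E2 by exact: contin_preimage_closed.
have kE2 : compact E2 by apply: (subclosed_compact cE2 (compact_disk ler01)) => z [].
have crf : contin E2 (fun z => rho (f (e z))).
  apply: (contin_comp (f := fun z => f (e z)) _ crho) => [|z []//].
  by apply: contin_sub cfe => z [].
(* The arc parameter of [f (e z)], defined when the image lies on the arc, is extended to the plane
   and clamped to [[0, s1]]; exiting points are sent to the resulting point of the arc. *)
have [S cS SE] := tietze_compact kE2 crf.
pose cl (t : R) := Num.max 0 (Num.min s1 t).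
have clI t : seg 0 s1 (cl t).
  by rewrite /seg /cl /= le_max lexx ge_max (ltW s10) ge_min lexx.
have clid t : seg 0 s1 t -> cl t = t.
  by move=> /andP[h1 h2]; rewrite /cl (min_idPr h2); apply/max_idPr.
pose out z := psi (w (cl (S z))).
pose G z := if `[< D (f (e z)) >] then psi (f (e z)) else out z.
have GD z : D (f (e z)) -> G z = psi (f (e z)) by move=> h; rewrite /G asboolT.
have GN z : ~ D (f (e z)) -> G z = out z by move=> h; rewrite /G asboolF.
have outJ z : J (w (cl (S z))) by exists (cl (S z)).
have cout A : contin A out.
  apply: (contin_comp (f := fun z => w (cl (S z))) _ cpsi) => [|z _]; last exact: JD (outJ z).
  apply: contin_continuous => z.
  apply: (@continuous_comp _ _ _ (fun z => cl (S z)) w); last exact: cw.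
  apply: contin_setT; apply: contin_max; first exact: contin_cst.
  by apply: contin_min; [exact: contin_cst|exact: contin_continuous].
have E2out z : E2 z -> psi (f (e z)) = out z.
  move=> Ez; have [_ Jz] := Ez; have [k1 k2] := rhoK _ Jz.
  by rewrite /out -SE ?inE// clid// k2.
pose F := closure (disk 1 `\` E1) `|` E2.
have cF : closed F by apply: closedU => //; exact: closed_closure.
have Fd : closure (disk 1 `\` E1) `<=` disk 1.
  by rewrite {2}(closure_id (disk 1)).1//; apply: closureS => z [].
(* The gluing is continuous because a limit of exiting points whose image is in the cell has its
   image on the arc, where both formulas agree. *)
have FE z : F z -> D (f (e z)) -> E2 z.
  move=> [cz|//] Dz; have dz := Fd _ cz; split=> //; apply: contrapT => nJ.
  have U := near_in _ Dz nJ.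
  have W : nbhs z [set t | disk 1 t -> (D (finv (f (e t))) -> D (f (e t)))] := cfe _ dz _ U.
  have [t [[dt nt] Wt]] := cz _ W.
  by apply: nt; split=> //; apply: (Wt dt); rewrite fK; exists t.
exists G; split.
- apply: (@contin_sub _ _ _ (E1 `|` F)).
    move=> z dz; have [h|h] := pselect (E1 z); first by left.
    by right; left; apply: subset_closure.
  apply: continU => //.
    apply: (contin_eq (f := fun z => psi (f (e z)))).
      by move=> z; rewrite inE => -[_ h]; rewrite GD.
    apply: (contin_comp (f := fun z => f (e z)) _ cpsi) => [|z []//].
    by apply: contin_sub cfe => z [].
  apply: (contin_eq (f := out)); last exact: cout.
  move=> z; rewrite inE => Fz; have [h|h] := pselect (D (f (e z))).
    by rewrite GD// E2out//; exact: FE.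
  by rewrite GN.
- move=> z dz; have [h|h] := pselect (D (f (e z))).
    by rewrite GD//; exact: (psiK _ h).1.
  by rewrite GN//; exact: (psiK _ (JD _ (outJ z))).1.
- by move=> z dz h; rewrite GD//; exact: (psiK _ h).2.
- by move=> z dz h; rewrite (GN _ h) /out (psiK _ (JD _ (outJ z))).2; exact: outJ.
Qed.

(** Once on the stable arc, a [G]-orbit stays there and is contracted by [la], so it is periodic
    only at [p]. Otherwise no exit ever happens and [G] acts as [f]; a point of the unstable arm is
    not periodic either, because its backward orbit shrinks by [mu]. *)
Lemma return_periodic f finv p io a mu la w e s1 x1 (G : plane -> plane) n z :
  cancel f finv -> (forall s, f (w s) = w (la * s)) ->
  arms f p io a mu la w e s1 x1 ->
  (forall z, disk 1 z -> disk 1 (G z)) ->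
  (forall z, disk 1 z -> (e @` disk 1) (f (e z)) -> e (G z) = f (e z)) ->
  (forall z, disk 1 z -> ~ (e @` disk 1) (f (e z)) -> (w @` seg 0 s1) (e (G z))) ->
  (0 < n)%N -> disk 1 z -> iter n G z = z ->
  e z = p \/ forall i, cell_int e (iter i f (e z)) /\ e (iter i G z) = iter i f (e z).
Proof.
move=> fK fw A Gd GD GJ n0 dz pz; have [L cw iw w_io [ce ie] s10 x10 x1a eB meet] := A.
have a0 := ls_a L; have mu1 := ls_mu L; have la0 := ls_la0 L; have la1 := ls_la1 L.
have mu0 : 0 < mu by exact: lt_trans ltr01 mu1.
have wp : w 0 = p by rewrite w_io ?normr0 ?(ltW a0)// -(ls_p L).
have dzi i : disk 1 (iter i G z) by elim: i => [//|i IH]; rewrite iterS; exact: Gd.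
have per k : iter (k * n) G z = z.
  by elim: k => [//|k IH]; rewrite mulSn iterD IH.
have JD y : (w @` seg 0 s1) y -> (e @` disk 1) y.
  by move=> Jy; apply/cell_split; right; rewrite eB; left.
have [[i [s hs sE]]|nJ] := pselect (exists i, (w @` seg 0 s1) (e (iter i G z))).
  left.
  have orb j : e (iter (j + i) G z) = w (la ^+ j * s) /\ seg 0 s1 (la ^+ j * s).
    elim: j => [|j [IH1 IH2]]; first by rewrite add0n expr0 mul1r -sE.
    have h : seg 0 s1 (la ^+ j.+1 * s).
      case/andP: IH2 => h1 h2; rewrite exprS -mulrA; apply/andP; rewrite mulr_ge0 ?(ltW la0)//.
      by split=> //; apply: le_trans h2; rewrite ler_piMl// ltW.
    have E : f (e (iter (j + i) G z)) = w (la ^+ j.+1 * s) by rewrite IH1 fw exprS mulrA.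
    split=> //; rewrite addSn iterS GD ?E//.
    by apply: JD; exists (la ^+ j.+1 * s).
  have s0 : s = 0.
    have [E _] := orb n; move: E; rewrite addnC iterD pz -sE => /iw /eqP.
    rewrite -subr_eq0 -{1}(mul1r s) -mulrBl mulf_eq0 => /orP[|/eqP//].
    rewrite subr_eq0 => /eqP E; have : la ^+ n < 1 by rewrite exprn_ilt1 ?(ltW la0)// -lt0n.
    by rewrite -E ltxx.
  have [E _] := orb (i * n - i)%N; move: E; rewrite subnK ?leq_pmulr// per s0 mulr0 wp.
  by [].
have Dall i : (e @` disk 1) (f (e (iter i G z))).
  by apply: contrapT => h; apply: nJ; exists i.+1; rewrite iterS; exact: GJ.
have orb i : e (iter i G z) = iter i f (e z).
  by elim: i => [//|i IH]; rewrite !iterS GD// IH.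
right=> i; split=> //; rewrite -orb.
have /cell_split[//|] : (e @` disk 1) (e (iter i G z)) by exists (iter i G z).
rewrite eB => -[h|[x /andP[x0 xx] xE]]; first by case: nJ; exists i.
have back k : iter k f (io (x / mu ^+ k, 0)) = io (x, 0).
  elim: k => [|k IH]; first by rewrite expr0 divr1.
  rewrite iterSr (ls_f L) /=.
    by rewrite mulr0 exprS invfM mulrCA mulVKf ?gt_eqF.
  split; rewrite /= ?normr0 ?(ltW a0)// ger0_norm ?divr_ge0 ?exprn_ge0 ?(ltW mu0)//.
  rewrite ler_pdivrMr ?exprn_gt0//; apply: (le_trans xx); apply: (le_trans x1a).
  by rewrite ler_peMr ?(ltW a0)// exprn_ege1// ltW.
have pit : iter n f (io (x, 0)) = io (x, 0).
  by rewrite xE orb -iterD addnC iterD -(orb n) pz.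
have bx t : 0 <= t -> t <= x -> box (mu * a) ((t, 0) : plane).
  move=> t0 tx; split; rewrite /= ?normr0 ?mulr_ge0 ?(ltW mu0) ?(ltW a0)// ger0_norm//.
  by apply: (le_trans tx); apply: (le_trans xx); apply: (le_trans x1a); rewrite ler_peMl// ltW.
have inj_iter : injective (iter n f).
  by move=> u v; elim: n {n0 pz per back pit} => [//|k IH]; rewrite !iterS => /(can_inj fK) /IH.
have E : io (x / mu ^+ n, 0) = io (x, 0) by apply: inj_iter; rewrite back pit.
have mn : 0 < mu ^+ n by rewrite exprn_gt0.
have mn1 : 1 < mu ^+ n by rewrite exprn_egt1// -lt0n.
have := ls_inj L (bx (x / mu ^+ n) _ _) (bx x x0 (lexx x)) E.
rewrite divr_ge0 ?(ltW mn)// ler_pdivrMr// ler_peMr ?(ltW mn1)// => /(_ isT isT) [E1].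
have xz : x = 0.
  apply/eqP; rewrite eq_le x0 andbT leNgt; apply/negP => xp.
  have : x / mu ^+ n < x by rewrite ltr_pdivrMr// ltr_pMr.
  by rewrite E1 ltxx.
by case: nJ; exists i; exists 0; [rewrite /seg /= lexx ltW|rewrite wp -(ls_p L) -xE xz].
Qed.

End Return.

(** * The index argument on the cell *)

Section Index.
Variables (R : realType) (T : topologicalType).
Notation plane := (R * R)%type.
Implicit Types (f finv : T -> T) (e io : plane -> T) (w : R -> T) (a mu la : R).

(** Plants the planar map [sh], the identity on the rim of [box d], into the closed disk through the
    chart at [p], which is a boundary point of the cell; [shD] keeps the result in the cell. *)
Lemma local_modification e io (d c : R) (sh : plane -> plane) : surface R T -> is_cell e ->
  d <= c -> 0 < d -> contin (box c) io -> {in box c &, injective io} ->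
  contin (box d) sh -> (forall q, box d q -> box c (sh q)) ->
  (forall q, box d q -> d <= nm q -> sh q = q) ->
  (forall q, box d q -> (e @` disk 1) (io q) -> (e @` disk 1) (io (sh q))) ->
  exists Sh : plane -> plane, [/\ contin (disk 1) Sh, (forall z, disk 1 z -> disk 1 (Sh z)),
    (forall z, disk 1 z -> ~ (io @` box d) (e z) -> Sh z = z) &
    (forall z q, disk 1 z -> box d q -> e z = io q -> e (Sh z) = io (sh q))].
Proof.
move=> sT [ce ie] dc d0 cio iio csh shc sh_id shD; have hT := sT.1.
pose D := e @` disk 1.
have D0 : (disk 1 : set plane) !=set0 by exists 0; rewrite /disk /sq /= expr0n /= addr0 sqr_ge0.
have [psi [cpsi eK psiK]] := contin_inverse hT (compact_disk ler01) ce ie D0.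
have B0 : (box d : set plane) !=set0 by exists 0; apply: box0; exact: ltW.
have cd : contin (box d) io by apply: contin_sub cio; exact: box_le.
have idd : {in box d &, injective io}.
  by move=> u v; rewrite !inE => /(box_le dc) hu /(box_le dc) hv; apply: iio; rewrite inE.
have [kap [ckap ioK kapK]] := contin_inverse hT (@compact_boxset R d) cd idd B0.
pose B := io @` box d.
have clB : closed B.
  by apply: compact_closed => //; apply: contin_image_compact => //; exact: compact_boxset.
pose M z := psi (io (sh (kap (e z)))).
pose Sh z := if `[< B (e z) >] then M z else z.
have ShM z : B (e z) -> Sh z = M z by move=> h; rewrite /Sh asboolT.
have ShN z : ~ B (e z) -> Sh z = z by move=> h; rewrite /Sh asboolF.
have cld : closed (disk 1 : set plane) by exact: closed_disk_set.
pose E1 := disk 1 `&` e @^-1` B.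
have cE1 : closed E1 by exact: contin_preimage_closed.
have MD z : E1 z -> D (io (sh (kap (e z)))).
  move=> [dz Bz]; have [k1 k2] := kapK _ Bz; apply: shD => //; rewrite k2; exact: imageP.
pose F := closure (disk 1 `\` E1).
have Fd : F `<=` disk 1.
  by rewrite [X in _ `<=` X](closure_id _).1//; apply: closureS => z [].
have FE z : F z -> B (e z) -> d <= nm (kap (e z)).
  move=> Fz Bz; have dz := Fd _ Fz; have [k1 k2] := kapK _ Bz.
  rewrite leNgt; apply/negP => lt.
  pose q := kap (e z); pose eta := d - nm q.
  have eta0 : 0 < eta by rewrite subr_gt0.
  have nb : nbhs q (box d).
    apply/nbhs_translate; exists eta => // v [v1 v2].
    have [n1 n2] : `|q.1| <= nm q /\ `|q.2| <= nm q by rewrite /nm !le_max !lexx orbT.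
    have dE : d = nm q + eta by rewrite /eta addrC subrK.
    by split; rewrite dE; apply: le_trans (ler_normD _ _) _; exact: lerD.
  have W : nbhs z [set t | disk 1 t -> B (e t)].
    have NB : nbhs (e z) B by rewrite -k2; exact: (open_param sT cd idd).
    exact: (ce _ dz _ NB).
  have [t [[dt nt] Wt]] := Fz _ W.
  by apply: nt; split=> //; exact: Wt.
exists Sh; split.
- apply: (@contin_sub _ _ _ (E1 `|` F)).
    move=> z dz; have [h|h] := pselect (E1 z); first by left.
    by right; apply: subset_closure.
  apply: continU => //; first exact: closed_closure.
    apply: (contin_eq (f := M)); first by move=> z; rewrite inE => -[_ h]; rewrite ShM.
    apply: (contin_comp (f := fun z => io (sh (kap (e z)))) _ cpsi); last exact: MD.
    apply: (contin_comp (f := fun z => sh (kap (e z))) _ cio) => [|z [_ h]]; last first.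
      by apply: shc; exact: (kapK _ h).1.
    apply: (contin_comp (f := fun z => kap (e z)) _ csh) => [|z [_ h]]; last exact: (kapK _ h).1.
    apply: (contin_comp (f := e) _ ckap) => [|z []//].
    by apply: contin_sub ce => z [].
  apply: (contin_eq (f := id)); last exact: contin_id.
  move=> z; rewrite inE => Fz; have [h|h] := pselect (B (e z)); last by rewrite ShN.
  have [k1 k2] := kapK _ h.
  by rewrite ShM// /M sh_id ?k2 ?eK//; [exact: Fd|exact: FE].
- move=> z dz; have [h|h] := pselect (B (e z)); last by rewrite ShN.
  by rewrite ShM//; exact: (psiK _ (MD _ (conj dz h))).1.
- by move=> z dz h; rewrite ShN.
- move=> z q dz bq E; have h : B (e z) by exists q.
  by rewrite ShM// (psiK _ (MD _ (conj dz h))).2 E ioK.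
Qed.

(** The linear map preserves the sector, so points of the cell near [p] do not exit while they stay
    in the box, and [G] acts linearly on them. *)
Lemma near_orbit f p io a mu la w e s1 x1 (G : plane -> plane) s (d : R) n z q :
  arms f p io a mu la w e s1 x1 ->
  (forall z, disk 1 z -> disk 1 (G z)) ->
  (forall z, disk 1 z -> (e @` disk 1) (f (e z)) -> e (G z) = f (e z)) ->
  d <= a -> (forall z, box d z -> ((e @` disk 1) (io z) <-> sector s z)) ->
  disk 1 z -> e z = io q -> sector s q -> mu ^+ n * `|q.1| <= d -> `|q.2| <= d ->
  e (iter n G z) = io (mu ^+ n * q.1, la ^+ n * q.2).
Proof.
move=> A Gd GD da sE dz ez sq_ h1 h2; have L := ar_L A.
have a0 := ls_a L; have mu1 := ls_mu L; have la0 := ls_la0 L; have la1 := ls_la1 L.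
have mu0 : 0 < mu by exact: lt_trans ltr01 mu1.
have dzi i : disk 1 (iter i G z) by elim: i => [//|i IH]; rewrite iterS; exact: Gd.
suff H i : (i <= n)%N -> e (iter i G z) = io (mu ^+ i * q.1, la ^+ i * q.2) by exact: H.
have bi j : (j <= n)%N -> box d ((mu ^+ j * q.1, la ^+ j * q.2) : plane).
  move=> jn; split; rewrite /= normrM ger0_norm ?exprn_ge0 ?(ltW mu0) ?(ltW la0)//.
    by apply: le_trans h1; rewrite ler_wpM2r// ler_weXn2l// ltW.
  by apply: le_trans h2; rewrite ler_piMl// exprn_ile1// ltW.
have si j : sector s ((mu ^+ j * q.1, la ^+ j * q.2) : plane).
  have m0 : 0 < mu ^+ j by rewrite exprn_gt0.
  have l0 : 0 < la ^+ j by rewrite exprn_gt0.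
  by move: sq_; case: (s) => /=; rewrite ?(pmulr_rge0 _ m0) ?(pmulr_rge0 _ l0)
    ?(pmulr_rle0 _ m0) ?(pmulr_rle0 _ l0).
elim: i => [|i IH] ilt; first by rewrite !expr0 !mul1r ez; congr io; exact: pairE.
have IH' := IH (ltnW ilt).
have E : f (e (iter i G z)) = io (mu ^+ i.+1 * q.1, la ^+ i.+1 * q.2).
  rewrite IH' (ls_f L); last by apply: box_le (bi _ (ltnW ilt)).
  by rewrite /= !mulrA -!exprS.
by rewrite iterS GD ?E//; apply/sE => //; exact: bi.
Qed.

(** What the index computation asks of a fixed point: derivative [diag (m, l)] with
    [1 - m < 0 < 1 - l], so that the identity minus the derivative has negative determinant. *)
Definition saddle_form (F : T -> T) (q : T) :=
  exists (ka : plane -> T) (h : plane -> plane) (m l : R) (U : set plane),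
    [/\ nbhs (0 : plane) U, contin U ka, {in U &, injective ka} & ka 0 = q] /\
    [/\ contin U h, (forall t : R, 0 < t -> \forall v \near (0 : plane),
          sq (h v - (m * v.1, l * v.2)) <= t * sq v), 1 < m, l < 1 &
        \forall v \near (0 : plane), ka (h v) = F (ka v)].

Lemma iter_continuous f n : continuous f -> continuous (iter n f).
Proof.
move=> cf; elim: n => [|n IH] x; first exact: cvg_id.
by apply: (@continuous_comp _ _ _ (iter n f) f); [exact: IH|exact: cf].
Qed.

(** Along an orbit inside the open cell no retraction takes place and, away from [B], no shift: near
    [psi q] the self-map of the disk is conjugate to the [n]-th iterate of [f]. *)
Lemma orbit_index f e psi (G Sh : plane -> plane) n q (B : set T) : surface R T ->
  continuous f -> is_cell e -> contin (e @` disk 1) psi ->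
  (forall z, disk 1 z -> psi (e z) = z) ->
  (forall y, (e @` disk 1) y -> disk 1 (psi y) /\ e (psi y) = y) ->
  (forall z, disk 1 z -> disk 1 (G z)) ->
  (forall z, disk 1 z -> (e @` disk 1) (f (e z)) -> e (G z) = f (e z)) ->
  (forall z, disk 1 z -> ~ B (e z) -> Sh z = z) ->
  closed B -> ~ B (iter n f q) -> (forall i, cell_int e (iter i f q)) ->
  saddle_form (iter n f) q ->
  neg_zero (fun z => z - Sh (iter n G z)) (psi q) /\
  exists2 U, nbhs (psi q) U & forall t, U t -> Sh (iter n G t) = t -> t = psi q.
Proof.
move=> sT cf [ce ie] cpsi eK psiK Gd GD ShN clB nB Vq [ka [h [m [l [U [[U0 cka ika ka0] H]]]]]].
case: H => ch est m1 l1 kaE.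
have VD y : cell_int e y -> (e @` disk 1) y by move=> h0; apply/cell_split; left.
have oV : open (cell_int e) by exact: cell_open.
have pull W : nbhs q W -> \forall v \near (0 : plane), W (ka v).
  rewrite -ka0 => nW.
  have U00 := nbhs_singleton U0.
  have H : nbhs (0 : plane) [set v | U v -> W (ka v)] := cka _ U00 _ nW.
  by apply: filterS2 U0 H => v Uv; apply.
have nV : \forall v \near (0 : plane), forall i, (i <= n)%N -> cell_int e (iter i f (ka v)).
  elim: (n) => [|k IH].
    have := pull _ (open_nbhs_nbhs (conj oV (Vq 0%N))).
    by apply: filterS => v Vv i; rewrite leqn0 => /eqP ->.
  have Hk : \forall v \near (0 : plane), cell_int e (iter k.+1 f (ka v)).
    apply: (pull [set y | cell_int e (iter k.+1 f y)]).
    exact: (@iter_continuous f k.+1 cf q _ (open_nbhs_nbhs (conj oV (Vq k.+1)))).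
  apply: filterS2 IH Hk => v h1 h2 i; rewrite leq_eqVlt => /orP[/eqP -> //|].
  by rewrite ltnS; exact: h1.
have nBv : \forall v \near (0 : plane), ~ B (iter n f (ka v)).
  apply: (pull [set y | ~ B (iter n f y)]).
  have oB : open (~` B) by rewrite openC.
  exact: (@iter_continuous f n cf q _ (open_nbhs_nbhs (conj oB nB))).
pose U' := [set v | U v /\ cell_int e (ka v)].
have nU' : nbhs (0 : plane) U'.
  by apply: filterS2 U0 nV => v Uv /(_ 0%N isT).
have c' : contin U' (fun v => psi (ka v)).
  apply: (contin_comp (f := ka) _ cpsi) => [|v [_]]; last exact: VD.
  by apply: contin_sub cka => v [].
have i' : {in U' &, injective (fun v => psi (ka v))}.
  move=> u v; rewrite !inE => -[Uu Vu] [Uv Vv] /(congr1 e).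
  by rewrite (psiK _ (VD _ Vu)).2 (psiK _ (VD _ Vv)).2; apply: ika; rewrite inE.
have ch' : contin U' h by apply: contin_sub ch => v [].
have est' (t : R) : 0 < t -> \forall v \near (0 : plane),
    sq (h (0 + v) - 0 - (m * v.1, l * v.2)) <= t * sq v.
  by move=> t0; apply: filterS (est t t0) => v; rewrite add0r subr0.
have dyn : \forall v \near (0 : plane), Sh (iter n G (psi (ka v))) = psi (ka (h v)).
  apply: filterS3 nV nBv kaE => v Vi nb kaEv.
  have [dv ev] := psiK _ (VD _ (Vi 0%N isT)).
  have O i : (i <= n)%N -> disk 1 (iter i G (psi (ka v))) /\
      e (iter i G (psi (ka v))) = iter i f (ka v).
    elim: i => [//|i IH] ilt; have [d1 e1] := IH (ltnW ilt).
    split; first by rewrite iterS; exact: Gd.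
    rewrite !iterS GD ?e1//; apply: VD; exact: (Vi _ ilt).
  have [d1 e1] := O n (leqnn n).
  by rewrite ShN ?e1// -[LHS](eK _ d1) e1; congr psi.
have := @saddle_index R (fun v => psi (ka v)) h (fun z => Sh (iter n G z)) m l 0 U' nU' c' i' ch' est' m1 l1 dyn.
by rewrite ka0.
Qed.

End Index.

Section Cell_index.
Variables (R : realType) (T : topologicalType).
Notation plane := (R * R)%type.
Implicit Types (f finv : T -> T) (e io : plane -> T) (w : R -> T) (a mu la : R).

Definition bump (d : R) (q : plane) : R := Num.max 0 (Num.min 1 (2 - nm q * (2 / d))).

Lemma bump_bounds d q : 0 <= bump d q <= 1.
Proof. by rewrite /bump le_max lexx ge_max ler01 ge_min lexx. Qed.

Lemma bump0 d q : 0 < d -> d <= nm q -> bump d q = 0.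
Proof.
move=> d0 dq; apply/max_idPl; rewrite ge_min; apply/orP; right.
by rewrite subr_le0 mulrA ler_pdivlMr// mulrC ler_pM2r.
Qed.

Lemma bump1 d q : 0 < d -> nm q <= d / 2 -> bump d q = 1.
Proof.
move=> d0 dq; rewrite /bump (min_idPl _); first exact/max_idPr.
by rewrite lerBrDr -lerBrDl mulrA ler_pdivrMr//; move: dq; clear; lra.
Qed.

Lemma contin_bump A d : contin A (bump d).
Proof.
apply: contin_max; first exact: contin_cst.
apply: contin_min; first exact: contin_cst.
apply: continB; first exact: contin_cst.
apply: continM; last exact: contin_cst.
by apply: contin_max; apply: contin_norm; [apply: contin_fst|apply: contin_snd]; exact: contin_id.
Qed.

(** Solving for [x] gives modulus at most [E M / (M - 1)]. With the contracting analogue this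
    confines fixed points of the shifted map to the zone where the cutoff is 1. *)
Lemma shift_expanding (M E d b x v : R) : 1 < M -> 0 <= b <= 1 -> `|v| <= 1 ->
  0 < E -> E * M <= d * (M - 1) -> x = M * (x + E * b * v) -> `|x| <= d.
Proof.
move=> M1 /andP[b0 b1]; rewrite ler_norml => /andP[v0 v1] E0 EM xE.
have bv : -1 <= b * v <= 1 by apply/andP; split; move: b0 b1 v0 v1; clear; nra.
have {}xE : x * (M - 1) = - (E * M) * (b * v) by rewrite mulrBr mulr1 {2}xE; ring.
have M0 : 0 < M - 1 by rewrite subr_gt0.
have EM0 : 0 < E * M by rewrite mulr_gt0// (lt_trans ltr01).
rewrite ler_norml -(ler_pM2r M0) -[x <= d](ler_pM2r M0) xE; case/andP: bv.
by move: EM EM0; clear; move=> *; apply/andP; split; nra.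
Qed.

Lemma shift_contracting (L E d b x v : R) : 0 < L < 1 -> 0 <= b <= 1 -> `|v| <= 1 ->
  0 < E -> E <= d * (1 - L) -> x = L * (x + E * b * v) -> `|x| <= d.
Proof.
move=> /andP[L0 L1] /andP[b0 b1]; rewrite ler_norml => /andP[v0 v1] E0 EM xE.
have bv : -1 <= L * b * v <= 1.
  have k0 : 0 <= L * b by rewrite mulr_ge0// ltW.
  have k1 : L * b <= 1 by rewrite mulr_ile1// ltW.
  by apply/andP; split; move: k0 k1 v0 v1; clear; nra.
have {}xE : x * (1 - L) = E * (L * b * v) by rewrite mulrBr mulr1 {1}xE; ring.
have M0 : 0 < 1 - L by rewrite subr_gt0.
rewrite ler_norml -(ler_pM2r M0) -[x <= d](ler_pM2r M0) xE; case/andP: bv.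
by move: EM E0; clear; move=> *; apply/andP; split; nra.
Qed.

(** The map [Sh] after [G^n] has, away from [p], the fixed points of [f^n] with orbit in the cell,
    and near [p] no fixed point or one interior linear saddle. All have index -1, against
    [no_negative_fixed_points]. *)
Lemma cell_index f finv p io a mu la w e s1 x1 n : surface R T -> continuous f ->
  cancel f finv -> cancel finv f -> (forall s, f (w s) = w (la * s)) -> mu * x1 <= a ->
  w s1 = io (x1, 0) -> arms f p io a mu la w e s1 x1 -> (0 < n)%N ->
  (forall q, iter n f q = q -> (forall i, cell_int e (iter i f q)) -> saddle_form R (iter n f) q) ->
  False.
Proof.
move=> sT cf fK finvK fw mx wx A n0 Hs; have hT := sT.1.
have [L cw iw w_io cell_e s10 x10 x1a eB meet] := A; have [ce ie] := cell_e.
have a0 := ls_a L; have mu1 := ls_mu L; have la0 := ls_la0 L; have la1 := ls_la1 L.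
have mu0 : 0 < mu by exact: lt_trans ltr01 mu1.
have [s [[D0 /andP[D00 D0a] sE] near_in]] := cell_sector sT cf fK finvK fw mx wx A.
have JB : w @` seg 0 s1 `<=` cell_bd e by move=> y Jy; rewrite eB; left.
have [G [cG Gd GD GJ]] := return_map sT cf fK cell_e cw iw s10 JB near_in.
have dn0 : (disk 1 : set plane) !=set0 by exists 0; rewrite /disk /sq /= expr0n /= addr0 sqr_ge0.
have [psi [cpsi eK psiK]] := contin_inverse hT (compact_disk ler01) ce ie dn0.
have [M ME] : exists M, M = mu ^+ n by exists (mu ^+ n).
have [l lE] : exists l, l = la ^+ n by exists (la ^+ n).
have M1 : 1 < M by rewrite ME exprn_egt1// -lt0n.
have l01 : 0 < l < 1 by rewrite lE exprn_gt0// exprn_ilt1 ?(ltW la0)// -lt0n.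
have M0 : 0 < M by exact: lt_trans ltr01 M1.
have [l0 l1] := andP l01.
(* [d] leaves room for the shift and then for [f^n] inside the linear box; [E] is so small that
   fixed points of the shifted linear map have coordinates at most [d / 4], where the cutoff is
   1. *)
have [d [E [d0 dD dM E0 [EM El Ed]]]] : exists d E, [/\ 0 < d, 2 * d <= D0, M * (2 * d) <= D0, 0 < E &
    [/\ E * M <= d / 4 * (M - 1), E <= d / 4 * (1 - l) & E <= d]].
  pose d := D0 / (2 * M); pose kp := Num.min ((M - 1) / M) (1 - l).
  have d0 : 0 < d by rewrite divr_gt0// mulr_gt0.
  have dM : M * (2 * d) = D0 by rewrite /d; field; rewrite gt_eqF.
  have kp0 : 0 < kp by rewrite lt_min divr_gt0// ?subr_gt0.
  have k1 : kp * M <= M - 1 by rewrite -ler_pdivlMr// ge_min lexx.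
  have k2 : kp <= 1 - l by rewrite ge_min lexx orbT.
  exists d, (d / 4 * kp); move: d dM d0 => d dM d0; move: kp kp0 k1 k2 => kp kp0 k1 k2.
  split=> //.
  - by rewrite -dM; move: d0 M1; clear; nra.
  - by rewrite dM.
  - by rewrite mulr_gt0// divr_gt0.
  split; first by rewrite -mulrA ler_pM2l// divr_gt0.
    by rewrite ler_pM2l// divr_gt0.
  by move: k2 l0 d0 kp0; clear; nra.
have Da : box D0 `<=` (box (mu * a) : set plane).
  by apply: box_le; apply: (le_trans D0a); rewrite ler_peMl// ltW.
have DD : box (2 * d) `<=` (box D0 : set plane) by exact: box_le.
have sD z (bz : box D0 z) := (sE z bz).1.
have dd : box d `<=` (box (2 * d) : set plane).
  by apply: box_le; move: d0; clear; lra.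
(* The shift must send the sector into itself. In a quadrant it pushes along the expanding axis, and
   no point with nonnegative first coordinate can be fixed; in three quadrants it pushes diagonally,
   which moves the fixed point to [w0], strictly inside. *)
pose v : plane := if s then (1, 0) else (-1, -1).
have v1 : `|v.1| <= 1 by rewrite /v; case: (s); rewrite /= ?normrN normr1.
have v2 : `|v.2| <= 1 by rewrite /v; case: (s); rewrite /= ?normrN ?normr1 ?normr0.
pose sh q : plane := (q.1 + E * bump d q * v.1, q.2 + E * bump d q * v.2).
have csh : contin (box d) sh.
  by apply: contin_pair; (apply: continD;
    [by [apply: contin_fst; exact: contin_id|apply: contin_snd; exact: contin_id]
    |apply: continM; [apply: continM; [exact: contin_cst|exact: contin_bump]|exact: contin_cst]]).
have shc q : box d q -> box (2 * d) (sh q).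
  have [b0 b1] := andP (bump_bounds d q).
  have B t : `|t| <= 1 -> `|E * bump d q * t| <= d.
    move=> t1; rewrite normrM ger0_norm ?mulr_ge0 ?(ltW E0)//; apply: le_trans Ed.
    by rewrite -{2}(mulr1 E) -mulrA ler_pM2l// mulr_ile1.
  move=> [q1 q2]; rewrite mulr_natl mulr2n.
  by split; apply: (le_trans (ler_normD _ _)); apply: lerD => //; exact: B.
have sh_id q : box d q -> d <= nm q -> sh q = q.
  by move=> _ dq; rewrite /sh bump0// mulr0 !mul0r !addr0; case: (q).
have shS q : sector s q -> sector s (sh q).
  have [b0 b1] := andP (bump_bounds d q); rewrite /sh /v.
  have k0 : 0 <= E * bump d q by rewrite mulr_ge0// ltW.
  case: (s) => /= -[]; rewrite ?mulr1 ?mulr0 ?mulrN1 ?addr0.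
  - by move=> h1 h2; rewrite addr_ge0.
  - by left; rewrite subr_le0; exact: le_trans k0.
  - by right; rewrite subr_le0; exact: le_trans k0.
have shD q : box d q -> (e @` disk 1) (io q) -> (e @` disk 1) (io (sh q)).
  by move=> bq /(sD q (DD _ (dd _ bq))) h; apply/sD; [exact/DD/shc|exact: shS].
have d2 : d <= 2 * d by move: d0; clear; lra.
have i2 : {in box (2 * d) &, injective io}.
  by move=> u t; rewrite !inE => /DD/Da hu /DD/Da ht; exact: (ls_inj L).
have [Sh [cSh Shd Sh_out Sh_in]] := local_modification sT cell_e d2 d0
  (contin_sub (subset_trans DD Da) (ls_c L)) i2 csh shc sh_id shD.
have Gnd k z : disk 1 z -> disk 1 (iter k G z).
  by move=> dz; elim: k => [//|k IH]; rewrite iterS; exact: Gd.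
have cGn k : contin (disk 1) (iter k G).
  elim: k => [|k IH]; first exact: contin_id.
  by apply: (contin_comp (f := iter k G) IH cG) => z; exact: Gnd.
(* The fixed point of the linear map followed by the translation by [(- E, - E)]. *)
pose w0 : plane := (E / (M - 1), - (E / (1 - l))).
have key z q : disk 1 z -> box d q -> e (iter n G z) = io q -> Sh (iter n G z) = z ->
    s = false /\ e z = io w0.
  move=> dz bq yE fz.
  have ez : e z = io (sh q) by rewrite -{1}fz (Sh_in _ _ (Gnd n z dz) bq yE).
  have sq_ : sector s q by apply/(sD q (DD _ (dd _ bq))); rewrite -yE; exists (iter n G z) => //; exact: Gnd.
  have [b1 b2] := shc q bq.
  have h1 : mu ^+ n * `|(sh q).1| <= D0 by rewrite -ME; apply: le_trans dM; rewrite ler_pM2l.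
  have h2 : `|(sh q).2| <= D0 by exact: le_trans dD.
  have := near_orbit (n := n) A Gd GD D0a sD dz ez (shS q sq_) h1 h2.
  rewrite -ME -lE yE => ioE.
  have bq' : box D0 ((M * (sh q).1, l * (sh q).2) : plane).
    split; rewrite /= normrM gtr0_norm//; first by rewrite ME.
    by apply: le_trans h2; rewrite ler_piMl// ltW.
  have qE := ls_inj L (Da _ (DD _ (dd _ bq))) (Da _ bq') ioE.
  have q1 : q.1 = M * (q.1 + E * bump d q * v.1) by rewrite {1}qE.
  have q2 : q.2 = l * (q.2 + E * bump d q * v.2) by rewrite {1}qE.
  have n1 := shift_expanding M1 (bump_bounds d q) v1 E0 EM q1.
  have n2 := shift_contracting l01 (bump_bounds d q) v2 E0 El q2.
  have b1q : bump d q = 1.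
    by apply: bump1 => //; rewrite /nm ge_max; move: n1 n2 d0; clear; move=> *; apply/andP; split; lra.
  have shq : sh q = (q.1 + E * v.1, q.2 + E * v.2) by rewrite /sh b1q mulr1.
  move: q1 q2 sq_; rewrite b1q mulr1 ez shq /v /w0; case: (s) => /=.
    rewrite mulr1 => q1 _ [q1p _]; exfalso.
    by move: q1 q1p M1 E0; clear; nra.
  rewrite mulrN1 => q1 q2 _; split=> //; congr io; congr pair.
    apply: (@mulIf _ (M - 1)); first by rewrite subr_eq0 gt_eqF.
    by rewrite divfK ?subr_eq0 ?gt_eqF//; move: q1; clear; lra.
  apply: (@mulIf _ (1 - l)); first by rewrite subr_eq0 gt_eqF.
  by rewrite mulNr divfK ?subr_eq0 ?gt_eqF//; move: q2; clear; lra.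
apply: (@no_negative_fixed_points R (fun z => Sh (iter n G z))).
- by apply: (contin_comp (f := iter n G) (cGn n) cSh) => z; exact: Gnd.
- by move=> z dz; apply: Shd; exact: Gnd.
move=> z dz fz; have dy := Gnd n z dz.
(* If [G^n z] is outside the support of the shift, then [z] is [G^n]-periodic, and not over [p]; its
   orbit is a true orbit of [f] in the open cell. *)
have [[q bq yE]|nB] := pselect ((io @` box d) (e (iter n G z))); last first.
  have per : iter n G z = z by rewrite -{2}fz Sh_out.
  have [zp|orb] := return_periodic fK fw A Gd GD GJ n0 dz per.
    by case: nB; exists 0; [apply: box0; exact: ltW|rewrite per zp (ls_p L)].
  have fz' : iter n f (e z) = e z by rewrite -(orb n).2 per.
  have Vz i : cell_int e (iter i f (e z)) by exact: (orb i).1.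
  have nB' : ~ (io @` box d) (iter n f (e z)) by rewrite fz' -{1}per.
  have clB : closed (io @` box d).
    apply: compact_closed => //; apply: contin_image_compact; last exact: compact_boxset.
    by apply: contin_sub (ls_c L); exact: subset_trans dd (subset_trans DD Da).
  have := orbit_index sT cf cell_e cpsi eK psiK Gd GD Sh_out clB nB' Vz (Hs _ fz' Vz).
  rewrite eK// => -[N [U nU Uz]]; split=> //; last by exists U => // t Ut _; exact: Uz.
  by have [t ot tE] := Vz 0%N; rewrite -(eK z dz) -[e z]tE eK//; exact: odisk_disk.
have [sF ez] := key z q dz bq (esym yE) fz.
have M10 : 0 < M - 1 by rewrite subr_gt0.
have l10 : 0 < 1 - l by rewrite subr_gt0.
have w1 : 0 < w0.1 by rewrite divr_gt0.
have w1M : w0.1 * M <= d / 4 by rewrite /w0 /= mulrAC ler_pdivrMr.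
have w2 : w0.2 < 0 by rewrite oppr_lt0 divr_gt0.
have w2l : - w0.2 <= d / 4 by rewrite opprK ler_pdivrMr.
pose U : set plane := [set w | [/\ `|w.1| * M < d / 2, `|w.2| < d / 2 & w.2 < 0]].
have nU : nbhs w0 U.
  have g1 := @contin_gt R _ setT (fun w : plane => d / 2 - `|w.1| * M) w0 0.
  have g2 := @contin_gt R _ setT (fun w : plane => d / 2 - `|w.2|) w0 0.
  have g3 := @contin_gt R _ setT (fun w : plane => - w.2) w0 0.
  have {}g1 := g1 _ I _; have {}g2 := g2 _ I _; have {}g3 := g3 _ I _.
  apply: filterS3 (g1 _ _) (g2 _ _) (g3 _ _) => [t /(_ I) h1 /(_ I) h2 /(_ I) h3| | | | | |].
  - by split; [rewrite -subr_gt0|rewrite -subr_gt0|rewrite -oppr_gt0].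
  - apply: continB; [exact: contin_cst|apply: continM; [|exact: contin_cst]].
    by apply: contin_norm; apply: contin_fst; exact: contin_id.
  - by rewrite (gtr0_norm w1) subr_gt0; move: w1M d0; clear; lra.
  - apply: continB; [exact: contin_cst|].
    by apply: contin_norm; apply: contin_snd; exact: contin_id.
  - by rewrite (ltr0_norm w2) subr_gt0; move: w2l d0; clear; lra.
  - by apply: continN; apply: contin_snd; exact: contin_id.
  - by rewrite oppr_gt0.
have Ub t : U t -> box d t.
  move=> [t1 t2 _]; split; apply: ltW; last by move: t2 d0; clear; lra.
  by have := normr_ge0 t.1; move: t1 d0 M1; clear; nra.
have Ubq t : U t -> nm (M * t.1, l * t.2) <= d / 2.
  move=> [t1 t2 _]; rewrite /nm ge_max /= !normrM (gtr0_norm M0) (gtr0_norm l0) mulrC (ltW t1) /=.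
  by apply: le_trans (ltW t2); rewrite ler_piMl// ltW.
have Us t : U t -> sector s t by move=> [_ _ t3]; rewrite sF; right; exact: ltW.
have UD t : U t -> (e @` disk 1) (io t) by move=> Ut; apply/(sD t (DD _ (dd _ (Ub t Ut)))); exact: Us.
have cphi : contin U (fun t => psi (io t)).
  apply: (contin_comp (f := io) _ cpsi) => //.
  by apply: contin_sub (ls_c L) => t Ut; exact: (Da _ (DD _ (dd _ (Ub t Ut)))).
have iphi : {in U &, injective (fun t => psi (io t))}.
  move=> t t'; rewrite !inE => Ut Ut' /(congr1 e).
  rewrite (psiK _ (UD t Ut)).2 (psiK _ (UD t' Ut')).2.
  apply: (ls_inj L); [exact: (Da _ (DD _ (dd _ (Ub t Ut))))|exact: (Da _ (DD _ (dd _ (Ub t' Ut'))))].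
pose h (t : plane) : plane := (M * t.1 - E, l * t.2 - E).
have ch : contin U h.
  apply: contin_pair; (apply: continB; [apply: continM; [exact: contin_cst|]|exact: contin_cst]).
    by apply: contin_fst; exact: contin_id.
  by apply: contin_snd; exact: contin_id.
have hw0 : h w0 = w0.
  have M1' : M - 1 != 0 by rewrite gt_eqF.
  have l1' : 1 - l != 0 by rewrite gt_eqF.
  by rewrite /h /w0 /=; congr pair; field.
have est (c : R) : 0 < c -> \forall t \near (0 : plane),
    sq (h (w0 + t) - w0 - (M * t.1, l * t.2)) <= c * sq t.
  move=> c0; apply: filterS (@filterT _ (nbhs (0 : plane)) _) => t _.
  rewrite (_ : _ - _ - _ = 0); first by rewrite /sq /= expr0n addr0 mulr_ge0 ?(ltW c0)// addr_ge0 ?sqr_ge0.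
  rewrite -{2}hw0; apply: pairE => /=; ring.
have dyn : \forall t \near w0, Sh (iter n G (psi (io t))) = psi (io (h t)).
  apply: filterS nU => t Ut; have [dt et] := psiK _ (UD t Ut).
  have [t1 t2 _] := Ut; have [b1 b2] := Ub t Ut.
  have h1 : mu ^+ n * `|t.1| <= D0.
    rewrite -ME; apply: le_trans dM; rewrite ler_pM2l//; apply: (le_trans b1); move: d0; clear; lra.
  have h2 : `|t.2| <= D0 by apply: (le_trans b2); apply: le_trans dD; move: d0; clear; lra.
  have := near_orbit (n := n) A Gd GD D0a sD dt et (Us t Ut) h1 h2.
  rewrite -ME -lE => E1.
  have bt : box d ((M * t.1, l * t.2) : plane).
    have := Ubq t Ut; rewrite /nm ge_max => /andP[k1 k2].
    by split; [apply: (le_trans k1)|apply: (le_trans k2)]; move: d0; clear; lra.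
  have E2 := Sh_in _ _ (Gnd n _ dt) bt E1.
  rewrite -[LHS]eK ?E2; last by apply: Shd; exact: Gnd.
  by congr (psi (io _)); rewrite /sh (bump1 d0 (Ubq t Ut)) mulr1 /v sF /= !mulrN1.
have := @saddle_index R (fun t => psi (io t)) h (fun z => Sh (iter n G z)) M l w0 U nU cphi iphi ch est M1 l1 dyn.
rewrite -ez eK// => -[N [W nW Wz]]; split=> //; last by exists W => // t Wt _; exact: Wz.
have : cell_int e (io w0).
  apply/(sE w0 _).2; first by apply: DD; apply: dd; apply: Ub; exact: nbhs_singleton nU.
  by rewrite sF /= => -[_]; rewrite leNgt w2.
by move=> [t ot tE]; rewrite -(eK z dz) ez -tE eK//; exact: odisk_disk.
Qed.

End Cell_index.

(** * Normal form of the homoclinic loop *)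

Section Loops.
Variables (R : realType) (T : topologicalType).
Notation plane := (R * R)%type.
Implicit Types (f finv : T -> T) (e io : plane -> T) (w : R -> T) (a mu la : R).

Record is_line f finv (p : T) w la : Prop := IsLine {
  il_cw : continuous w;
  il_iw : injective w;
  il_0 : w 0 = p;
  il_la0 : 0 < la;
  il_la1 : la < 1;
  il_f : forall s, f (w s) = w (la * s);
  il_finv : forall s, finv (w s) = w (s / la);
  il_ex : forall x, (fun k => iter k f x) @ \oo --> p -> exists s, x = w s }.

Lemma line_ex f finv p io a mu la : surface R T -> continuous finv ->
  cancel f finv -> cancel finv f -> lin_saddle f p io a mu la ->
  exists w, is_line f finv p w la /\ forall s, `|s| <= a -> w s = io (0, s).
Proof.
move=> sT cfinv fK finvK L; have [w [cw iw wio fw ex]] := stable_line sT cfinv fK finvK L.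
exists w; split=> //; split=> //.
- by rewrite wio ?normr0 ?(ltW (ls_a L))// -(ls_p L).
- exact: ls_la0 L.
- exact: ls_la1 L.
- by move=> s; have [] := fw s.
- by move=> s; have [] := fw s.
Qed.

Lemma line_reflect f finv p w la (t : R) : `|t| = 1 -> is_line f finv p w la ->
  is_line f finv p (fun s => w (t * s)) la.
Proof.
move=> t1 [cw iw w0 l0 l1 fw finvw ex].
have tt : t * t = 1 by rewrite -expr2 -real_normK ?num_real// t1 expr1n.
split=> //.
- apply: contin_setT; apply: (contin_comp (B := setT)) (contin_continuous cw) _ => //.
  by apply: continM; [exact: contin_cst|exact: contin_id].
- by move=> s s' /iw /(congr1 (fun r => t * r)); rewrite !mulrA tt !mul1r.
- by rewrite mulr0.
- by move=> s; rewrite fw mulrCA.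
- by move=> s; rewrite finvw mulrA.
- by move=> x /ex[s ->]; exists (t * s); rewrite mulrA tt mul1r.
Qed.

Lemma arc_dichotomy f finv p p' w la (J : set T) : hausdorff_space T -> continuous finv ->
  is_line f finv p w la -> is_arc R J p p' ->
  (forall x, J x -> (fun k => iter k f x) @ \oo --> p) ->
  (exists s1, [/\ s1 != 0, p' = w s1 & J = (fun t => w (t * s1)) @` seg 0 1]) \/
  [/\ forall x, J x -> J (finv x), ~ J (f p') &
      forall x, J x -> (fun k => iter k finv x) @ \oo --> p].
Proof.
move=> hT cfinv [cw iw w0 l0 l1 fw finvw ex] [g [cg ig g0 g1 JE]] Jp.
have cg' : contin (seg 0 1) g by apply/continP.
have ig' : {in seg 0 1 &, injective g} by move=> s t; rewrite !inE; exact: ig.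
have gw t : seg 0 1 t -> exists s, g t = w s.
  by move=> ht; apply: ex; apply: Jp; rewrite JE; exists t.
have [[s1 [s10 g1w H]]|[H1 H2 H3]] := arc_on_line hT cfinv cw iw l0 l1 w0 fw finvw cg' ig' g0 gw.
  by left; exists s1; split=> //; [rewrite -g1|rewrite JE; apply/seteqP; split=> x /H].
by right; rewrite JE; split=> //; rewrite -g1.
Qed.

Lemma arc_ends (J : set T) x y : is_arc R J x y -> J x /\ J y.
Proof.
by move=> [g [_ _ <- <- ->]]; split; [exists 0|exists 1] => //; rewrite /= ?lexx ler01.
Qed.

(* If [Js] returns towards [p] under [finv] and [Ju] under [f], then [Ju] is an arc of the stable
   line and [Js] one of the unstable line. *)
Lemma homoclinic_arcs f finv p w w2 la la2 (V : set T) : surface R T ->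
  continuous f -> continuous finv -> cancel f finv -> cancel finv f -> f p = p ->
  is_line f finv p w la -> is_line finv f p w2 la2 -> homoclinic_cell R f finv p V ->
  exists e s1 x1, [/\ is_cell e, cell_int e = V, s1 != 0, x1 != 0 &
    [/\ cell_bd e = ((fun t => w (t * s1)) @` seg 0 1) `|` ((fun t => w2 (t * x1)) @` seg 0 1),
       w s1 = w2 x1 & forall t t', seg 0 1 t -> seg 0 1 t' -> w (t * s1) = w2 (t' * x1) ->
         w (t * s1) = p \/ w (t * s1) = w s1]].
Proof.
move=> sT cf cfinv fK finvK fp Wl W2l [e [ce ie VE [p' [Js [Ju [pp' [_ [_ [Jsp [Jup [aS [aU [JJ eJ]]]]]]]]]]]]].
have hT := sT.1.
have diskE : @closed_disk R = disk 1 by rewrite /closed_disk /disk /sq expr1n.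
have circE : @unit_circle R = circle 1 by rewrite /unit_circle /circle /sq expr1n.
rewrite diskE in ce ie VE; rewrite circE in VE eJ.
have cell_e : is_cell e.
  by split; [apply/continP|move=> u v; rewrite !inE; exact: ie].
have intE : cell_int e = V.
  rewrite VE; apply/seteqP; split=> y.
    move=> Vy; split; first by apply/cell_split; left.
    exact: cell_disjoint cell_e Vy.
  by move=> [/cell_split[]].
have Jsc x : Js x -> (fun k => iter k f x) @ \oo --> p by move=> /Jsp /connected_component_sub.
have Juc x : Ju x -> (fun k => iter k finv x) @ \oo --> p by move=> /Jup /connected_component_sub.
have [Js_p Js_p'] := arc_ends aS; have [Ju_p Ju_p'] := arc_ends aU.
have finvp : finv p = p by rewrite -{1}fp fK.
have concl J1 J2 s1 x1 : J1 `|` J2 = Js `|` Ju -> J1 `&` J2 = [set p; p'] ->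
    s1 != 0 -> p' = w s1 -> J1 = (fun t => w (t * s1)) @` seg 0 1 ->
    x1 != 0 -> p' = w2 x1 -> J2 = (fun t => w2 (t * x1)) @` seg 0 1 ->
  exists e s1 x1, [/\ is_cell e, cell_int e = V, s1 != 0, x1 != 0 &
    [/\ cell_bd e = ((fun t => w (t * s1)) @` seg 0 1) `|` ((fun t => w2 (t * x1)) @` seg 0 1),
       w s1 = w2 x1 & forall t t', seg 0 1 t -> seg 0 1 t' -> w (t * s1) = w2 (t' * x1) ->
         w (t * s1) = p \/ w (t * s1) = w s1]].
  move=> JU JI s10 p's J1E x10 p'x J2E; exists e, s1, x1; split=> //; split.
  - by rewrite -J1E -J2E JU -eJ.
  - by rewrite -p's.
  - move=> t t' ht ht' E.
    have : (J1 `&` J2) (w (t * s1)).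
      by split; [rewrite J1E; exists t|rewrite J2E E; exists t'].
    by rewrite JI p's.
have [[s1 [s10 p's JsE]]|[s_inv s_out s_conv]] := arc_dichotomy hT cfinv Wl aS Jsc.
  have [[x1 [x10 p'x JuE]]|[u_inv u_out u_conv]] := arc_dichotomy hT cf W2l aU Juc.
    exact: (concl Js Ju s1 x1).
  (* Mixed case: [f p'] lies on both arcs but is neither [p] nor [p']. The opposite mixed case below
     uses [finv p']. *)
  exfalso; have : (Js `&` Ju) (f p').
    split; last exact: u_inv.
    rewrite p's (il_f Wl) JsE; exists la => //.
    by rewrite /seg /= (ltW (il_la0 Wl)) (ltW (il_la1 Wl)).
  rewrite JJ => -[E|E].
    by apply: pp'; rewrite -[p']fK E.
  move: E; rewrite /= p's (il_f Wl) => /(il_iw Wl) /eqP.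
  rewrite -subr_eq0 -{2}(mul1r s1) -mulrBl mulf_eq0 (negbTE s10) orbF subr_eq0 => /eqP E.
  by have := il_la1 Wl; rewrite E ltxx.
have [[x1 [x10 p'x JuE]]|[u_inv u_out u_conv]] := arc_dichotomy hT cf W2l aU Juc.
  exfalso; have : (Js `&` Ju) (finv p').
    split; first exact: s_inv.
    rewrite p'x (il_f W2l) JuE; exists la2 => //.
    by rewrite /seg /= (ltW (il_la0 W2l)) (ltW (il_la1 W2l)).
  rewrite JJ => -[E|E].
    by apply: pp'; rewrite -[p']finvK E.
  move: E; rewrite /= p'x (il_f W2l) => /(il_iw W2l) /eqP.
  rewrite -subr_eq0 -{2}(mul1r x1) -mulrBl mulf_eq0 (negbTE x10) orbF subr_eq0 => /eqP E.
  by have := il_la1 W2l; rewrite E ltxx.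
(* Now points of [Ju] are also attracted to [p] by [f] and those of [Js] by [finv], so each
   dichotomy can be applied to the other line; a second escape contradicts that [f p'] is not in
   [Ju], respectively [finv p'] not in [Js]. *)
have [[s1 [s10 p's JuE]]|[h _ _]] := arc_dichotomy hT cfinv Wl aU u_conv; last first.
  by case: u_out; exact: h.
have [[x1 [x10 p'x JsE]]|[h _ _]] := arc_dichotomy hT cf W2l aS s_conv; last first.
  by case: s_out; exact: h.
by apply: (concl Ju Js s1 x1) => //; [rewrite setUC|rewrite setIC].
Qed.

Lemma seg_rescale (u s1 s : R) : 0 < s1 -> 0 < u -> seg 0 (s1 * u) s ->
  seg 0 1 (s / (s1 * u)) /\ s = s / (s1 * u) * s1 * u.
Proof.
move=> s10 u0 /andP[h1 h2]; have p0 : 0 < s1 * u by rewrite mulr_gt0.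
split; last by rewrite -mulrA divfK// gt_eqF.
by rewrite /seg /= divr_ge0 ?(ltW p0)//= ler_pdivrMr// mul1r.
Qed.

(** Two normalizations: reflections make both arms positive, and [finv^K] contracts the unstable arm
    into the linear box. The cell becomes the preimage of [V] by [f^K]. *)
Lemma homoclinic_arms f finv p (V : set T) : surface R T ->
  continuous f -> continuous finv -> cancel f finv -> cancel finv f ->
  direct_saddle R f p -> homoclinic_cell R f finv p V ->
  exists io a mu la w e s1 x1 K, [/\ arms f p io a mu la w e s1 x1,
    forall s, f (w s) = w (la * s), mu * x1 <= a, w s1 = io (x1, 0) &
    forall y, cell_int e y <-> V (iter K f y)].
Proof.
move=> sT cf cfinv fK finvK ds hc.
have [io [a [mu [la L]]]] := direct_saddle_lin ds.
have a0 := ls_a L; have mu1 := ls_mu L; have la0 := ls_la0 L; have la1 := ls_la1 L.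
have mu0 : 0 < mu by exact: lt_trans ltr01 mu1.
have [w [Wl wio]] := line_ex sT cfinv fK finvK L.
have [w2 [W2l w2io]] := line_ex sT cf finvK fK (lin_saddle_dual fK L).
have [e0 [s1 [x1 [[ce ie] eV s10 x10 [eB sx JJ]]]]] := homoclinic_arcs sT cf cfinv fK finvK ds.1 Wl W2l hc.
have sg1 (t : R) : t != 0 -> `|Num.sg t| = 1 by move=> t0; rewrite normr_sg t0.
(* The unstable line [w2] agrees with the horizontal axis only up to [la * a], the radius of the
   dual saddle. *)
pose a' := la * a.
have a'0 : 0 < a' by rewrite mulr_gt0.
have a'a : a' <= a by rewrite /a' ler_piMl// ltW.
have L' := lin_saddle_reflect (sg1 _ x10) (sg1 _ s10) (lin_saddle_shrink a'0 a'a L).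
have Wl' := line_reflect (sg1 _ s10) Wl; have W2l' := line_reflect (sg1 _ x10) W2l.
pose w' s := w (Num.sg s1 * s); pose w2' x := w2 (Num.sg x1 * x).
pose io' (z : plane) := io (Num.sg x1 * z.1, Num.sg s1 * z.2).
have wio' s : `|s| <= a' -> w' s = io' (0, s).
  by move=> h; rewrite /w' wio ?normrM ?sg1 ?mul1r ?(le_trans h)// /io' mulr0.
have w2io' x : `|x| <= a' -> w2' x = io' (x, 0).
  by move=> h; rewrite /w2' w2io ?normrM ?sg1 ?mul1r// /io' /= mulr0.
have S0 : 0 < `|s1| by rewrite normr_gt0.
have X0 : 0 < `|x1| by rewrite normr_gt0.
have ws1 t : w (t * s1) = w' (t * `|s1|) by rewrite /w' mulrCA -numEsg.
have wx1 t : w2 (t * x1) = w2' (t * `|x1|) by rewrite /w2' mulrCA -numEsg.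
(* [finv] contracts the unstable line by [mu^-1]; after [K] steps even the image of the arm by [f]
   fits in the chart. *)
have [K KE] : exists K, mu^-1 ^+ K < a' / (mu * `|x1|).
  apply: pow_small; rewrite ?invr_ge0 ?(ltW mu0) ?invf_lt1//.
  by rewrite divr_gt0// mulr_gt0.
have uE1 s : iter K finv (w' s) = w' (s * la^-1 ^+ K).
  by rewrite (iter_finv_line (il_finv Wl')) exprVn.
have f2 x : finv (w2' x) = w2' (mu^-1 * x) := il_f W2l' x.
have uE2 x : iter K finv (w2' x) = w2' (x * mu^-1 ^+ K).
  elim: (K) => [|k IH]; first by rewrite expr0 mulr1.
  by rewrite iterS IH f2 exprS mulrCA.
have [u1 u1E] : exists u1, u1 = la^-1 ^+ K by eexists.
have [u2 u2E] : exists u2, u2 = mu^-1 ^+ K by eexists.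
have u10 : 0 < u1 by rewrite u1E exprn_gt0// invr_gt0.
have u20 : 0 < u2 by rewrite u2E exprn_gt0// invr_gt0.
rewrite -u2E in uE2 KE; rewrite -u1E in uE1.
have x1a : mu * (`|x1| * u2) <= a'.
  by rewrite mulrA [_ * u2]mulrC -ler_pdivlMr ?mulr_gt0// ltW.
have x1a' : `|x1| * u2 <= a'.
  by apply: le_trans x1a; rewrite ler_peMl ?(ltW mu1)// mulr_ge0// ltW.
have iterK : cancel (iter K f) (iter K finv).
  by move=> y; elim: (K) => [//|k IH]; rewrite iterSr iterS fK.
have iterVK : cancel (iter K finv) (iter K f).
  by move=> y; elim: (K) => [//|k IH]; rewrite iterSr iterS finvK.
have sx' : w' `|s1| = w2' `|x1| by rewrite -[`|s1|]mul1r -[`|x1|]mul1r -ws1 -wx1 !mul1r.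
pose e z := iter K finv (e0 z).
exists io', a', mu, la, w', e, (`|s1| * u1), (`|x1| * u2), K; split=> //.
- split=> //.
  + exact: il_cw Wl'.
  + exact: il_iw Wl'.
  + split.
      exact: (contin_comp (B := setT) ce (contin_continuous (@iter_continuous T finv K cfinv))).
    by move=> u v hu hv /(can_inj iterVK); exact: ie.
  + by rewrite mulr_gt0.
  + by rewrite mulr_gt0.
  + apply/seteqP; split=> y.
      move=> [z cz <-]; have : cell_bd e0 (e0 z) by exists z.
      rewrite eB => -[[t ht]|[t ht]] E; rewrite /e -E; [left|right].
        exists (t * `|s1| * u1); last by rewrite ws1 uE1.
        case/andP: ht => t0 t1; rewrite /seg /= !mulr_ge0 ?(ltW u10)//= -mulrA.
        by rewrite ler_piMl// mulr_ge0// ltW.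
      have ht' : seg 0 (`|x1| * u2) (t * `|x1| * u2).
        case/andP: ht => t0 t1; rewrite /seg /= !mulr_ge0 ?(ltW u20)//= -mulrA.
        by rewrite ler_piMl// mulr_ge0// ltW.
      exists (t * `|x1| * u2) => //; rewrite wx1 uE2 w2io'//.
      by case/andP: ht' => h1 h2; rewrite ger0_norm//; exact: le_trans x1a'.
    have lift t t' : (seg 0 1 t /\ y = w' (t * `|s1| * u1)) \/
        (seg 0 1 t' /\ y = w2' (t' * `|x1| * u2)) -> cell_bd e y.
      move=> H; have [z cz zE] : cell_bd e0 (iter K f y).
        rewrite eB; case: H => -[ht ->]; [left|right].
          by exists t => //; rewrite -uE1 iterVK -ws1.
        by exists t' => //; rewrite -uE2 iterVK -wx1.
      by exists z => //; rewrite /e zE iterK.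
    move=> [[s hs sE]|[x hx xE]].
      have [h1 h2] := seg_rescale S0 u10 hs; apply: (lift (s / (`|s1| * u1)) 0); left.
      by rewrite -h2 sE.
    have [h1 h2] := seg_rescale X0 u20 hx; apply: (lift 0 (x / (`|x1| * u2))); right.
    rewrite -h2 -xE w2io'//; case/andP: hx => k1 k2; rewrite ger0_norm//.
    exact: le_trans x1a'.
  + move=> s x hs hx.
    have hxa : `|x| <= a' by case/andP: hx => k1 k2; rewrite ger0_norm//; exact: le_trans x1a'.
    rewrite -w2io'//.
    have [h1 h2] := seg_rescale S0 u10 hs; have [k1 k2] := seg_rescale X0 u20 hx.
    rewrite {1}h2 {1}k2 -uE1 -uE2 => /(can_inj iterVK) E.
    rewrite -ws1 -wx1 in E; case: (JJ _ _ h1 k1 E); rewrite E wx1.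
      rewrite -(il_0 W2l') => /(il_iw W2l') h.
      by left; rewrite k2 h mul0r.
    rewrite -[s1]mul1r ws1 mul1r sx' => /(il_iw W2l') h.
    by right; rewrite k2 h.
- by move=> s; exact: (il_f Wl').
- by rewrite -uE1 sx' uE2 w2io'// ger0_norm// mulr_ge0// ltW.
- move=> y; rewrite -eV; split=> -[v ov].
    by move=> <-; exists v => //; rewrite /e iterVK.
  by move=> E; exists v => //; rewrite /e E iterK.
Qed.

End Loops.

(** * Orientation *)

Section Quotient.

(** A continuous map from a compact set onto a subset of a Hausdorff space is a quotient map. It
    lets functions descend from a segment to the circle. *)
Lemma contin_quotient (X Y Z : topologicalType) (K : set X) (k : X -> Y) (g : Y -> Z) :
  hausdorff_space Y -> compact K -> contin K k -> contin K (fun x => g (k x)) ->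
  contin (k @` K) g.
Proof.
move=> hY cK ck cg y Ky W /nbhs_interior nW.
have nW' : nbhs (g y) (W^°) by exact: nW.
pose C := K `&` (fun x => ~ (W^° (g (k x)))).
have cC : compact (k @` C).
  apply: contin_image_compact; first by apply: contin_sub ck => x [].
  move=> F FF FC; have FK : F K by apply: filterS FC => x [].
  have [x [Kx Fx]] := cK F FF FK; exists x; split=> //; split=> // Wx.
  have H : nbhs x [set t | K t -> W^° (g (k t))].
    have nk : nbhs (g (k x)) (W^°) by apply: open_nbhs_nbhs; split=> //; exact: open_interior.
    exact: (cg _ Kx _ nk).
  by have [t [[Kt Ct] /(_ Kt)]] := Fx _ _ FC H.
have nC : nbhs y (~` (k @` C)).
  apply: open_nbhs_nbhs; split; first by rewrite openC; exact: compact_closed.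
  by move=> [x [Kx Cx] kx]; apply: Cx; rewrite kx; exact: nbhs_singleton nW'.
apply: filterS nC => t nCt [x Kx kx]; apply: contrapT => nWt.
apply: nCt; exists x => //; split=> // Wx; apply: nWt; rewrite -kx.
exact: (interior_subset Wx).
Qed.

End Quotient.

Section Orientation.
Variables (R : realType) (T : topologicalType).
Notation plane := (R * R)%type.
Implicit Types (f finv : T -> T) (e io : plane -> T) (w : R -> T) (a mu la : R).

Lemma cos2pi_eq1 (s : R) : 0 <= s <= 1 -> cos (2 * pi * s) = 1 -> s = 0 \/ s = 1.
Proof.
move=> /andP[s0 s1] c1; have p0 := pi_gt0 R.
have : sin (pi * s) = 0.
  have E : cos (2 * pi * s) = 1 - (sin (pi * s) ^+ 2) *+ 2.
    by rewrite -mulrA mulr_natl cos_mulr2n cos2sin2; ring.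
  apply/eqP; rewrite -sqrf_eq0; apply/eqP; move: E; rewrite c1 mulr2n => E; lra.
have [->|sn0] := eqVneq s 0; first by left.
have [->|sn1] := eqVneq s 1; first by right.
have h : 0 < sin (pi * s).
  have s0' : 0 < s by rewrite lt_neqAle eq_sym sn0.
  have s1' : s < 1 by rewrite lt_neqAle sn1.
  by apply: sin_gt0_pi; rewrite mulr_gt0//= gtr_pMr.
by move=> E; rewrite E ltxx in h.
Qed.

Lemma crc_inj r (t t' : R) : 0 < r -> 0 <= t -> t <= t' -> t' <= 1 -> crc r t = crc r t' ->
  t = t' \/ (t = 0 /\ t' = 1).
Proof.
move=> r0 t0 tt t1 [/(mulfI (lt0r_neq0 r0)) E1 /(mulfI (lt0r_neq0 r0)) E2].
have c1 : cos (2 * pi * (t' - t)) = 1.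
  by rewrite mulrBr cosB E1 E2 -!expr2 cos2Dsin2.
have hs : 0 <= t' - t <= 1 by rewrite subr_ge0 tt /= lerBlDr; move: t0 t1; clear; lra.
case: (cos2pi_eq1 hs c1) => h; first by left; apply/esym/eqP; rewrite -subr_eq0 h.
by right; move: t0 t1 h; clear; move=> *; split; lra.
Qed.

(** For winding number 1 the function [th t - 2 pi t] takes equal values at 0 and 1, so it descends
    to the circle, as an argument of [g (z + v) - g z] divided by [v]. *)
Lemma winds_nul (g : plane -> plane) (z : plane) r : 0 < r ->
  winds (fun t => g (circ z r t)) (g z) 1 ->
  nul (circle r) (fun v => cm (g (z + v) - g z) (cj v)).
Proof.
move=> r0 [gz [th [cth thE th1]]].
pose al (t : R) := th t - 2 * pi * t.
have al01 : al 0 = al 1 by rewrite /al mulr0 mulr1; move: th1; rewrite mulr1; lra.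
have sel v : exists t, circle r v -> seg 0 1 t /\ crc r t = v.
  have [/(crc_surj r0)[t ht E]|n] := pselect (circle r v); last by exists 0 => /n.
  by exists t.
have [sl slE] := choice sel.
have alE t : seg 0 1 t -> al (sl (crc r t)) = al t.
  move=> ht; have [hs E] := slE _ (crc_circle r t).
  move: (sl _) hs E => s /andP[s0 s1] E; case/andP: ht => t0 t1.
  have [st|/ltW ts] := leP s t.
    by have [->//|[-> ->]] := crc_inj r0 s0 st t1 E.
  by have [->//|[-> ->]] := crc_inj r0 t0 ts s1 (esym E).
have circE : circle r = crc r @` seg 0 1.
  apply/seteqP; split=> [v cv|v [t _ <-]]; last exact: crc_circle.
  by have [t ht E] := crc_surj r0 cv; exists t.
exists (fun v => al (sl v)).
  rewrite circE; apply: contin_quotient.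
  - exact: plane_hausdorff.
  - exact: compact_seg.
  - exact: contin_crc.
  - apply: (contin_eq (f := al)); first by move=> t; rewrite inE => /alE ->.
    apply: continB; first exact/continP.
    by apply: continM; [exact: contin_cst|exact: contin_id].
move=> v cv; have [t ht <-] := crc_surj r0 cv; rewrite alE//.
have [E1 E2] := thE t ht; have gn := gz t ht.
have Ez : z + crc r t = circ z r t by [].
rewrite Ez; set d := g _ - g z.
have d0 : d <> 0 by move/eqP; rewrite subr_eq0 => /eqP.
have s0 := sq_gt0 d0.
exists (Num.sqrt (sq d) * r); first by rewrite mulr_gt0// sqrtr_gt0.
have D1 : d.1 = Num.sqrt (sq d) * cos (th t) by exact: E1.
have D2 : d.2 = Num.sqrt (sq d) * sin (th t) by exact: E2.
clearbody d; rewrite /al /cis cosB sinB; apply: pairE; rewrite /cm /cj /sc /crc /= D1 D2;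
  move: (Num.sqrt _) (cos (th t)) (sin (th t)) (cos (2 * pi * t)) (sin (2 * pi * t)); clear; move=> *; ring.
Qed.

(* A loop of the punctured disk is pushed radially onto the circle. *)
Lemma radial_nul (be u : plane -> plane) (r0 r : R) : 0 < r0 -> 0 <= r -> contin (disk r0) be ->
  (forall v, disk r0 v -> v <> 0 -> be v <> 0) -> nul (circle r0) be ->
  contin (circle r) u -> (forall v, circle r v -> u v <> 0) ->
  (forall v, circle r v -> disk r0 (u v)) -> nul (circle r) (fun v => be (u v)).
Proof.
move=> r00 rge cbe be0 nbe cu u0 du.
pose m v := Num.sqrt (sq (u v)).
have m0 v : circle r v -> 0 < m v by move=> /u0/sq_gt0; rewrite /m sqrtr_gt0.
have m2 v : sq (u v) = m v ^+ 2 by rewrite /m sqr_sqrtr// sq_ge0.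
have mr v : circle r v -> m v <= r0.
  move=> cv; rewrite -(@ler_pXn2r _ 2)// ?nnegrE ?(ltW r00) ?(ltW (m0 _ cv))// -m2.
  exact: du.
pose k (q : plane * R) := (1 - q.2) + q.2 * (r0 / m q.1).
have kE q : cyl (circle r) q -> k q * m q.1 = (1 - q.2) * m q.1 + q.2 * r0.
  by move=> [cq _]; rewrite /k mulrDl -mulrA divfK// gt_eqF// m0.
have kp q : cyl (circle r) q -> 0 < k q /\ k q * m q.1 <= r0.
  move=> cq; have E := kE q cq; have [cv /andP[q0 q1]] := cq.
  have h1 := m0 _ cv; have h2 := mr _ cv.
  split; last by rewrite E; move: h2 q0 q1 h1; clear; nra.
  rewrite -(pmulr_lgt0 _ h1) E; move: h1 r00 q0 q1; clear; move=> *.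
  by rewrite -(subrK (m q.1) r0); nra.
pose H (q : plane * R) := be (sc (k q) (u q.1)).
have Hd q : cyl (circle r) q -> disk r0 (sc (k q) (u q.1)).
  move=> cq; have [k0 k1] := kp q cq; rewrite /disk /= sq_sc m2 -exprMn.
  by rewrite ler_pXn2r ?nnegrE ?mulr_ge0 ?(ltW k0) ?(ltW r00) ?(ltW (m0 _ cq.1)).
have cm' : contin (circle r) m.
  by apply: (continc (f := fun v => sq (u v))); [exact: contin_sqn|exact: sqrt_continuous].
have ck : contin (cyl (circle r)) k.
  apply: continD.
    by apply: continB; [exact: contin_cst|exact: contin_idsnd].
  apply: continM; first exact: contin_idsnd.
  apply: continM; first exact: contin_cst.
  apply: continV; first exact: contin_cyl.
  by move=> q [/m0 h _]; rewrite gt_eqF.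
have cH : contin (cyl (circle r)) H.
  apply: (contin_comp (f := fun q => sc (k q) (u q.1)) _ cbe) => //.
  by apply: contin_sc => //; exact: contin_cyl.
have Hn q : cyl (circle r) q -> H q <> 0.
  move=> cq; apply: be0; first exact: Hd.
  by apply: sc_neq0; [rewrite gt_eqF//; exact: (kp q cq).1|apply: u0; exact: cq.1].
have S := homotopy_sim (compact_circle rge) cH Hn.
apply: (nul_ext (v := fun v => H (v, 0))); last first.
  by move=> v _; rewrite /H /k /= subr0 mul0r addr0 sc_id.
apply: (sim_nul S).
apply: (nul_comp (g := fun v => sc (k (v, 1)) (u v)) _ _ nbe).
  apply: contin_sc => //; apply: (contin_comp _ ck) => [|v cv].
    by apply: contin_pair; [exact: contin_id|exact: contin_cst].
  by split=> //=; rewrite ler01 lexx.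
move=> v cv; have cq : cyl (circle r) (v, 1 : R) by split=> //=; rewrite ler01 lexx.
by rewrite /circle /= sq_sc m2 -exprMn kE//= subrr mul0r add0r mul1r.
Qed.

End Orientation.

(** * Orientation and saddles with multipliers of either sign *)

Section Signed.
Variables (R : realType) (T : topologicalType).
Notation plane := (R * R)%type.
Implicit Types (f finv F : T -> T) (ka k : plane -> T) (mu la : R).

(** Local degree +1 makes [(G (z + v) - G z) cj(v)] null on a round circle; [radial_nul] passes from
    that circle to the loop traced by [k]. So one application of [f] does not change the homotopy
    class of the loop read in charts of the atlas. *)
Lemma orient_step (A : set (chart R T)) f c c' k (b : R) x : continuous f -> injective f ->
  orient_pres A f -> A c -> A c' -> is_chart c -> is_chart c' -> ch_dom c x -> ch_dom c' (f x) ->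
  0 < b -> contin (box b) k -> {in box b &, injective k} -> k 0 = x ->
  exists2 r0, 0 < r0 & forall r, 0 < r <= r0 ->
    sim (circle r) (fun v => ch_map c' (f (k v)) - ch_map c' (f x))
                   (fun v => ch_map c (k v) - ch_map c x).
Proof.
move=> cf jf oA Ac Ac' ic ic' dx dfx b0 ck ik k0.
pose D := ch_map c @` (ch_dom c `&` f @^-1` ch_dom c').
pose G z := ch_map c' (f (ch_inv c z)).
have oc : open (ch_dom c) by case: ic.
have oc' : open (ch_dom c') by case: ic'.
have invc y : ch_dom c y -> ch_inv c (ch_map c y) = y by move=> dy; case: ic => _ [H _]; case: (H y dy).
have imgc y : ch_dom c y -> ch_img c (ch_map c y) by move=> dy; case: ic => _ [H _]; case: (H y dy).
have ck0 : forall U, nbhs x U -> nbhs (0 : plane) [set v | box b v -> U (k v)].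
  by rewrite -k0 => U nU; exact: (ck _ (box0 (ltW b0)) _ nU).
pose N := [set v | [/\ box b v, ch_dom c (k v) & ch_dom c' (f (k v))]].
have nN : nbhs (0 : plane) N.
  have h1 := ck0 _ (open_nbhs_nbhs (conj oc dx)).
  have h2 := ck0 [set y | ch_dom c' (f y)] (cf x _ (open_nbhs_nbhs (conj oc' dfx))).
  by apply: filterS3 (box_nbhs b0) h1 h2 => v bv /(_ bv) d1 /(_ bv) d2.
have cN : contin N k by apply: contin_sub ck => v [].
pose phi v := ch_map c (k v).
have cphi : contin N phi by apply: (contin_comp cN (chart_contin ic)) => v [].
have iphi : {in N &, injective phi}.
  move=> u v; rewrite !inE => -[b1 d1 _] [b2 d2 _] /(chart_inj ic d1 d2) E.
  by apply: ik; rewrite ?inE.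
have phi0 : phi 0 = ch_map c x by rewrite /phi k0.
have nD : nbhs (ch_map c x) D.
  rewrite -phi0; apply: filterS (invariance_of_domain nN cphi iphi) => _ [v [_ d1 d2] <-].
  by exists (k v).
have intD : interior_in D (ch_map c x).
  by move/nbhs_ballP: nD => [e /= e0 eD]; exists e.
have [e [e0 eD wE]] := oA c c' x Ac Ac' dx dfx intD.
have cG : contin D G.
  apply: (contin_comp (f := fun z => f (ch_inv c z)) _ (chart_contin ic')).
    apply: (contin_comp (B := setT) _ (contin_continuous cf)) => //.
    by apply: contin_sub (chart_inv_contin ic) => _ [y [dy _] <-]; exact: imgc.
  by move=> _ [y [dy dfy] <-]; rewrite invc.
have GE y : ch_dom c y -> G (ch_map c y) = ch_map c' (f y) by move=> dy; rewrite /G invc.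
have iG z z' : D z -> D z' -> G z = G z' -> z = z'.
  move=> [y [dy dfy] <-] [y' [dy' dfy'] <-]; rewrite !GE// => /(chart_inj ic' dfy dfy') /jf ->.
  by [].
have [r1 r10 r1D] := (nbhs_diskP _ _).1 nD.
pose r0 := Num.min r1 (e / 2).
have r00 : 0 < r0 by rewrite lt_min r10 divr_gt0.
have r0e : r0 < e.
  by apply: (@le_lt_trans _ _ (e / 2)); [rewrite ge_min lexx orbT|rewrite ltr_pdivrMr// ltr_pMr// ltr1n].
have r0D v : disk r0 v -> D (ch_map c x + v).
  move=> dv; apply: r1D; rewrite /disk /=; apply: le_trans dv _.
  by rewrite ler_pXn2r ?nnegrE ?(ltW r00) ?(ltW r10)// ge_min lexx.
pose be v := cm (G (ch_map c x + v) - G (ch_map c x)) (cj v).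
have nbe : nul (circle r0) be by apply: winds_nul => //; apply: wE; rewrite r00.
have cbe : contin (disk r0) be.
  apply: contin_cm; last by apply: contin_cj; exact: contin_id.
  apply: contin_subp; last exact: contin_cst.
  apply: (contin_comp (f := fun v => ch_map c x + v) _ cG) => //.
  by apply: contin_addp; [exact: contin_cst|exact: contin_id].
have d00 : disk r0 (0 : plane) by rewrite /disk /sq /= expr0n /= addr0 sqr_ge0.
have be0 v : disk r0 v -> v <> 0 -> be v <> 0.
  move=> dv v0; apply: cm_neq0; last exact: cj_neq0.
  move/eqP; rewrite subr_eq0 => /eqP E; apply: v0.
  have Dx : D (ch_map c x) by have := r0D 0 d00; rewrite addr0.
  have := iG _ _ (r0D v dv) Dx E.
  by rewrite -{2}(addr0 (ch_map c x)) => /addrI.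
pose u v := phi v - ch_map c x.
have N0 : N 0 by exact: nbhs_singleton nN.
have nu : \forall v \near (0 : plane), disk r0 (u v).
  have W : nbhs (phi 0) [set z | disk r0 (z - ch_map c x)].
    apply/nbhs_diskP; exists r0 => // v dv.
    by rewrite /= -phi0 addrAC subrr add0r.
  have H : nbhs (0 : plane) [set v | N v -> disk r0 (phi v - ch_map c x)] := cphi _ N0 _ W.
  by apply: filterS2 nN H => v Nv /(_ Nv).
have [r2 r20 r2E] := (near_diskP _).1 (filterI nN nu).
exists r2 => // r /andP[rp rr2].
have dr v : circle r v -> disk r2 v.
  rewrite /circle /disk /= => ->; rewrite ler_pXn2r ?nnegrE ?(ltW rp)//; exact: (ltW r20).
have rn := @radial_nul R be u r0 r r00 (ltW rp) cbe be0 nbe.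
apply: (nul_ext (v := fun v => be (u v))); last first.
  move=> v /dr /r2E[[_ d1 d2] _]; rewrite /be /u /phi addrCA subrr addr0 !GE//.
apply: rn.
- apply: contin_subp; last exact: contin_cst.
  by apply: contin_sub cphi => v /dr /r2E[].
- move=> v cv /eqP; rewrite subr_eq0 -phi0 => /eqP E.
  have v0 : v = 0 by apply: iphi => //; rewrite inE//; exact: (r2E _ (dr _ cv)).1.
  move: cv; rewrite v0 /circle /sq /= expr0n /= addr0 => /eqP.
  by rewrite eq_sym expf_eq0 /= gt_eqF.
- by move=> v /dr /r2E[].
Qed.

Record signed_saddle F (q : T) ka (r mu la : R) : Prop := SignedSaddle {
  ss_r : 0 < r;
  ss_mu : 1 < `|mu|;
  ss_la0 : 0 < `|la|;
  ss_la1 : `|la| < 1;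
  ss_q : ka 0 = q;
  ss_c : contin (box (`|mu| * r)) ka;
  ss_i : {in box (`|mu| * r) &, injective ka};
  ss_F : forall v, box r v -> F (ka v) = ka (mu * v.1, la * v.2) }.

Lemma box_diag (r mu la : R) (v : plane) : 1 <= `|mu| -> `|la| <= 1 -> box r v ->
  box (`|mu| * r) ((mu * v.1, la * v.2) : plane).
Proof.
move=> mu1 la1 [v1 v2]; split; rewrite /= normrM; first by rewrite ler_wpM2l.
have := normr_ge0 v.2; have := normr_ge0 la; move: v2 mu1 la1; clear; move=> *; nra.
Qed.

(** The radius is divided by [|mu|^m] so that the intermediate iterates stay in [box r]. *)
Lemma signed_iter F q ka r mu la m : signed_saddle F q ka r mu la -> (0 < m)%N ->
  signed_saddle (iter m F) q ka (r / `|mu| ^+ m) (mu ^+ m) (la ^+ m).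
Proof.
move=> [r0 mu1 la0 la1 kq kc ki kF] m0; have mu0 : 0 < `|mu| by exact: lt_trans ltr01 mu1.
have mp j : 0 < `|mu| ^+ j by rewrite exprn_gt0.
have rE : `|mu ^+ m| * (r / `|mu| ^+ m) = r by rewrite normrX mulrC divfK// gt_eqF.
have sub : box (`|mu ^+ m| * (r / `|mu| ^+ m)) `<=` (box (`|mu| * r) : set plane).
  by apply: box_le; rewrite rE ler_peMl// ltW.
split=> //.
- by rewrite divr_gt0.
- by rewrite normrX exprn_egt1// -lt0n.
- by rewrite normrX exprn_gt0.
- by rewrite normrX exprn_ilt1// -lt0n.
- exact: contin_sub sub kc.
- by move=> u v; rewrite !inE => /sub hu /sub hv; apply: ki; rewrite inE.
move=> v bv; suff H j : (j <= m)%N -> iter j F (ka v) = ka (mu ^+ j * v.1, la ^+ j * v.2) by exact: H.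
elim: j => [|j IH] jm; first by rewrite !expr0 !mul1r -surjective_pairing.
rewrite iterS IH ?(ltnW jm)// kF /=; first by rewrite !exprS !mulrA.
have bj : box (`|mu ^+ j| * (r / `|mu| ^+ m)) ((mu ^+ j * v.1, la ^+ j * v.2) : plane).
  by apply: box_diag => //; rewrite normrX ?exprn_ege1 ?exprn_ile1// ltW.
apply: box_le bj; rewrite normrX mulrCA ler_piMr ?(ltW r0)//.
by rewrite ler_pdivrMr// mul1r ler_weXn2l ?(ltW mu1)// ltnW.
Qed.

Lemma signed_transport f F q ka r mu la : continuous f -> injective f ->
  (forall x, F (f x) = f (F x)) -> signed_saddle F q ka r mu la ->
  signed_saddle F (f q) (fun v => f (ka v)) r mu la.
Proof.
move=> cf jf com [r0 mu1 la0 la1 kq kc ki kF]; split=> //.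
- by rewrite kq.
- by apply: (contin_comp (B := setT) kc (contin_continuous cf)).
- by move=> u v hu hv /jf; exact: ki.
- by move=> v bv; rewrite com kF.
Qed.

Lemma signed_saddle_form F q ka r mu la : signed_saddle F q ka r mu la -> 1 < mu -> la < 1 ->
  saddle_form R F q.
Proof.
move=> [r0 mu1 la0 la1 kq kc ki kF] m1 l1.
have sub : box r `<=` (box (`|mu| * r) : set plane) by apply: box_le; rewrite ler_peMl// ltW.
exists ka, (fun v => (mu * v.1, la * v.2)), mu, la, (box r); split; split=> //.
- exact: box_nbhs.
- exact: contin_sub kc.
- by move=> u v; rewrite !inE => /sub hu /sub hv; apply: ki; rewrite inE.
- apply: contin_pair; (apply: continM; first exact: contin_cst).
    by apply: contin_fst; exact: contin_id.
  by apply: contin_snd; exact: contin_id.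
- move=> t t0; apply: filterS (@filterT _ (nbhs (0 : plane)) _) => v _.
  by rewrite subrr /sq /= expr0n addr0 mulr_ge0 ?(ltW t0)// addr_ge0 ?sqr_ge0.
- by apply: filterS (box_nbhs r0) => v bv; rewrite kF.
Qed.

End Signed.

Section Twisted.
Variables (R : realType) (T : topologicalType).
Notation plane := (R * R)%type.
Implicit Types (f finv F : T -> T) (ka k : plane -> T) (mu la : R).

Lemma circle_box (r d : R) : 0 <= r -> r <= d -> circle r `<=` (box d : set plane).
Proof.
move=> r0 rd v /circle_disk dv; have [h1 h2] := abs_le_sq r0 dv.
by split; [exact: le_trans rd|exact: le_trans rd].
Qed.

(* If [la > 0] then [f^n] is homotopic near [q] to the reflection [rho] in the second axis, so that
   [phi o rho] and [phi] are homotopic for the chart [phi]; as [phi * (phi o rho)] is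
   null-homotopic, being invariant under [rho], so is [phi ^ 2]. *)
Lemma signed_orientation (A : set (chart R T)) f n q ka (r mu la : R) : continuous f -> injective f ->
  oriented_atlas A -> orient_pres A f -> signed_saddle (iter n f) q ka r mu la ->
  iter n f q = q -> mu < 0 -> la < 0.
Proof.
move=> cf jf [Ach Acov _] oA [r0 mu1 la0 la1 kq kc ki kF] fq mun; rewrite ltNge; apply/negP => lage.
have lap : 0 < la by rewrite lt_neqAle lage andbT eq_sym -normr_gt0.
have [C CE] := choice Acov.
have AC y : A (C y) by have [] := CE y.
have dC y : ch_dom (C y) y by have [] := CE y.
have iC y : is_chart (C y) by exact: Ach.
have b0 : 0 < `|mu| * r by rewrite mulr_gt0// (lt_trans ltr01).
have cfi i : continuous (iter i f) by exact: iter_continuous.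
have jfi i : injective (iter i f) by elim: i => [//|i IH] x y /jf /IH.
(* The [i]-th image of a small loop around [q], read in the chart at [f^i q]. By [orient_step] all
   of them are homotopic, and for [i = n] the chart is again the one at [q]. *)
pose u i v := ch_map (C (iter i f q)) (iter i f (ka v)) - ch_map (C (iter i f q)) (iter i f q).
have ku v : box (`|mu| * r) v -> ka v = q -> v = 0.
  move=> bv E; apply: ki; rewrite ?inE ?kq//; apply: box0; exact: ltW.
have oq : open (ch_dom (C q)) by case: (iC q).
have nN : nbhs (0 : plane) [set v | box (`|mu| * r) v /\ ch_dom (C q) (ka v)].
  have nq : nbhs (ka 0) (ch_dom (C q)) by rewrite kq; exact: (open_nbhs_nbhs (conj oq (dC q))).
  have H : nbhs (0 : plane) [set v | box (`|mu| * r) v -> ch_dom (C q) (ka v)] :=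
    kc _ (box0 (ltW b0)) _ nq.
  by apply: filterS2 (box_nbhs b0) H => v bv /(_ bv).
have [d d0 dE] := nbhs_box nN.
have cphi : contin (box d) (fun v => ch_map (C q) (ka v)).
  apply: (contin_comp (f := ka) _ (chart_contin (iC q))) => [|v /dE[]//].
  by apply: contin_sub kc => v /dE[].
have u00 v : box d v -> v <> 0 -> u 0%N v <> 0.
  move=> /dE[bv dv] v0 /eqP; rewrite subr_eq0 => /eqP /(chart_inj (iC q) dv (dC q)) E.
  exact: v0 (ku v bv E).
have circ0 (rho : R) v : 0 < rho -> circle rho v -> v <> 0.
  move=> rp cv v0; move: cv; rewrite v0 /circle /sq /= expr0n /= addr0 => /eqP.
  by rewrite eq_sym expf_eq0 /= gt_eqF.
have S i : exists2 r1, 0 < r1 & forall rho, 0 < rho <= r1 -> sim (circle rho) (u i) (u 0%N).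
  elim: i => [|i [r1 r10 H]].
    exists d => // rho /andP[rp rd]; apply: sim_refl => v cv; apply: u00.
      exact: (circle_box (ltW rp) rd).
    exact: circ0 cv.
  have ci : contin (box (`|mu| * r)) (fun v => iter i f (ka v)).
    exact: (contin_comp (B := setT) kc (contin_continuous (cfi i))).
  have ii : {in box (`|mu| * r) &, injective (fun v => iter i f (ka v))}.
    by move=> v v' hv hv' /jfi; exact: ki.
  have k0 : iter i f (ka 0) = iter i f q by rewrite kq.
  have [r2 r20 H2] := orient_step cf jf oA (AC (iter i f q)) (AC (iter i.+1 f q)) (iC _) (iC _)
    (dC _) (dC (iter i.+1 f q)) b0 ci ii k0.
  exists (Num.min r1 r2); first by rewrite lt_min r10.
  move=> rho; rewrite le_min => /andP[rp /andP[h1 h2]].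
  by apply: (sim_trans (H2 rho _)); [rewrite rp|apply: H; rewrite rp].
have {S} [r1 r10 S] := S n.
pose rho := Num.min r1 (Num.min r (d / `|mu|)).
have mu0 : 0 < `|mu| by exact: lt_trans ltr01 mu1.
have rp : 0 < rho by rewrite !lt_min r10 r0 divr_gt0.
have rr : rho <= r by rewrite /rho !ge_min lexx orbT.
have md : `|mu| * rho <= d by rewrite mulrC -ler_pdivlMr// /rho !ge_min lexx !orbT.
have rd : rho <= d by apply: le_trans md; rewrite ler_peMl ?(ltW rp) ?(ltW mu1).
have {}S : sim (circle rho) (u n) (u 0%N) by apply: S; rewrite rp /rho ge_min lexx.
(* A path of invertible diagonal matrices from [diag (mu, la)] to the reflection [diag (-1, 1)]: the
   first entry stays negative, the second positive. *)
pose K (z : plane * R) : plane :=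
  (((1 - z.2) * mu - z.2) * z.1.1, ((1 - z.2) * la + z.2) * z.1.2).
have Kb z : cyl (circle rho) z -> box d (K z).
  move=> [cz /andP[s0 s1]]; have [h1 h2] := circle_box (ltW rp) (lexx rho) cz.
  have muE : `|mu| = - mu by rewrite ltr0_norm.
  have a1 : `|(1 - z.2) * mu - z.2| <= `|mu|.
    by move: mu1; rewrite muE => m1; rewrite ler_norml; apply/andP; split; move: m1 s0 s1; clear; nra.
  have a2 : `|(1 - z.2) * la + z.2| <= `|mu|.
    move: la1; rewrite gtr0_norm// => l1; apply: le_trans (ltW mu1).
    by rewrite ler_norml; apply/andP; split; move: l1 lap s0 s1; clear; nra.
  by split; rewrite /= normrM; apply: le_trans md; exact: ler_pM.
have Kn z : cyl (circle rho) z -> K z <> 0.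
  move=> [cz /andP[s0 s1]] [E1 E2]; apply: (circ0 rho z.1 rp cz); apply: pairE => /=.
    move/eqP: E1; rewrite mulf_eq0 => /orP[/eqP E|/eqP//].
    by exfalso; move: E s0 s1 mun; clear; nra.
  move/eqP: E2; rewrite mulf_eq0 => /orP[/eqP E|/eqP//].
  by exfalso; move: E s0 s1 lap; clear; nra.
have cK : contin (cyl (circle rho)) K.
  apply: contin_pair; apply: continM.
  - apply: continB; last exact: contin_idsnd.
    apply: continM; last exact: contin_cst.
    by apply: continB; [exact: contin_cst|exact: contin_idsnd].
  - by apply: contin_fst; exact: contin_idfst.
  - apply: continD; last exact: contin_idsnd.
    apply: continM; last exact: contin_cst.
    by apply: continB; [exact: contin_cst|exact: contin_idsnd].
  - by apply: contin_snd; exact: contin_idfst.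
have cu0 : contin (box d) (u 0%N) by apply: contin_subp; [exact: cphi|exact: contin_cst].
have cH : contin (cyl (circle rho)) (fun z => u 0%N (K z)) by exact: contin_comp cK cu0 Kb.
have Hn z : cyl (circle rho) z -> u 0%N (K z) <> 0.
  by move=> cz; apply: u00; [exact: Kb|exact: Kn].
have S2 := homotopy_sim (compact_circle (ltW rp)) cH Hn.
have cbr : circle rho `<=` (box rho : set plane) by exact: circle_box (ltW rp) (lexx rho).
have S3 : sim (circle rho) (fun v => u 0%N (- v.1, v.2)) (u 0%N).
  apply: (sim_trans (sim_sym (nul_ext S2 _)) S) => v cv.
  rewrite /K /= !subr0 !subrr !mul0r !mul1r !sub0r !add0r !addr0 mulN1r mul1r; congr cm.
  rewrite /u fq kF//; exact: (box_le rr (cbr _ cv)).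
have bd' v : box d v -> box d ((- v.1, v.2) : plane) by move=> [h1 h2]; split; rewrite /= ?normrN.
have cd : circle rho `<=` box d by exact: subset_trans cbr (box_le rd).
have cu1 : contin (circle rho) (fun v => u 0%N (- v.1, v.2)).
  apply: (contin_comp _ cu0) => [|v /cd/bd'//].
  apply: contin_pair; last by apply: contin_snd; exact: contin_id.
  by apply: continN; apply: contin_fst; exact: contin_id.
have nf : nul (circle rho) (fun v => cm (u 0%N v) (u 0%N (- v.1, v.2))).
  apply: nul_fold => //.
  - by apply: contin_cm => //; exact: contin_sub cu0.
  - move=> v cv; apply: cm_neq0; apply: u00.
    + exact: cd.
    + exact: circ0 cv.
    + by apply: bd'; exact: cd.
    + move=> [/eqP]; rewrite oppr_eq0 => /eqP E1 E2.
      by apply: (circ0 rho v rp cv); exact: pairE.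
  - by move=> v _ /=; rewrite opprK -surjective_pairing /cm; apply: pairE => /=; ring.
have n2 : nul (circle rho) (fun v => cm (u 0%N v) (u 0%N v)).
  apply: (nul_scale (nul_cm (nul_cj S3) nf)) => v cv.
  have [/sq_gt0 v0 _] := sim_neq0 S3 cv.
  exists (sq (u 0%N (- v.1, v.2)))^-1; first by rewrite invr_gt0.
  move: (u 0%N (- v.1, v.2)) (u 0%N v) v0 => x y; rewrite /sq => x0.
  by apply: pairE; rewrite /cm /cj /sc /=; field; rewrite gt_eqF.
have n1 : nul (circle rho) (u 0%N).
  by apply: nul_sqrt n2; [exact: connected_circle|exact: contin_sub cu0].
have dd : disk rho `<=` (box d : set plane).
  move=> v dv; have [h1 h2] := abs_le_sq (ltW rp) dv.
  by split; exact: le_trans rd.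
apply: (@injective_not_nul R rho (fun v => ch_map (C q) (ka v)) rp).
- exact: contin_sub cphi.
- move=> v v'; rewrite !inE => /dd/dE[b1 d1] /dd/dE[b2 d2] /(chart_inj (iC q) d1 d2).
  by apply: ki; rewrite inE.
- by apply: (nul_ext n1) => v _; rewrite /u kq.
Qed.

(** By invariance of domain the image in a boundary chart would contain a full neighbourhood of a
    point of the axis, including a point below it. *)
Lemma param_not_boundary (N : set plane) k z : contin N k -> {in N &, injective k} ->
  nbhs z N -> ~ boundary_pt R (k z).
Proof.
move=> ck ik Nz [c [ic dc [W0 [oW imE]] c0]].
have oc : open (ch_dom c) by case: ic.
have H : nbhs z [set v | N v -> ch_dom c (k v)] :=
  ck _ (nbhs_singleton Nz) _ (open_nbhs_nbhs (conj oc dc)).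
pose M := [set v | N v /\ ch_dom c (k v)].
have nM : nbhs z M by apply: filterS2 Nz H => v Nv /(_ Nv).
have cphi : contin M (fun v => ch_map c (k v)).
  apply: (contin_comp (f := k) _ (chart_contin ic)) => [|v []//].
  by apply: contin_sub ck => v [].
have iphi : {in M &, injective (fun v => ch_map c (k v))}.
  move=> u v; rewrite !inE => -[Nu du] [Nv dv] /(chart_inj ic du dv).
  by apply: ik; rewrite inE.
have /nbhs_translate[e e0 eE] := invariance_of_domain nM cphi iphi.
have be : box e ((0, - e) : plane) by split; rewrite /= ?normr0 ?normrN ?gtr0_norm ?(ltW e0).
have [v [_ dv] vE] := eE _ be.
have : ch_img c (ch_map c (k v)) by case: ic => _ [h _]; case: (h _ dv).
by rewrite imE vE => -[_]; rewrite /halfplane /= c0 add0r leNgt oppr_lt0 e0.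
Qed.

Lemma open_nm (b : R) : open [set v : plane | nm v < b].
Proof.
rewrite openE => v /= vb.
have c : contin setT (fun v : plane => - nm v).
  apply: continN; apply: contin_max; apply: contin_norm.
    by apply: contin_fst; exact: contin_id.
  by apply: contin_snd; exact: contin_id.
have := contin_gt (c := - b) c I (_ : - b < - nm v); rewrite ltrN2 => /(_ vb).
by apply: filterS => t /(_ I); rewrite /= ltrN2.
Qed.

(** The diagonalizing chart is the inverse of [ka] on an open box, which is open in the surface by
    [open_param]. *)
Lemma signed_twisted F q ka (r mu la : R) : surface R T -> signed_saddle F q ka r mu la ->
  mu < 0 -> la < 0 -> twisted_saddle R F q.
Proof.
move=> sT [r0 mu1 la0 la1 kq kc ki kF] mun lan.
have mup : 0 < `|mu| by exact: lt_trans ltr01 mu1.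
pose b := `|mu| * r; have b0 : 0 < b by rewrite mulr_gt0.
have muE : `|mu| = - mu by rewrite ltr0_norm.
have laE : `|la| = - la by rewrite ltr0_norm.
pose U := [set v : plane | nm v < b].
have UB : U `<=` box b.
  by move=> v; rewrite /U /nm /= gt_max => /andP[h1 h2]; split; exact: ltW.
have nm0 : nm 0 = 0 :> R by rewrite /nm /= normr0; exact: maxxx.
have oU : open U by exact: open_nm.
have U0 : U 0 by rewrite /U /= nm0.
have B0 : (box b : set plane) !=set0 by exists 0; apply: box0; exact: ltW.
have [kap [ckap kaK kapK]] := contin_inverse sT.1 (@compact_boxset R b) kc ki B0.
have iU : {in U &, injective ka} by move=> u v; rewrite !inE => /UB hu /UB hv; apply: ki; rewrite inE.
have cU : contin U ka by exact: contin_sub kc.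
split; first by rewrite -kq kF /= ?mulr0//; apply: box0; exact: ltW.
split; first by rewrite -kq; exact: (param_not_boundary cU iU (open_nbhs_nbhs (conj oU U0))).
exists mu, la; split=> //.
- by move: mu1; rewrite muE; clear; lra.
- by move: la1; rewrite laE; clear; lra.
exists (Chart (ka @` U) kap ka U), [set v | nm v < r] => /=.
have rb : r < b by rewrite /b ltr_pMl.
split; [split; [|split; [|split; [|split; [|split]]]] => /=|split; [|split; [|split; [|split; [|split]]]]] => //=.
- rewrite openE => _ [v Uv <-]; exact: (open_param sT cU iU (open_nbhs_nbhs (conj oU Uv))).
- by move=> _ [v Uv <-]; rewrite kaK//; exact: UB.
- by move=> v Uv; split; [exists v|rewrite kaK//; exact: UB].
- by apply/continP; apply: contin_sub ckap => _ [v Uv <-]; exists v => //; exact: UB.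
- exact/continP.
- by left.
- by exists 0.
- by rewrite -kq kaK//; exact: UB.
- exact: open_nm.
- by rewrite nm0.
- by move=> v /= vr; exact: lt_trans rb.
- move=> v /= vr.
  have bv : box r v by move: vr; rewrite /nm gt_max => /andP[h1 h2]; split; exact: ltW.
  have Uv : U (mu * v.1, la * v.2).
    move: vr; rewrite /U /nm /= !gt_max !normrM => /andP[h1 h2].
    rewrite ltr_pM2l// h1 /=; apply: le_lt_trans rb; apply: le_trans (ltW h2).
    by rewrite ler_piMl// ltW.
  by rewrite kF//; split; [exists (mu * v.1, la * v.2)|rewrite kaK//; exact: UB].
Qed.

End Twisted.

(** * Smooth hyperbolic points *)

Section Linearized.
Variables (R : realType) (T : topologicalType).
Notation plane := (R * R)%type.
Implicit Types (f finv F : T -> T) (ka k : plane -> T) (mu la : R).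

(** The new parametrization is [k] after the inverse of the linearizing map; its radius is such that
    a point and its linear image both lie in the image of that map. *)
Lemma signed_of_strict F q k (h : plane -> plane) (mu la d0 : R) : 0 < d0 -> contin (box d0) k ->
  {in box d0 &, injective k} -> k 0 = q -> h 0 = 0 -> strict_diag h mu la ->
  {in box d0 &, injective h} -> (forall v, box d0 v -> F (k v) = k (h v)) ->
  1 < `|mu| -> `|la| < 1 -> exists ka r la', signed_saddle F q ka r mu la'.
Proof.
move=> d00 ck ik k0 h0 sd ih kF mu1 la1.
have [Psi [la' [/andP[la0' la1'] cP iP P0 [r r0 PE]]]] := linearize h0 sd d00 ih mu1 la1.
pose s := Num.min r d0; have s0 : 0 < s by rewrite lt_min r0.
have sr : box s `<=` (box r : set plane) by apply: box_le; rewrite ge_min lexx.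
have sd0 : box s `<=` (box d0 : set plane) by apply: box_le; rewrite ge_min lexx orbT.
have B0 : (box s : set plane) !=set0 by exists 0; apply: box0; exact: ltW.
have cPs : contin (box s) Psi by exact: contin_continuous.
have iPs : {in box s &, injective Psi} by exact: in2W.
have [psi [cpsi PK psiK]] := contin_inverse (@plane_hausdorff R) (@compact_boxset R s) cPs iPs B0.
have := invariance_of_domain (box_nbhs s0) cPs iPs; rewrite P0 => /nbhs_box[r1 r10 r1P].
have mup : 0 < `|mu| by exact: lt_trans ltr01 mu1.
have bE : `|mu| * (r1 / `|mu|) = r1 by rewrite mulrC divfK// gt_eqF.
exists (fun v => k (psi v)), (r1 / `|mu|), la'; split=> //; rewrite ?bE.
- by rewrite divr_gt0.
- by rewrite -P0 PK//; apply: box0; exact: ltW.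
- apply: (contin_comp (f := psi) _ ck) => [|v /r1P/psiK[/sd0]//].
  exact: contin_sub cpsi.
- move=> u v; rewrite !inE => /r1P/psiK[u1 u2] /r1P/psiK[v1 v2] E.
  by rewrite -u2 -v2; congr Psi; apply: ik; rewrite ?inE//; exact: sd0.
- move=> v bv; have bv' : box r1 v.
    by apply: box_le bv; rewrite ler_pdivrMr// ler_peMr ?(ltW r10)// ltW.
  have [v1 v2] := psiK _ (r1P _ bv').
  have bm : box r1 ((mu * v.1, la' * v.2) : plane).
    by rewrite -bE; apply: box_diag => //; exact: ltW.
  have [w1 w2] := psiK _ (r1P _ bm).
  rewrite (kF _ (sd0 _ v1)); congr k; apply: iP.
  by rewrite w2 PE ?v2//; exact: sr.
Qed.

Lemma derive_along (g : plane -> plane) (pr : plane -> R) (y v : plane) (t : R) : continuous pr ->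
  (forall c u, pr (c *: u) = c * pr u) -> (forall u u', pr (u - u') = pr u - pr u') ->
  differentiable g (y + t *: v) ->
  is_derive t 1 (fun s => pr (g (y + s *: v))) (pr ('d g (y + t *: v) v)).
Proof.
move=> cpr prZ prB dg; set x := y + t *: v.
have dv : derivable g x v by exact: diff_derivable.
have H : (fun s : R => s^-1 *: (g (s *: v + x) - g x)) @ 0^' --> 'd g x v.
  by rewrite -deriveE//; exact: dv.
have H2 : (fun s : R => s^-1 *: (((fun s => pr (g (y + s *: v))) \o shift t) (s *: 1) -
    pr (g x))) @ 0^' --> pr ('d g x v).
  have := cvg_comp _ _ H (cpr ('d g x v)); apply: cvg_trans; apply: near_eq_cvg.
  near=> s; rewrite /= prZ prB; congr (_ * (pr (g _) - _)).
  by rewrite /x [s *: 1]mulr1 scalerDl addrCA.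
split; first by apply/cvg_ex; exists (pr ('d g x v)).
exact: cvg_lim H2.
Unshelve. all: by end_near. Qed.

(** The mean value theorem is scalar, so it is stated for one coordinate [pr], known only to be
    linear and continuous; the intermediate point may differ from one coordinate to the other. *)
Lemma mvt_plane (g : plane -> plane) (pr : plane -> R) (y v : plane) : continuous pr ->
  (forall c u, pr (c *: u) = c * pr u) -> (forall u u', pr (u - u') = pr u - pr u') ->
  (forall t : R, 0 <= t <= 1 -> differentiable g (y + t *: v)) ->
  exists2 t : R, 0 <= t <= 1 & pr (g (y + v)) - pr (g y) = pr ('d g (y + t *: v) v).
Proof.
move=> cpr prZ prB dg.
pose phi s := pr (g (y + s *: v)).
have D (t : R) : 0 <= t <= 1 -> is_derive t 1 phi (pr ('d g (y + t *: v) v)).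
  by move=> ht; apply: derive_along => //; exact: dg.
have [t||t ht E] := @MVT R phi (fun t => pr ('d g (y + t *: v) v)) 0 1 ltr01.
- by rewrite in_itv /= => /andP[t0 t1]; apply: D; rewrite !ltW.
- apply: derivable_within_continuous => t; rewrite in_itv /= => ht.
  by have [] := D t ht.
exists t; first by move: ht; rewrite in_itv /= => /andP[t0 t1]; rewrite !ltW.
by move: E; rewrite subr0 mulr1 /phi scale1r scale0r addr0.
Qed.

Lemma diff_plane (g : plane -> plane) (z v : plane) :
  'd g z v = v.1 *: 'd g z (1, 0) + v.2 *: 'd g z (0, 1).
Proof.
rewrite -!linearZ -linearD; congr ('d g z _).
by apply: pairE; rewrite /= [_ *: 1]mulr1 [_ *: 0]mulr0 ?addr0 ?add0r.
Qed.

Lemma diff_pr (g : plane -> plane) (pr : plane -> R) (z v : plane) :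
  (forall u u', pr (u + u') = pr u + pr u') -> (forall c u, pr (c *: u) = c * pr u) ->
  pr ('d g z v) = v.1 * pr ('d g z (1, 0)) + v.2 * pr ('d g z (0, 1)).
Proof.
by move=> prD prZ; apply: (etrans (congr1 pr (diff_plane g z v))); rewrite prD !prZ.
Qed.

Lemma linear_gap (v : plane) (x y p q p' q' e : R) :
  x = v.1 * p' + v.2 * q' -> y = v.1 * p + v.2 * q -> `|p - p'| < e / 2 -> `|q - q'| < e / 2 ->
  `|x - y| <= e * nm v.
Proof.
move=> -> -> h1 h2.
have [n1 n2] : `|v.1| <= nm v /\ `|v.2| <= nm v by rewrite /nm !le_max !lexx orbT.
have -> : v.1 * p' + v.2 * q' - (v.1 * p + v.2 * q) = - (v.1 * (p - p') + v.2 * (q - q')) by ring.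
rewrite normrN; apply: (le_trans (ler_normD _ _)); rewrite !normrM.
have -> : e * nm v = nm v * (e / 2) + nm v * (e / 2) by field.
by apply: lerD; apply: ler_pM => //; exact: ltW.
Qed.

(** The box is convex, so the mean value theorem applies on the segment from [y] to [x], where the
    partial derivatives differ from those at [z0] by less than [e / 2]. *)
Lemma C1_strict (g : plane -> plane) (Q : set plane) (z0 : plane) (pr : plane -> R) (e : R) :
  open Q -> Q z0 -> C1_on g Q -> continuous pr ->
  (forall c u, pr (c *: u) = c * pr u) -> (forall u u', pr (u - u') = pr u - pr u') -> 0 < e ->
  exists2 d, 0 < d & forall x y, box d x -> box d y ->
    `|pr (g (z0 + x)) - pr (g (z0 + y)) - pr ('d g z0 (x - y))| <= e * nm (x - y).
Proof.
move=> oQ Qz [dg /continP cdg] cpr prZ prB e0.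
have prD u u' : pr (u + u') = pr u + pr u'.
  by rewrite -{1}[u']opprK prB -[- u']scaleN1r prZ mulN1r opprK.
have near_d i : \forall z \near z0, `|pr (if i then 'd g z0 (1, 0) else 'd g z0 (0, 1)) -
    pr (if i then 'd g z (1, 0) else 'd g z (0, 1))| < e / 2.
  have c : contin Q (fun z => pr (if i then 'd g z (1, 0) else 'd g z (0, 1))).
    apply: (contin_comp (B := setT) _ (contin_continuous cpr)) => //.
    by case: (i); [exact: contin_fst cdg|exact: contin_snd cdg].
  have e20 : 0 < e / 2 by rewrite divr_gt0.
  have nb := nbhsx_ballx (pr (if i then 'd g z0 (1, 0) else 'd g z0 (0, 1))) _ (_ : 0 < e / 2).
  have H : nbhs z0 [set z | Q z -> ball (pr (if i then 'd g z0 (1, 0) else 'd g z0 (0, 1))) (e / 2)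
     (pr (if i then 'd g z (1, 0) else 'd g z (0, 1)))] := c _ Qz _ (nb e20).
  by apply: filterS2 (open_nbhs_nbhs (conj oQ Qz)) H => z Qz' /(_ Qz').
have /nbhs_translate[d d0 dE] : nbhs z0 [set z | [/\ Q z,
    `|pr ('d g z0 (1, 0)) - pr ('d g z (1, 0))| < e / 2 &
    `|pr ('d g z0 (0, 1)) - pr ('d g z (0, 1))| < e / 2]].
  apply: filterS3 (open_nbhs_nbhs (conj oQ Qz)) (near_d true) (near_d false) => z h1 h2 h3.
  by split.
exists d => // x y [x1 x2] [y1 y2].
have conv (t : R) : 0 <= t <= 1 -> box d (y + t *: (x - y)).
  move=> /andP[t0 t1].
  have C (a b : R) : `|a| <= d -> `|b| <= d -> `|b + t * (a - b)| <= d.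
    rewrite !ler_norml => /andP[h1 h2] /andP[h3 h4].
    by apply/andP; split; move: h1 h2 h3 h4 t0 t1; clear; nra.
  by split; exact: C.
have dg' (t : R) : 0 <= t <= 1 -> differentiable g (z0 + y + t *: (x - y)).
  by move=> ht; rewrite -addrA; apply: dg; have [] := dE _ (conv t ht).
have [t ht E] := mvt_plane cpr prZ prB dg'.
rewrite (_ : z0 + y + (x - y) = z0 + x) in E; last by rewrite -addrA; congr (_ + _); rewrite addrC subrK.
have [_ h1 h2] := dE _ (conv t ht); rewrite addrA in h1 h2.
have E2 := etrans E (diff_pr g _ _ prD prZ); have E3 := diff_pr g z0 (x - y) prD prZ.
exact: linear_gap E2 E3 h1 h2.
Qed.

End Linearized.

Section Hyperbolic.
Variables (R : realType) (T : topologicalType).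
Notation plane := (R * R)%type.
Implicit Types (f finv F : T -> T) (ka k : plane -> T) (mu la : R).

(** The columns [(p, r)] and [(q, s)] are eigenvectors: [(b, mu - a)] and [(b, la - a)] if [b] is
    nonzero, [(mu - d, c)] and [(la - d, c)] if [c] is, and the standard basis in one of the two
    orders for a diagonal matrix. *)
Lemma eigenbasis (a b c d mu la : R) : mu + la = a + d -> mu * la = a * d - b * c -> mu != la ->
  exists p q r s, [/\ p * s - q * r != 0, a * p + b * r = mu * p, c * p + d * r = mu * r,
    a * q + b * s = la * q & c * q + d * s = la * s].
Proof.
move=> tr dt ml.
have laE : la = a + d - mu by rewrite -tr; ring.
have bc : b * c = (mu - a) * (d - mu) + (mu - d) * (mu - a) + (mu - a) * (mu - d).
  have : b * c = a * d - mu * la by rewrite dt; ring.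
  by rewrite laE => ->; ring.
have [b0|b0] := eqVneq b 0; last first.
  exists b, b, (mu - a), (la - a); split; try by rewrite ?laE; ring: bc.
  rewrite (_ : _ - _ = b * (la - mu)); last by ring.
  by rewrite mulf_neq0// subr_eq0 eq_sym.
have [c0|c0] := eqVneq c 0; last first.
  exists (mu - d), (la - d), c, c; split; try by rewrite ?laE; ring: bc.
  rewrite (_ : _ - _ = c * (mu - la)); last by ring.
  by rewrite mulf_neq0// subr_eq0.
have : (mu - a) * (mu - d) == 0.
  by move: bc; rewrite b0 mul0r => h; apply/eqP; rewrite [RHS]h; ring.
rewrite b0 c0 mulf_eq0 !subr_eq0 => /orP[/eqP E|/eqP E].
  by exists 1, 0, 0, 1; rewrite laE E; split; rewrite ?oner_eq0 ?mulr0 ?mulr1 ?subr0 ?oner_eq0//; ring.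
by exists 0, 1, 1, 0; rewrite laE E; split; rewrite ?mulr0 ?mulr1 ?sub0r ?oppr_eq0 ?oner_eq0//; ring.
Qed.

Lemma eigenvalue_mx2 (K : fieldType) (M : 'M[K]_2) (l : K) : eigenvalue M l ->
  (l - M ord0 ord0) * (l - M ord_max ord_max) = M ord0 ord_max * M ord_max ord0.
Proof.
move=> /eigenvalueP[v vM v0].
have E0 : v 0 ord0 * M ord0 ord0 + v 0 ord_max * M ord_max ord0 = l * v 0 ord0.
  have := congr1 (fun B : 'rV_2 => B 0 ord0) vM; rewrite !mxE big_ord_recr big_ord1 /= => <-.
  by congr (v _ _ * M _ _ + _); apply: val_inj.
have E1 : v 0 ord0 * M ord0 ord_max + v 0 ord_max * M ord_max ord_max = l * v 0 ord_max.
  have := congr1 (fun B : 'rV_2 => B 0 ord_max) vM; rewrite !mxE big_ord_recr big_ord1 /= => <-.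
  by congr (v _ _ * M _ _ + _); apply: val_inj.
have [z0|n0] := eqVneq (v 0 ord0) 0; last first.
  apply: (mulfI n0); have h1 : v 0 ord_max * M ord_max ord0 = (l - M ord0 ord0) * v 0 ord0.
    by rewrite mulrBl -E0; ring.
  have h2 : (l - M ord_max ord_max) * v 0 ord_max = v 0 ord0 * M ord0 ord_max.
    by rewrite mulrBl -E1; ring.
  by rewrite [LHS](_ : _ = (l - M ord_max ord_max) * (v 0 ord_max * M ord_max ord0));
    [rewrite mulrA h2; ring|rewrite h1; ring].
have n1 : v 0 ord_max != 0.
  apply: contra v0 => /eqP z1; apply/eqP/rowP => j; rewrite mxE.
  by case: j => -[|[|//]] hj; [rewrite -[RHS]z0|rewrite -[RHS]z1]; congr (v _ _); exact: val_inj.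
move: E0 E1; rewrite z0 !mul0r !add0r mulr0 => /eqP.
rewrite mulf_eq0 (negbTE n1) /= => /eqP -> /eqP; rewrite mulrC -subr_eq0 -mulrBl mulf_eq0 (negbTE n1) orbF.
by rewrite subr_eq0 => /eqP ->; rewrite subrr !mulr0.
Qed.

(** The two roots have different moduli, whereas non-real roots of a real quadratic polynomial are
    conjugate. *)
Lemma real_eigenvalues (a b c d : R) (l1 l2 : R[i]) :
  (l1 - (a%:C)%C) * (l1 - (d%:C)%C) = (b%:C)%C * (c%:C)%C ->
  (l2 - (a%:C)%C) * (l2 - (d%:C)%C) = (b%:C)%C * (c%:C)%C ->
  1 < `|l1| -> `|l2| < 1 ->
  exists mu la, [/\ 1 < `|mu|, `|la| < 1, mu + la = a + d & mu * la = a * d - b * c].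
Proof.
move=> E1 E2 n1 n2.
have l12 : l1 - l2 != 0.
  by rewrite subr_eq0; apply/eqP => E; move: n1; rewrite E => n1; have := lt_trans n1 n2; rewrite ltxx.
have tr : l1 + l2 = (a%:C)%C + (d%:C)%C.
  apply/eqP; rewrite -subr_eq0; apply/eqP; apply: (mulfI l12); rewrite mulr0.
  by transitivity ((l1 - (a%:C)%C) * (l1 - (d%:C)%C) - (l2 - (a%:C)%C) * (l2 - (d%:C)%C));
    [ring|rewrite E1 E2 subrr].
have dt : l1 * l2 = (a%:C)%C * (d%:C)%C - (b%:C)%C * (c%:C)%C.
  have -> : l2 = (a%:C)%C + (d%:C)%C - l1 by rewrite -tr; ring.
  by rewrite -E1; ring.
move: n1 n2 {E1 E2 l12} tr dt; case: l1 => x1 y1; case: l2 => x2 y2.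
rewrite !normc_def /= -[1]/((1%:C)%C) !ltcR => n1 n2.
move=> /eqP; rewrite eq_complex /= => /andP[/eqP t1 /eqP t2].
move=> /eqP; rewrite eq_complex /= => /andP[/eqP d1 /eqP d2].
have y2E : y2 = - y1 by move: t2; clear; lra.
have : y1 * (x2 - x1) == 0 by apply/eqP; move: d2; rewrite y2E; clear; lra.
rewrite mulf_eq0 subr_eq0 => /orP[/eqP y0|/eqP xE]; last first.
  by move: n2; rewrite y2E xE sqrrN => n2; have := lt_trans n1 n2; rewrite ltxx.
move: n1 n2 d1; rewrite y2E y0 oppr0 expr0n !addr0 !sqrtr_sqr => n1 n2 d1.
by exists x1, x2; split=> //; move: d1; clear; lra.
Qed.

Lemma strict_conjugate (g : plane -> plane) (Q : set plane) (z0 : plane) (p q r s mu la : R) :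
  open Q -> Q z0 -> C1_on g Q -> p * s - q * r != 0 ->
  ('d g z0 (1, 0)).1 * p + ('d g z0 (0, 1)).1 * r = mu * p ->
  ('d g z0 (1, 0)).2 * p + ('d g z0 (0, 1)).2 * r = mu * r ->
  ('d g z0 (1, 0)).1 * q + ('d g z0 (0, 1)).1 * s = la * q ->
  ('d g z0 (1, 0)).2 * q + ('d g z0 (0, 1)).2 * s = la * s ->
  let P (v : plane) : plane := z0 + (p * v.1 + q * v.2, r * v.1 + s * v.2) in
  strict_diag (fun v => let w := g (P v) - z0 in
    ((s * w.1 - q * w.2) / (p * s - q * r), (p * w.2 - r * w.1) / (p * s - q * r))) mu la.
Proof.
move=> oQ Qz C1 D0 e11 e21 e12 e22 P e e0.
pose C := `|p| + `|q| + `|r| + `|s|; pose D := p * s - q * r.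
have aC : [/\ `|p| + `|q| <= C, `|r| + `|s| <= C, `|s| + `|q| <= C & `|p| + `|r| <= C].
  have := normr_ge0 p; have := normr_ge0 q; have := normr_ge0 r; have := normr_ge0 s.
  by rewrite /C; clear; move=> *; split; lra.
have C0 : 0 < C.
  rewrite lt_neqAle !addr_ge0// andbT eq_sym; apply: contra D0 => /eqP Cz.
  have := normr_ge0 p; have := normr_ge0 q; have := normr_ge0 r; have := normr_ge0 s.
  move=> h1 h2 h3 h4; have [hp hq] : `|p| = 0 /\ `|q| = 0.
    by move: Cz; rewrite /C; move: h1 h2 h3 h4; clear; move=> *; split; lra.
  by rewrite (normr0_eq0 hp) (normr0_eq0 hq) !mul0r subr0.
have Dp : 0 < `|D| by rewrite normr_gt0.
(* The change of basis costs a factor [C] and its inverse a factor [C / |D|]. *)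
pose e' := e * `|D| / (C * C).
have e'0 : 0 < e' by rewrite divr_gt0 ?mulr_gt0.
have c1 : continuous (fst : plane -> R) by move=> x; exact: cvg_fst.
have c2 : continuous (snd : plane -> R) by move=> x; exact: cvg_snd.
have [d1 d10 H1] := C1_strict oQ Qz C1 c1 (fun c u => erefl) (fun u u' => erefl) e'0.
have [d2 d20 H2] := C1_strict oQ Qz C1 c2 (fun c u => erefl) (fun u u' => erefl) e'0.
pose d := Num.min d1 d2 / C.
have d0 : 0 < d by rewrite divr_gt0// lt_min d10.
pose L (v : plane) : plane := (p * v.1 + q * v.2, r * v.1 + s * v.2).
have nmE (v : plane) : `|v.1| <= nm v /\ `|v.2| <= nm v by rewrite /nm !le_max !lexx orbT.
have comb (x y t k : R) (v : plane) : `|x| + `|y| <= C -> `|v.1| <= k -> `|v.2| <= k ->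
    `|x * v.1 + y * v.2| <= C * k.
  move=> h k1 k2; apply: (le_trans (ler_normD _ _)); rewrite !normrM.
  apply: (@le_trans _ _ ((`|x| + `|y|) * k)); first by rewrite mulrDl; apply: lerD; exact: ler_wpM2l.
  by apply: ler_wpM2r => //; exact: le_trans k1.
have [aC1 aC2 aC3 aC4] := aC.
have Ld v : box d v -> box d1 (L v) /\ box d2 (L v).
  have dC : C * d = Num.min d1 d2 by rewrite /d mulrC divfK// gt_eqF.
  move=> [v1 v2]; have k1 := comb p q 0 d v aC1 v1 v2; have k2 := comb r s 0 d v aC2 v1 v2.
  by split; split; rewrite /L /=; (apply: (le_trans k1) || apply: (le_trans k2));
    rewrite dC ge_min lexx ?orbT.
exists d => // z w bz bw.
have [z1 z2] := Ld z bz; have [w1 w2] := Ld w bw.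
have K1 := H1 _ _ z1 w1; have K2 := H2 _ _ z2 w2.
have LB : L z - L w = L (z - w) by apply: pairE; rewrite /L /=; ring.
have nL : nm (L z - L w) <= C * nm (z - w).
  have [n1 n2] := nmE (z - w); rewrite LB /nm ge_max; apply/andP; split.
    exact: comb.
  exact: comb.
have lc (x y m n a b t u : R) : a * x + b * y = mu * m -> a * t + b * u = la * n ->
    forall X Y, (x * X + t * Y) * a + (y * X + u * Y) * b = m * (mu * X) + n * (la * Y).
  by move=> h1 h2 X Y; transitivity ((a * x + b * y) * X + (a * t + b * u) * Y);
    [ring|rewrite h1 h2; ring].
have dE1 : ('d g z0 (L z - L w)).1 = p * (mu * (z.1 - w.1)) + q * (la * (z.2 - w.2)).
  rewrite LB; apply: (etrans (diff_pr (pr := fst) g z0 _ (fun u u' => erefl) (fun c u => erefl))).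
  exact: lc e11 e12 _ _.
have dE2 : ('d g z0 (L z - L w)).2 = r * (mu * (z.1 - w.1)) + s * (la * (z.2 - w.2)).
  rewrite LB; apply: (etrans (diff_pr (pr := snd) g z0 _ (fun u u' => erefl) (fun c u => erefl))).
  exact: lc e21 e22 _ _.
rewrite dE1 in K1; rewrite dE2 in K2.
have fin (x y E1 E2 : R) : `|x| + `|y| <= C -> `|E1| <= e' * nm (L z - L w) -> `|E2| <= e' * nm (L z - L w) ->
    `|(x * E1 + y * E2) / D| <= e * nm (z - w).
  move=> h k1 k2; rewrite normrM normfV ler_pdivrMr//.
  apply: (le_trans (comb x y 0 _ (E1, E2) h k1 k2)).
  apply: (@le_trans _ _ (C * (e' * (C * nm (z - w))))).
    by rewrite !ler_pM2l.
  by rewrite le_eqVlt; apply/orP; left; apply/eqP; rewrite /e'; field; rewrite gt_eqF.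
rewrite /P -/(L z) -/(L w) /= -/D.
split.
  rewrite (_ : _ - _ = (s * ((g (z0 + L z)).1 - (g (z0 + L w)).1 - (p * (mu * (z.1 - w.1)) + q * (la * (z.2 - w.2))))
     + (- q) * ((g (z0 + L z)).2 - (g (z0 + L w)).2 - (r * (mu * (z.1 - w.1)) + s * (la * (z.2 - w.2))))) / D).
    by apply: fin => //; rewrite normrN.
  by move: ((g _).1) ((g _).1) ((g _).2) ((g _).2) => *; rewrite /D; field.
rewrite (_ : _ - _ = (p * ((g (z0 + L z)).2 - (g (z0 + L w)).2 - (r * (mu * (z.1 - w.1)) + s * (la * (z.2 - w.2))))
   + (- r) * ((g (z0 + L z)).1 - (g (z0 + L w)).1 - (p * (mu * (z.1 - w.1)) + q * (la * (z.2 - w.2))))) / D).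
  by apply: fin => //; rewrite normrN.
by move: ((g _).1) ((g _).1) ((g _).2) ((g _).2) => *; rewrite /D; field.
Qed.

(** If the eigenvalues are neither all inside nor all outside the unit circle, there is one on each
    side; both are then real, and the eigenbasis feeds the linearization. *)
Lemma hyperbolic_trichotomy F q : injective F -> hyperbolic_fixed R F q ->
  [\/ sink_fixed R F q, source_fixed R F q |
      exists ka r mu la, signed_saddle F q ka r mu la].
Proof.
move=> jF [fq [c [Q [ic [dq [oQ [Qz [Qi [Fd [C1 hy]]]]]]]]]].
set g := fun z => ch_map c (F (ch_inv c z)) in C1 hy *; set z0 := ch_map c q in Qz hy *.
set M := map_mx _ _ in hy.
have [h|/existsNP[l1 /not_implyP[e1 n1]]] := pselect (forall l, eigenvalue M l -> `|l| < 1).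
  by apply: Or31; split=> //; exists c, Q.
have [h|/existsNP[l2 /not_implyP[e2 n2]]] := pselect (forall l, eigenvalue M l -> 1 < `|l|).
  by apply: Or32; split=> //; exists c, Q.
apply: Or33.
have {}n1 : 1 < `|l1|.
  (* The order of [R[i]] is partial, but moduli are real and hence comparable. *)
  by rewrite lt_neqAle eq_sym hy// real_leNgt ?real1 ?normr_real//; exact/negP.
have {}n2 : `|l2| < 1.
  by rewrite lt_neqAle hy// real_leNgt ?real1 ?normr_real//; exact/negP.
have E1 := eigenvalue_mx2 e1; have E2 := eigenvalue_mx2 e2.
rewrite !mxE in E1 E2.
have [mu [la [mu1 la1 tr dt]]] := real_eigenvalues E1 E2 n1 n2.
have ml : mu != la by apply/eqP => E; move: mu1; rewrite E => h; have := lt_trans h la1; rewrite ltxx.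
have [p [t [r [s [D0 e11 e21 e12 e22]]]]] := eigenbasis tr dt ml.
rewrite /= in e11 e21 e12 e22.
pose L (v : plane) : plane := (p * v.1 + t * v.2, r * v.1 + s * v.2).
pose h v := let w := g (z0 + L v) - z0 in
    ((s * w.1 - t * w.2) / (p * s - t * r), (p * w.2 - r * w.1) / (p * s - t * r)).
have SD : strict_diag h mu la := strict_conjugate oQ Qz C1 D0 e11 e21 e12 e22.
pose k v := ch_inv c (z0 + L v).
have cL : continuous L.
  apply: contin_setT; apply: contin_pair; apply: continD; (apply: continM; first exact: contin_cst);
    by [apply: contin_fst; exact: contin_id|apply: contin_snd; exact: contin_id].
have L0 : L 0 = 0 by apply: pairE; rewrite /L /= !mulr0 addr0.
have czL : continuous (fun v => z0 + L v).
  by apply: contin_setT; apply: contin_addp; [exact: contin_cst|exact: contin_continuous].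
have nQ : nbhs (0 : plane) [set v | Q (z0 + L v)].
  have zL : z0 + L 0 = z0 by rewrite L0 addr0.
  by apply: (czL 0); rewrite /= zL; exact: (open_nbhs_nbhs (conj oQ Qz)).
have [d0 d00 d0Q] := nbhs_box nQ.
have mapK z : Q z -> ch_map c (ch_inv c z) = z.
  by move=> /Qi hz; case: ic => _ [_ [H _]]; case: (H z hz).
have invK y : ch_dom c y -> ch_inv c (ch_map c y) = y.
  by move=> hy'; case: ic => _ [H _]; case: (H y hy').
have iL : injective L.
  move=> u v [h1 h2].
  have k1 : (p * s - t * r) * (u.1 - v.1) = 0.
    transitivity (s * ((p * u.1 + t * u.2) - (p * v.1 + t * v.2)) - t * ((r * u.1 + s * u.2) - (r * v.1 + s * v.2))).
      by ring.
    by rewrite h1 h2 !subrr; ring.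
  have k2 : (p * s - t * r) * (u.2 - v.2) = 0.
    transitivity (p * ((r * u.1 + s * u.2) - (r * v.1 + s * v.2)) - r * ((p * u.1 + t * u.2) - (p * v.1 + t * v.2))).
      by ring.
    by rewrite h1 h2 !subrr; ring.
  apply: pairE; apply/eqP; rewrite -subr_eq0; apply/eqP; apply: (mulfI D0); rewrite mulr0; assumption.
have Lh v : L (h v) = g (z0 + L v) - z0.
  rewrite /h -/(L v); move: (g (z0 + L v) - z0) => w.
  by apply: pairE; rewrite /L /=; field; exact: D0.
have kF v : box d0 v -> F (k v) = k (h v).
  move=> bv; rewrite /k Lh addrCA subrr addr0 /g invK//; apply: Fd; exact: d0Q.
have ik : {in box d0 &, injective k}.
  move=> u v; rewrite !inE => /d0Q hu /d0Q hv /(congr1 (ch_map c)).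
  by rewrite !mapK// => /addrI /iL.
have ck : contin (box d0) k.
  apply: (contin_comp (f := fun v => z0 + L v) _ (chart_inv_contin ic)) => [|v /d0Q/Qi//].
  exact: contin_continuous.
have k0 : k 0 = q by rewrite /k L0 addr0 invK.
have h0 : h 0 = 0.
  by apply: iL; rewrite Lh L0 addr0 /g invK// fq subrr.
have ih : {in box d0 &, injective h}.
  move=> u v hu hv E; apply: ik => //; apply: jF.
  by rewrite !kF ?E//; [move: hv|move: hu]; rewrite inE.
have [ka [b [la' S]]] := signed_of_strict d00 ck ik k0 h0 SD ih kF mu1 la1.
by exists ka, b, mu, la'.
Qed.

End Hyperbolic.

(** * Transport along an orbit, and conclusion *)

(** Carrying the chart along by [f], which commutes with [F], leaves the local representative of [F]
    unchanged, so its eigenvalues are the same. *)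
Lemma smooth_transport (R : realType) (T : topologicalType) (f finv F : T -> T) q (P : R[i] -> Prop) :
  continuous f -> continuous finv -> cancel f finv -> cancel finv f ->
  (forall x, F (f x) = f (F x)) -> smooth_fixed_with F q P -> smooth_fixed_with F (f q) P.
Proof.
move=> cf cfinv fK finvK com [fq [c [Q [[oc [c1 [c2 [c3 [c4 c5]]]]] [dq [oQ [Qz [Qi [Fd H]]]]]]]]].
split; first by rewrite com fq.
exists (Chart (finv @^-1` ch_dom c) (fun x => ch_map c (finv x)) (fun z => f (ch_inv c z)) (ch_img c)), Q.
have E : (fun z => ch_map c (finv (F (f (ch_inv c z))))) = (fun z => ch_map c (F (ch_inv c z))).
  by apply/funext => z; rewrite com fK.
split=> /=.
  split; first by move/continuousP: cfinv; apply.
  split; first by move=> x /c1[h1 h2]; split=> //=; rewrite h2 finvK.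
  split; first by move=> z /c2[h1 h2]; split=> /=; rewrite fK.
  split.
    apply/continP; apply: (contin_comp (B := ch_dom c) (contin_continuous cfinv)) => //.
    exact/continP.
  split=> //; apply/continP; apply: (contin_comp (B := setT) _ (contin_continuous cf)) => //.
  exact/continP.
rewrite fK E; split=> //; split=> //; split=> //; split=> //; split=> //.
by move=> z Qz'; rewrite com fK; exact: Fd.
Qed.

Lemma min_period_exists (T : Type) (f : T -> T) (q : T) n : (0 < n)%N -> iter n f q = q ->
  exists2 m, (m %| n)%N & [/\ (0 < m)%N, iter m f q = q & forall i, (0 < i < m)%N -> iter i f q <> q].
Proof.
move=> n0 pn.
have ex : exists m, (0 < m)%N && `[< iter m f q = q >] by exists n; rewrite n0; exact/asboolP.
case: (ex_minnP ex) => m /andP[m0 /asboolP pm] mmin.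
have mk j : iter (j * m) f q = q.
  by elim: j => [//|j IH]; rewrite mulSn iterD IH.
have nomin i : (0 < i < m)%N -> iter i f q <> q.
  move=> /andP[i0 im] pi; have := mmin i; rewrite i0 => /(_ _); rewrite leqNgt im.
  by move=> h; have := h (introT (asboolP _) pi).
exists m => //; have [//|nd] := boolP (m %| n)%N; exfalso.
apply: (nomin (n %% m)%N); first by rewrite lt0n nd ltn_pmod.
by rewrite -{2}pn {2}(divn_eq n m) addnC iterD mk.
Qed.

Lemma comm_iter (T : Type) (f : T -> T) i j x : iter i f (iter j f x) = iter j f (iter i f x).
Proof. by rewrite -!iterD addnC. Qed.

Theorem theorem2p7 (R : realType) (T : topologicalType) (A : set (chart R T))
  (f finv : T -> T) (p : T) (V : set T) (r : nat) :
  surface R T -> connected [set: T] -> oriented_atlas A ->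
  continuous f -> continuous finv -> cancel f finv -> cancel finv f ->
  orient_pres A f ->
  ~ boundary_pt R p -> direct_saddle R f p ->
  homoclinic_cell R f finv p V ->
  (forall (k : nat) (q : T), (k <= r)%N -> min_period f q (2 ^ k) ->
     orbit_of f q `<=` V ->
     forall q', orbit_of f q q' -> hyperbolic_fixed R (iter (2 ^ k) f) q') ->
  (exists (k : nat) (q : T), [/\ (k <= r)%N, min_period f q (2 ^ k),
      orbit_of f q `<=` V &
      (forall q', orbit_of f q q' -> sink_fixed R (iter (2 ^ k) f) q') \/
      (forall q', orbit_of f q q' -> source_fixed R (iter (2 ^ k) f) q')])
  \/
  (forall k : nat, (k <= r)%N ->
     exists q : T, [/\ min_period f q (2 ^ k), orbit_of f q `<=` V &
       forall q', orbit_of f q q' -> twisted_saddle R (iter (2 ^ k) f) q']).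
Proof.
move=> sT _ oA cf cfinv fK finvK oP _ ds hc hyp.
have [|nA] := pselect (exists (k : nat) (q : T), [/\ (k <= r)%N, min_period f q (2 ^ k),
      orbit_of f q `<=` V &
      (forall q', orbit_of f q q' -> sink_fixed R (iter (2 ^ k) f) q') \/
      (forall q', orbit_of f q q' -> source_fixed R (iter (2 ^ k) f) q')]); first by left.
right=> k kr; apply: contrapT => nB.
have jf : injective f by exact: can_inj fK.
have citer i : continuous (iter i f) by exact: iter_continuous.
have citerV i : continuous (iter i finv) by exact: iter_continuous.
have iK i : cancel (iter i f) (iter i finv).
  by move=> y; elim: i => [//|i IH]; rewrite iterSr iterS fK.
have iVK i : cancel (iter i finv) (iter i f).
  by move=> y; elim: i => [//|i IH]; rewrite iterSr iterS finvK.
have [io [a [mu0 [la0 [w [e [s1 [x1 [K [A1 fw mx wx VE]]]]]]]]]] := homoclinic_arms sT cf cfinv fK finvK ds hc.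
have n0 : (0 < 2 ^ k)%N by rewrite expn_gt0.
apply: (cell_index sT cf fK finvK fw mx wx A1 n0) => q pq cq.
(* The orbit is known to lie in the preimage of [V] by [f^K]. Periodicity writes [f^i q] as the
   image by [f^K] of a later point of the orbit. *)
have qV : orbit_of f q `<=` V.
  move=> _ [i _ <-].
  have pm j : iter (j * 2 ^ k) f q = q.
    by elim: j => [//|j IH]; rewrite mulSn iterD IH.
  have /VE := cq (i + (K * 2 ^ k - K))%N.
  by rewrite -iterD addnCA subnKC ?leq_pmulr// iterD pm.
have [m /dvdn_pfactor -/(_ isT)[j jk mE] [m0 pm mmin]] := min_period_exists n0 pq.
rewrite {}mE in m0 pm mmin.
have mp : min_period f q (2 ^ j) by [].
have jr : (j <= r)%N by exact: leq_trans kr.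
have hq : hyperbolic_fixed R (iter (2 ^ j) f) q by apply: (hyp j q) => //; exists 0%N.
have jF : injective (iter (2 ^ j) f) by exact: can_inj (iK _).
(* The trichotomy is applied at [q] alone; the conclusion concerns every point of the orbit. *)
have tr (P : R[i] -> Prop) i : smooth_fixed_with (iter (2 ^ j) f) q P ->
    smooth_fixed_with (iter (2 ^ j) f) (iter i f q) P.
  apply: (smooth_transport (citer i) (citerV i) (iK i) (iVK i)) => x; exact: comm_iter.
have [S|S|[ka [b [mu [la S]]]]] := hyperbolic_trichotomy jF hq.
- by case: nA; exists j, q; split=> //; left=> _ [i _ <-]; exact: tr.
- by case: nA; exists j, q; split=> //; right=> _ [i _ <-]; exact: tr.
have kE : (2 ^ k = 2 ^ (k - j) * 2 ^ j)%N by rewrite -expnD subnK.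
have FE : iter (2 ^ k) f = iter (2 ^ (k - j)) (iter (2 ^ j) f).
  by apply/funext => x; rewrite kE iterM.
have mg0 : (0 < 2 ^ (k - j))%N by rewrite expn_gt0.
have Sm := signed_iter S mg0.
have [mu1|mu1] := ltP 1 (mu ^+ (2 ^ (k - j))).
  rewrite FE; apply: (signed_saddle_form Sm) => //.
  by apply: le_lt_trans (ss_la1 Sm); exact: ler_norm.
exfalso; have jk' : j = k.
  apply/eqP; rewrite eqn_leq jk leqNgt; apply/negP => lt.
  have kj : (k - j = (k - j).-1.+1)%N by rewrite prednK// subn_gt0.
  move: mu1; rewrite leNgt => /negP; apply.
  have E : `|mu ^+ (2 ^ (k - j))| = mu ^+ (2 ^ (k - j)).
    by rewrite ger0_norm// kj expnS mulnC exprM sqr_ge0.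
  by rewrite -E; exact: ss_mu Sm.
subst j; rewrite subnn expr1 in mu1.
have mun : mu < 0.
  by rewrite ltNge; apply/negP => mup; have := ss_mu S; rewrite ger0_norm// ltNge mu1.
have lan : la < 0 := signed_orientation cf jf oA oP S pm mun.
apply: nB; exists q; split=> // _ [i _ <-].
have Si := signed_transport (citer i) (can_inj (iK i)) (fun x => comm_iter f (2 ^ k) i x) S.
exact: signed_twisted sT Si mun lan.
Qed.
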